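(* Let $B=(B_t;0\le t\le 1)$ be standard Brownian motion started at $0$ and $V(B)$ its Vervaat transform. For all $t \in [0,1]$, $$\mathbb{E}[V(B)_t]=\sqrt{\frac{8}{\pi}}\, (\sqrt{t}+\sqrt{1-t}-1)$$ and $$\mathbb{E}[V(B)_t^2]=3t+\frac{4-8t}{\pi} \arcsin\sqrt{t}-\frac{4}{\pi}\sqrt{t(1-t)}.$$
   Context: Vervaat transform: for continuous $f:[0,1]\to\mathbb{R}$ with $f(0)=0$, let $\tau(f)$ be the first time at which $f$ attains its minimum on $[0,1]$. Define $V(f)(t)=f(\tau(f)+t)-f(\tau(f))$ for $0\le t\le 1-\tau(f)$ and $V(f)(t)=f(\tau(f)+t-1)+f(1)-f(\tau(f))$ for $1-\tau(f)\le t\le 1$. *)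

(* Defs.v *)
From HB Require Import structures.
From mathcomp Require Import all_boot all_order all_algebra.
From mathcomp Require Import all_classical all_reals all_analysis.
Import Order.TTheory GRing.Theory Num.Theory.
Import numFieldNormedType.Exports.

Set Implicit Arguments.
Unset Strict Implicit.
Unset Printing Implicit Defensive.

Local Open Scope classical_set_scope.
Local Open Scope ring_scope.

(* Taking A i = setT for the irrelevant indices recovers the product rule for
   every subfamily. *)
Definition mutually_independent (d : measure_display) (T : measurableType d)
    (R : realType) (P : probability T R) (n : nat) (X : 'I_n -> T -> R) : Prop :=
  forall A : 'I_n -> set R, (forall i, measurable (A i)) ->
    P [set w | forall i, A i (X i w)] = (\prod_(i < n) P (X i @^-1` A i))%E.

(* Only the values B t for t in [0, 1] are constrained.  The increments are
   compared with normal_prob for s < t only, because the second argument of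
   normal_prob is the standard deviation and normal_prob m 0 is not the Dirac
   mass at m. *)
Record standard_brownian_motion (d : measure_display) (T : measurableType d)
    (R : realType) (P : probability T R) (B : R -> T -> R) : Prop := {
  bm_measurable : forall t, 0 <= t <= 1 -> measurable_fun [set: T] (B t) ;
  bm_start : forall w, B 0 w = 0 ;
  bm_continuous : forall w, {within `[0, 1], continuous (fun t => B t w)} ;
  bm_gaussian : forall s t, 0 <= s -> s < t -> t <= 1 ->
    forall A : set R, measurable A ->
      P [set w | A (B t w - B s w)] = normal_prob 0 (Num.sqrt (t - s)) A ;
  bm_independent : forall (n : nat) (t : nat -> R),
    0 <= t 0%N -> (forall i, (i < n)%N -> t i <= t i.+1) -> t n <= 1 ->
    mutually_independent P (fun (i : 'I_n) w => B (t i.+1) w - B (t i) w)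
}.

Definition argmin_set (R : realType) (f : R -> R) : set R :=
  [set u | 0 <= u <= 1 /\ forall v, 0 <= v <= 1 -> f u <= f v].

(* For f continuous on [0, 1] the set of minimizers is nonempty and compact, so
   its infimum is the first time at which the minimum is attained. *)
Definition first_argmin (R : realType) (f : R -> R) : R := inf (argmin_set f).

(* When f 0 = 0 both branches agree at t = 1 - first_argmin f. *)
Definition vervaat (R : realType) (f : R -> R) (t : R) : R :=
  let tau := first_argmin f in
  if t <= 1 - tau then f (tau + t) - f tau
  else f (tau + t - 1) + f 1 - f tau.

(* Main.v *)
(* Exchange argument. Let tau be the argmin and V the transform of B. On
   {tau <= 1 - t} the value V_t is the increment of B over [tau, tau + t]. On a
   grid, E[u(V_t) v(B_1 - V_t); tau <= 1 - t] is approximated by summing over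
   the steps j the probability-weighted increment of the running depth, over
   those j at which the record depth is within e of the final depth, divided by
   e. The increments are exchangeable, so the block of length t that follows
   step j may be moved to the front; the sum over j then telescopes, and what
   remains involves two independent blocks of lengths t and 1 - t with end
   values Z1, Z2 and depths M1, M2: it is
   E[u(Z1) v(Z2) 1{M1 <= e} min(M2, Z1 + e)] / e.
   The reflection principle lets e tend to 0, with limit
   E[u(Z1) v(Z2) min(M2, Z1+) 2 Z1+ / t].
   The case tau > 1 - t is the same statement for the time-reversed motion.
   Taking for u or v a square gives E[(V_t + c)^2] as an explicit Gaussian
   integral, and c = 0, 1 yield both moments; the arcsine is the probability
   that one centred Gaussian exceeds another one in absolute value. *)
Require Import Defs.
From HB Require Import structures.
From mathcomp Require Import all_boot all_order all_algebra.
From mathcomp Require Import all_classical all_reals all_analysis.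
From mathcomp Require Import measurable_realfun normal_distribution.
From mathcomp Require Import ring lra zify.
Import Order.TTheory GRing.Theory Num.Theory.
Import numFieldNormedType.Exports.

Set Implicit Arguments.
Unset Strict Implicit.
Unset Printing Implicit Defensive.

Local Open Scope classical_set_scope.
Local Open Scope ring_scope.

(** * Bounded measurable functions and laws of sequences *)

(** The obstacle is that the argmin is not a stopping time, so independence of the increments does
    not apply after it, and the exact law of a grid argmin is not tractable. Weighting step [j] by
    the growth of the running depth avoids both difficulties. On every path the weights add up to
    the smaller of the final depth and [e], up to one step size; and a step of positive weight is a
    record, which is what lets the final-depth condition split over the exchanged blocks. Two limits
    compete. For fixed [e] the mesh tends to 0 and the product side has an explicit limit; on the
    single path, concentration of the weights at the argmin needs [e] to tend to 0 as well. A bound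
    on all increments, invariant under permutation, keeps the sums dominated, and a mesh is chosen
    for each [e] by a diagonal argument. Squares are used instead of V_t because nonnegative weights
    pass from bounded to unbounded by monotone convergence, so no integrability of V_t has to be
    known beforehand. *)

Section bounded_measurable.
Context {d : measure_display} {T : measurableType d} {R : realType}.

Definition bdm (f : T -> R) :=
  measurable_fun setT f /\ exists C : R, forall w, `|f w| <= C.

Lemma bdm_cst c : bdm (fun _ => c).
Proof. by split=> //; exists `|c|. Qed.

Lemma bdmD f g : bdm f -> bdm g -> bdm (fun w => f w + g w).
Proof.
move=> [mf [C hC]] [mg [D hD]]; split; first exact: measurable_funD.
by exists (C + D) => w; rewrite (le_trans (ler_normD _ _))// lerD.
Qed.

Lemma bdmN f : bdm f -> bdm (fun w => - f w).
Proof.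
move=> [mf [C hC]]; split; first exact: measurableT_comp.
by exists C => w; rewrite normrN.
Qed.

Lemma bdmB f g : bdm f -> bdm g -> bdm (fun w => f w - g w).
Proof. by move=> hf hg; apply: bdmD => //; exact: bdmN. Qed.

Lemma bdmM f g : bdm f -> bdm g -> bdm (fun w => f w * g w).
Proof.
move=> [mf [C hC]] [mg [D hD]]; split; first exact: measurable_funM.
by exists (C * D) => w; rewrite normrM ler_pM.
Qed.

Lemma bdm_sum n (F : nat -> T -> R) :
  (forall i, (i < n)%N -> bdm (F i)) -> bdm (fun w => \sum_(i < n) F i w).
Proof.
elim: n => [|n IH] h.
  by under eq_fun do rewrite big_ord0; exact: bdm_cst.
under eq_fun do rewrite big_ord_recr/=.
apply: bdmD; last exact: h.
by apply: IH => i ni; apply: h; rewrite ltnW.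
Qed.

Lemma bdm_bool (b : T -> bool) : measurable_fun setT b -> bdm (fun w => (b w)%:R).
Proof.
move=> mb; split; last by exists 1 => w; case: (b w); rewrite ?normr1 ?normr0.
have -> : (fun w => (b w)%:R : R) = (fun w => if b w then 1 else 0).
  by apply/funext => w; case: (b w).
exact: measurable_fun_ifT.
Qed.

Variable P : probability T R.

Lemma bdm_integrable f : bdm f -> P.-integrable setT (EFin \o f).
Proof.
move=> [mf [C hC]]; apply: (@le_integrable _ _ _ P setT measurableT _ (EFin \o cst C)).
- exact/measurable_EFinP.
- move=> w _ /=; rewrite lee_fin (le_trans (hC w))// ler_norm//.
- exact: finite_measure_integrable_cst.
Qed.

Lemma ExE f : bdm f -> (\int[P]_w (f w)%:E = (\int[P]_w f w)%:E)%E.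
Proof.
move=> hf; rewrite /Rintegral fineK//.
by apply: integrable_fin_num => //; exact: bdm_integrable.
Qed.

Lemma ExD f g : bdm f -> bdm g ->
  \int[P]_w (f w + g w) = \int[P]_w f w + \int[P]_w g w.
Proof. by move=> hf hg; rewrite RintegralD//; exact: bdm_integrable. Qed.

Lemma ExB f g : bdm f -> bdm g ->
  \int[P]_w (f w - g w) = \int[P]_w f w - \int[P]_w g w.
Proof. by move=> hf hg; rewrite RintegralB//; exact: bdm_integrable. Qed.

Lemma ExZ c f : bdm f -> \int[P]_w (c * f w) = c * \int[P]_w f w.
Proof. by move=> hf; rewrite RintegralZl//; exact: bdm_integrable. Qed.

Lemma Ex_cst c : \int[P]_w c = c.
Proof. by rewrite Rintegral_cst//= probability_setT mulr1. Qed.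

Lemma Ex_sum n (F : nat -> T -> R) : (forall i, (i < n)%N -> bdm (F i)) ->
  \int[P]_w (\sum_(i < n) F i w) = \sum_(i < n) \int[P]_w F i w.
Proof.
elim: n => [|n IH] h.
  rewrite big_ord0; under eq_Rintegral do rewrite big_ord0.
  by rewrite Ex_cst.
rewrite big_ord_recr/= -IH; last by move=> i ni; apply: h; rewrite ltnW.
under eq_Rintegral do rewrite big_ord_recr/=.
rewrite ExD//; last exact: h.
by apply: bdm_sum => i ni; apply: h; rewrite ltnW.
Qed.

Lemma le_Ex f g : bdm f -> bdm g -> (forall w, f w <= g w) ->
  \int[P]_w f w <= \int[P]_w g w.
Proof. by move=> hf hg h; apply: le_Rintegral => //; exact: bdm_integrable. Qed.

Lemma le_norm_Ex f : bdm f -> `|\int[P]_w f w| <= \int[P]_w `|f w|.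
Proof. by move=> hf; apply: le_normr_Rintegral => //; exact: bdm_integrable. Qed.

Lemma bounded_cvg (f_ : nat -> T -> R) (f : T -> R) (C : R) :
  (forall n, measurable_fun setT (f_ n)) -> measurable_fun setT f ->
  (forall n w, `|f_ n w| <= C) ->
  {ae P, forall w, f_ ^~ w @ \oo --> f w} ->
  \int[P]_w f_ n w @[n --> \oo] --> \int[P]_w f w.
Proof.
move=> mf_ mf hC hcv.
have [|||||intf _ cv] := @dominated_convergence _ _ _ P setT measurableT
  (fun n => EFin \o f_ n) (EFin \o f) (EFin \o cst C).
- by move=> n; exact/measurable_EFinP.
- exact/measurable_EFinP.
- by apply: filterS hcv => w h _ /=; apply: cvg_EFin => //; exact: nearW.
- exact: finite_measure_integrable_cst.
- by apply: nearW => w n _ /=; rewrite lee_fin.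
- apply: fine_cvg; rewrite fineK//; exact: integrable_fin_num.
Qed.

End bounded_measurable.

Lemma measurable_forall_lt d (T : measurableType d) n (E : nat -> set T) :
  (forall i, (i < n)%N -> measurable (E i)) ->
  measurable [set w | forall i, (i < n)%N -> E i w].
Proof. by move=> mE; apply: (fin_bigcap_measurable (finite_II n)). Qed.

Section law_uniqueness.
Context {d d' : measure_display} {T : measurableType d} {T' : measurableType d'}.
Context {R : realType} (P : probability T R) (P' : probability T' R).
Variables (n : nat) (X : nat -> T -> R) (X' : nat -> T' -> R).
Hypothesis mX : forall i, (i < n)%N -> measurable_fun setT (X i).
Hypothesis mX' : forall i, (i < n)%N -> measurable_fun setT (X' i).
Hypothesis XX' : forall A : nat -> set R, (forall i, measurable (A i)) ->
  P [set w | forall i, (i < n)%N -> A i (X i w)] =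
  P' [set w | forall i, (i < n)%N -> A i (X' i w)].

Let tup {S : Type} (Y : nat -> S -> R) (w : S) : n.-tuple R :=
  [tuple Y (i : 'I_n) w | i < n].

Let mtup d0 (S : measurableType d0) (Y : nat -> S -> R) :
  (forall i, (i < n)%N -> measurable_fun setT (Y i)) ->
  measurable_fun setT (tup Y).
Proof.
move=> mY; apply/measurable_fun_tnthP => i.
rewrite (_ : _ \o _ = Y i); first exact: mY.
by apply/funext => w /=; rewrite tnth_mktuple.
Qed.

Let tupE S (Y : nat -> S -> R) w i : (i < n)%N -> nth 0 (tup Y w) i = Y i w.
Proof. by move=> ni; rewrite -(tnth_nth 0 _ (Ordinal ni)) tnth_mktuple. Qed.

Let rect : set (set (n.-tuple R)) :=
  [set E | exists2 A : nat -> set R, (forall i, measurable (A i)) &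
     E = [set x : n.-tuple R | forall i, (i < n)%N -> A i (nth 0 x i)]].

Let mnth i : (i < n)%N -> measurable_fun [set: n.-tuple R] (fun x => nth 0 x i).
Proof.
move=> ni; under eq_fun do rewrite -(tnth_nth 0 _ (Ordinal ni)).
exact: measurable_tnth.
Qed.

Let mrect E : rect E -> measurable E.
Proof.
move=> [A mA ->]; apply: (measurable_forall_lt (E := fun i => [set x : n.-tuple R | A i (nth 0 x i)])).
by move=> i ni; rewrite -[X in measurable X]setTI; exact: mnth.
Qed.

(** Rectangles are stable under intersection and generate the product sigma-algebra: a coordinate
    cylinder is a rectangle whose other sides are the whole line. *)
Lemma tuple_law_uniq E : measurable E ->
  pushforward P (tup X) E = pushforward P' (tup X') E.
Proof.
have mt := mtup mX; have mt' := mtup mX'.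
pose f : {mfun T >-> n.-tuple R} := HB.pack (tup X) (isMeasurableFun.Build _ _ _ _ _ mt).
pose f' : {mfun T' >-> n.-tuple R} := HB.pack (tup X') (isMeasurableFun.Build _ _ _ _ _ mt').
move=> mE.
apply: (@measure_unique _ R (n.-tuple R) rect (fun _ => setT) _ _ _ _
  (pushforward P f) (pushforward P' f')) => //.
- apply/seteqP; split; last by apply: smallest_sub;
    [exact: sigma_algebra_measurable | move=> A; exact: mrect].
  move=> A mA; apply: mA; split; first exact: smallest_sigma_algebra.
  elim/big_ind : _ => [B []|C1 C2 h1 h2 B [/h1|/h2]//|i _ B].
  move=> [D mD <-]; apply: sub_sigma_algebra.
  exists (fun j => if j == i :> nat then D else setT); first by move=> j; case: ifP.
  rewrite setTI; apply/seteqP; split => x /=.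
    move=> Dx j nj; case: ifP => // /eqP ji.
    by rewrite ji -(tnth_nth 0 _ i).
  by move=> /(_ i (ltn_ord i)); rewrite eqxx (tnth_nth 0).
- move=> E1 E2 [A1 mA1 ->] [A2 mA2 ->].
  exists (fun i => A1 i `&` A2 i); first by move=> i; exact: measurableI.
  apply/seteqP; split => x /=; first by move=> [h1 h2] i ni; split; [exact: h1|exact: h2].
  by move=> h; split => i /h [].
- by move=> _; exists (fun _ => setT) => //; apply/seteqP; split.
- by apply/seteqP; split => // x _; exists 0%N.
- move=> _ [A mA ->]; rewrite /pushforward/=.
  rewrite [X in P X = _](_ : _ = [set w | forall i, (i < n)%N -> A i (X i w)]).
    rewrite XX'//; congr (P' _); apply/seteqP; split => w /= h i ni;
      by have := h i ni; rewrite tupE.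
  apply/seteqP; split => w /= h i ni; by have := h i ni; rewrite tupE.
- by move=> _; rewrite /= /pushforward preimage_setT probability_setT ltry.
Qed.

(** The change of variables is made separately on the positive and the negative part, so [Phi] need
    not be integrable. *)
Lemma integral_law_uniq (Phi : (nat -> R) -> R) :
  (forall x y, (forall i, (i < n)%N -> x i = y i) -> Phi x = Phi y) ->
  measurable_fun [set: n.-tuple R] (fun x : n.-tuple R => Phi (fun i => nth 0 x i)) ->
  \int[P]_w Phi (fun i => X i w) = \int[P']_w Phi (fun i => X' i w).
Proof.
move=> Phi_ext mPhi.
pose F (x : n.-tuple R) := (Phi (fun i => nth 0 x i))%:E.
have mt := mtup mX; have mt' := mtup mX'.
have mF : measurable_fun setT F by exact/measurable_EFinP.
have key (G : n.-tuple R -> \bar R) : measurable_fun setT G -> (forall x, 0 <= G x)%E ->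
    (\int[P]_w G (tup X w) = \int[P']_w G (tup X' w))%E.
  move=> mG G0.
  pose f : {mfun T >-> n.-tuple R} := HB.pack (tup X) (isMeasurableFun.Build _ _ _ _ _ mt).
  pose f' : {mfun T' >-> n.-tuple R} := HB.pack (tup X') (isMeasurableFun.Build _ _ _ _ _ mt').
  have h1 := @ge0_integral_pushforward _ _ _ _ R (tup X) mt P setT G measurableT mG (fun x _ => G0 x).
  have h2 := @ge0_integral_pushforward _ _ _ _ R (tup X') mt' P' setT G measurableT mG (fun x _ => G0 x).
  rewrite preimage_setT in h1; rewrite preimage_setT in h2.
  rewrite /comp in h1 h2; rewrite -h1 -h2.
  apply: (@eq_measure_integral _ _ _ _ (pushforward P' f') (pushforward P f)) => A mA _.
  exact: tuple_law_uniq.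
have e1 w : (Phi (fun i => X i w))%:E = F (tup X w).
  by congr EFin; apply: Phi_ext => i ni; rewrite tupE.
have e2 w : (Phi (fun i => X' i w))%:E = F (tup X' w).
  by congr EFin; apply: Phi_ext => i ni; rewrite tupE.
rewrite /Rintegral; congr fine.
under eq_integral do rewrite e1.
under [RHS]eq_integral do rewrite e2.
rewrite integralE [RHS]integralE; congr (_ - _)%E.
- transitivity (\int[P]_w (F^\+)%E (tup X w))%E; first by apply: eq_integral => w _; rewrite !funeposE.
  rewrite (key _ (measurable_funepos mF) (funepos_ge0 F)).
  by apply: eq_integral => w _; rewrite !funeposE.
- transitivity (\int[P]_w (F^\-)%E (tup X w))%E; first by apply: eq_integral => w _; rewrite !funenegE.
  rewrite (key _ (measurable_funeneg mF) (funeneg_ge0 F)).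
  by apply: eq_integral => w _; rewrite !funenegE.
Qed.

End law_uniqueness.

(** * Walks and the exchange of blocks *)

Section walks.
Variable R : realType.
Implicit Types (X s : nat -> R) (a c e : R).

Definition walk X (j : nat) : R := \sum_(i < j) X i.

Fixpoint rmax s (j : nat) : R :=
  if j is i.+1 then Num.max (rmax s i) (- s j) else - s 0%N.

Lemma walk0 X : walk X 0 = 0. Proof. by rewrite /walk big_ord0. Qed.

Lemma walkS X j : walk X j.+1 = walk X j + X j.
Proof. by rewrite /walk big_ord_recr. Qed.

Lemma walk_ext X Y j : (forall i, (i < j)%N -> X i = Y i) -> walk X j = walk Y j.
Proof. by move=> h; apply: eq_bigr => i _; exact: h. Qed.

Lemma rmax_le s j c : (rmax s j <= c) = [forall l : 'I_j.+1, - s l <= c].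
Proof.
elim: j => [|j IH] /=.
  by apply/idP/forallP => [h l|/(_ ord0)]//; rewrite ord1.
rewrite ge_max IH; apply/andP/forallP => [[/forallP h1 h2] l|h].
  case: (unliftP ord_max l) => [i ->|->//].
  by have := h1 i; rewrite lift_max.
split; last exact: (h ord_max).
by apply/forallP => l; have := h (widen_ord (leqnSn _) l).
Qed.

Lemma rmax_leP s j c :
  reflect (forall l, (l <= j)%N -> - s l <= c) (rmax s j <= c).
Proof.
rewrite rmax_le; apply: (iffP forallP) => [h l lj|h l].
  exact: (h (Ordinal (lj : (l < j.+1)%N))).
by apply: h; rewrite -ltnS.
Qed.

Lemma rmax_ge s j l : (l <= j)%N -> - s l <= rmax s j.
Proof. by move=> lj; have /rmax_leP := lexx (rmax s j); apply. Qed.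

Lemma rmax_ext s s' j : (forall l, (l <= j)%N -> s l = s' l) -> rmax s j = rmax s' j.
Proof.
elim: j => [|j IH] h /=; first by rewrite h.
by rewrite IH ?h// => l lj; apply: h; rewrite ltnW.
Qed.

Lemma rmax_nd s i j : (i <= j)%N -> rmax s i <= rmax s j.
Proof.
by move=> ij; apply/rmax_leP => l li; apply: rmax_ge; exact: leq_trans ij.
Qed.

Variables (n k : nat) (u v : R -> R).

(* Step [j] contributes the increase of the running depth, provided that the depth
   at [j] is within [e] of the final one; in the limit only the argmin counts. *)
Definition lterm e X j : R :=
  let S := walk X in
  u (S (j + k)%N - S j) * v (S n - (S (j + k)%N - S j)) *
  ((rmax S j - rmax S j.-1) * (rmax S n <= rmax S j + e)%R%:R).

Definition zwalk X l : R := walk X (k + l)%N - walk X k.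

(* [lterm] after the block of the [k] steps following [j] is moved to the front:
   the final depth is then the larger of the depth of that block and of the rest. *)
Definition rterm e X j : R :=
  u (walk X k) * v (zwalk X (n - k)) * (rmax (walk X) k <= e)%R%:R *
  ((rmax (zwalk X) j - rmax (zwalk X) j.-1) *
   (rmax (zwalk X) (n - k) <= rmax (zwalk X) j + (walk X k + e))%R%:R).

(** Described from the rearranged side: [X \o block_front j] reads steps [k], ..., [k + j - 1] of
    [X] first and then its first [k] steps. The block that follows step [j] of the rearranged walk
    is thus the front block of [X]. *)
Definition block_front j i : nat :=
  if (i < j)%N then (k + i)%N else if (i < j + k)%N then (i - j)%N else i.

Lemma walk_front_le X j l : (l <= j)%N -> walk (X \o block_front j) l = zwalk X l.
Proof.
rewrite /zwalk; elim: l => [|l IH] lj; first by rewrite walk0 addn0 subrr.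
by rewrite walkS IH ?(ltnW lj)// addnS walkS /= /block_front lj addrAC.
Qed.

Lemma walk_front_mid X j l : (l <= k)%N ->
  walk (X \o block_front j) (j + l)%N = zwalk X j + walk X l.
Proof.
elim: l => [|l IH] lk; first by rewrite addn0 walk_front_le// walk0 addr0.
rewrite addnS walkS IH ?(ltnW lk)// walkS /= /block_front.
by rewrite ltnNge leq_addr/= ltn_add2l lk addKn addrA.
Qed.

Lemma walk_front_ge X j l : (j <= l)%N ->
  walk (X \o block_front j) (k + l)%N = zwalk X l + walk X k.
Proof.
move=> /subnKC <-; elim: (l - j)%N => [|m IH].
  by rewrite addn0 addnC walk_front_mid.
rewrite !addnS walkS IH /zwalk !addnS walkS /= /block_front.
rewrite (_ : k + (j + m) < j = false)%N; last by lia.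
rewrite (_ : k + (j + m) < j + k = false)%N; last by lia.
by rewrite !subrK.
Qed.

(** The identity is pathwise; probability enters only later, through the invariance of the law under
    [block_front]. *)
Lemma lterm_front e X j : (k <= n)%N -> (0 < j <= n - k)%N ->
  lterm e (X \o block_front j) j = rterm e X j.
Proof.
move=> kn /andP[j0 jn]; rewrite /lterm /rterm.
set S := walk (X \o _); set Z := zwalk X.
have SZ l : (l <= j)%N -> S l = Z l by exact: walk_front_le.
have Sm l : (l <= k)%N -> S (j + l)%N = Z j + walk X l by exact: walk_front_mid.
have Sg l : (j <= l)%N -> S (k + l)%N = Z l + walk X k by exact: walk_front_ge.
have RZ l : (l <= j)%N -> rmax S l = rmax Z l.
  by move=> lj; apply: rmax_ext => i il; apply: SZ; exact: leq_trans lj.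
have -> : S (j + k)%N - S j = walk X k by rewrite Sm// SZ// addrAC subrr add0r.
have -> : S n - walk X k = Z (n - k)%N.
  by rewrite -{1}(subnKC kn) Sg// addrK.
rewrite (RZ _ (leqnn _)) (RZ _ (leq_pred _)).
(* Without a new record at [j] both sides vanish. At a record the running depth is [- Z j], and the
   final-depth condition becomes one condition on the block and one on the remaining steps. *)
have [->|RR] := eqVneq (rmax Z j) (rmax Z j.-1).
  by rewrite subrr !mul0r !mulr0.
have Rj : rmax Z j = - Z j.
  move: RR; rewrite -(prednK j0) /=.
  by case: leP => //; rewrite eqxx.
rewrite -[RHS]mulrA; congr (_ * _); rewrite [RHS]mulrCA; congr (_ * _).
rewrite -natrM mulnb; congr (_%:R); congr nat_of_bool.
apply/rmax_leP/andP => [h|[/rmax_leP h1 /rmax_leP h2] l ln].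
  split; apply/rmax_leP => l lk.
    have : (j + l <= n)%N by lia.
    by move=> /h; rewrite Sm// Rj opprD lerD2l.
  have [lj|jl] := leqP j l.
    have : (k + l <= n)%N by lia.
    by move=> /h; rewrite Sg// opprD lerBlDr addrA addrAC.
  (* Position [l < j] of [Z] is no deeper than the record at [j], and the end of the block, position
     [j + k], gives [0 <= walk X k + e]. *)
  have h0 : (j + k <= n)%N by lia.
  have := h _ h0; rewrite Sm// Rj opprD lerD2l => he.
  have := rmax_ge Z (ltnW jl).
  by rewrite Rj; lra.
have [lj|jl] := leqP l j.
  have := h1 0%N (leq0n _); rewrite walk0 oppr0 => e0.
  by rewrite SZ// (le_trans (rmax_ge Z lj))// lerDl.
have [lk|kl] := leqP l (j + k).
  have -> : l = (j + (l - j))%N by lia.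
  rewrite Sm; last by lia.
  have := h1 (l - j)%N; rewrite Rj => h3.
  have : (l - j <= k)%N by lia.
  by move=> /h3; lra.
have -> : l = (k + (l - k))%N by lia.
rewrite Sg; last by lia.
have : (l - k <= n - k)%N by lia.
by move=> /h2; lra.
Qed.

End walks.

(** * Telescoping sums over records *)

Section telescoping.
Variables (R : realType) (r : nat -> R).
Hypothesis rS : forall i, r i <= r i.+1.

(** Each term dominates the corresponding increment of the maximum of [r] and [c]. *)
Lemma telescope_ge c m :
  Num.max (r m) c - Num.max (r 0%N) c <=
  \sum_(i < m) (r i.+1 - r i) * (c <= r i.+1)%R%:R.
Proof.
elim: m => [|m IH]; first by rewrite big_ord0 subrr.
rewrite big_ord_recr /=.
have h : Num.max (r m.+1) c - Num.max (r m) c <= (r m.+1 - r m) * (c <= r m.+1)%R%:R.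
  by have := rS m; case: (leP c (r m.+1)) => /= h1; case: (leP c (r m)) => h2; lra.
by lra.
Qed.

(** A counted step ends at or above [c], hence starts at or above [c - w]; it is then a full
    increment of the maximum of [r] and [c - w]. *)
Lemma telescope_le c w m : (forall i, (i < m)%N -> r i.+1 <= r i + w) ->
  \sum_(i < m) (r i.+1 - r i) * (c <= r i.+1)%R%:R <=
  Num.max (r m) (c - w) - Num.max (r 0%N) (c - w).
Proof.
elim: m => [|m IH] rw; first by rewrite big_ord0 subrr.
rewrite big_ord_recr /=.
have {}IH := IH (fun i im => rw i (ltnW im)).
have h : (r m.+1 - r m) * (c <= r m.+1)%R%:R <= Num.max (r m.+1) (c - w) - Num.max (r m) (c - w).
  have := rw m (ltnSn m); have := rS m.
  case: (leP c (r m.+1)) => /= h1; case: (leP (c - w) (r m)) => h2;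
  case: (leP (c - w) (r m.+1)) => h3; lra.
by lra.
Qed.

End telescoping.

Section record_sums.
Variables (R : realType) (s : nat -> R) (m : nat).
Hypothesis s0 : s 0%N = 0.

Lemma rmax00 : rmax s 0 = 0.
Proof. by rewrite /= s0 oppr0. Qed.

Lemma rmax_ge0 j : 0 <= rmax s j.
Proof. by have := rmax_ge s (leq0n j); rewrite s0 oppr0. Qed.

Lemma rmaxS j : rmax s j <= rmax s j.+1.
Proof. exact: rmax_nd. Qed.

(** Telescoping with threshold [rmax s m - w]. Together with [record_sum_le] it fixes the weighted
    sum, up to one step size, at the smaller of the final depth and the window. *)
Lemma record_sum_ge (w : R) : 0 <= w ->
  Num.min (rmax s m) w <=
  \sum_(i < m) (rmax s i.+1 - rmax s i) * (rmax s m <= rmax s i.+1 + w)%R%:R.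
Proof.
move=> w0; under eq_bigr do rewrite -lerBlDr.
apply: le_trans (telescope_ge rmaxS _ _).
rewrite rmax00.
case: (leP (rmax s m) w) => h1; case: (leP (rmax s m) (rmax s m - w)) => h2;
  case: (leP 0 (rmax s m - w)) => h3; lra.
Qed.

Lemma record_sum_le (w d : R) : 0 <= w -> 0 <= d ->
  (forall i, (i < m)%N -> `|s i.+1 - s i| <= d) ->
  \sum_(i < m) (rmax s i.+1 - rmax s i) * (rmax s m <= rmax s i.+1 + w)%R%:R <=
  Num.min (rmax s m) (w + d).
Proof.
move=> w0 d0 sd; under eq_bigr do rewrite -lerBlDr.
apply: le_trans (telescope_le rmaxS (w := d) _ _) _.
  move=> i im /=; rewrite ge_max lerDl d0/=.
  have := sd i im; have := rmax_ge s (leqnn i); rewrite ler_norml => h1 /andP[h2 _]; lra.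
have := rmax_ge0 m.
rewrite rmax00.
case: (leP (rmax s m) (w + d)) => h1; case: (leP (rmax s m) (rmax s m - w - d)) => h2;
  case: (leP 0 (rmax s m - w - d)) => h3; lra.
Qed.

End record_sums.

(** * Grid approximation of continuous paths *)

Section paths.
Variable R : realType.
Implicit Types (f g : R -> R) (u v t e c d x y : R).

Definition ucont f := forall e : R, 0 < e -> exists2 d : R, 0 < d &
  forall x y, `|x - y| <= d -> `|f x - f y| <= e.

Lemma continuousP_le f x : {for x, continuous f} <-> forall e : R, 0 < e ->
  exists2 d : R, 0 < d & forall y, `|x - y| <= d -> `|f x - f y| <= e.
Proof.
split=> [/cvgrPdist_le fx e e0|h].
  have /nbhs_ballP[d /= d0 hd] := fx e e0.
  exists (d / 2); first exact: divr_gt0.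
  move=> y xy; apply: hd; rewrite /ball/= (le_lt_trans xy)// ltr_pdivrMr// ltr_pMr//.
  by rewrite ltr1n.
apply/cvgrPdist_le => e e0; have [d d0 hd] := h e e0.
by apply/nbhs_ballP; exists d => //= y xy; apply: hd; exact: ltW.
Qed.

Lemma ucont_continuous f : ucont f -> continuous f.
Proof.
move=> uf x; apply/continuousP_le => e e0; have [d d0 h] := uf e e0.
by exists d => // y; exact: h.
Qed.

Definition maxdrop f u v : R := sup [set f u - f s | s in `[u, v]].

Section drop_theory.
Variables (f : R -> R) (u v : R).
Hypotheses (uf : ucont f) (uv : u <= v).

Lemma drop_attained :
  exists2 s, u <= s <= v & maxdrop f u v = f u - f s /\
    forall s', u <= s' <= v -> f u - f s' <= maxdrop f u v.
Proof.
have cf : {within `[u, v], continuous f}.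
  by apply: continuous_subspaceT; exact: ucont_continuous.
have [s suv fs] := EVT_min uv cf.
have h s' : u <= s' <= v -> f u - f s' <= f u - f s.
  by move=> h; rewrite lerB// fs// in_itv.
have e : maxdrop f u v = f u - f s.
  apply/eqP; rewrite eq_le; apply/andP; split.
    apply: ge_sup; first by exists (f u - f s) => /=; exists s.
    by move=> _ [s' /= + <-]; rewrite in_itv => /h.
  apply: ub_le_sup; last by exists s.
  by exists (f u - f s) => _ [s' /= + <-]; rewrite in_itv => /h.
exists s; first by move: suv; rewrite in_itv.
by split=> // s' /h; rewrite e.
Qed.

Lemma drop_ge s : u <= s <= v -> f u - f s <= maxdrop f u v.
Proof. by have [? _ [_]] := drop_attained; apply. Qed.

Lemma drop_le c : (forall s, u <= s <= v -> f u - f s <= c) -> maxdrop f u v <= c.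
Proof. by have [s suv [-> _]] := drop_attained; apply. Qed.

Lemma drop_ge0 : 0 <= maxdrop f u v.
Proof. by rewrite -(subrr (f u)); apply: drop_ge; rewrite lexx. Qed.

(** The grid is only required to start and end near [u] and [v], possibly outside the interval,
    because a uniform grid does not contain [t] in general. *)
Lemma grid_drop e : 0 < e -> exists2 d : R, 0 < d & forall (p : nat -> R) m,
  (forall i, (i < m)%N -> p i <= p i.+1 <= p i + d) ->
  `|p 0%N - u| <= d -> `|p m - v| <= d ->
  `|rmax (fun l => f (p l) - f (p 0%N)) m - maxdrop f u v| <= e.
Proof.
move=> e0; have [d d0 fd] := uf (divr_gt0 e0 (ltr0n _ 2)).
exists d => // p m pS p0 pm.
have p_ge i : (i <= m)%N -> p 0%N <= p i.
  elim: i => // i IH im; rewrite (le_trans (IH (ltnW im)))//.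
  by have /andP[] := pS i im.
have p_le i : p (m - i)%N <= p m.
  elim: i => [|i IH]; first by rewrite subn0.
  have [mi|im] := leqP m i; first by rewrite (_ : m - i.+1 = m - i)%N//; lia.
  apply: le_trans IH; have : (m - i.+1 < m)%N by lia.
  by move=> /pS/andP[+ _]; rewrite (_ : (m - i.+1).+1 = m - i)%N//; lia.
have p0u := fd _ _ p0.
move: p0 pm; rewrite !ler_norml => /andP[p01 p02] /andP[pm1 pm2].
apply/andP; split.
  rewrite lerBrDl lerBlDr.
  have [s /andP[us sv] [-> _]] := drop_attained.
  have hm : p m >= s - d by lra.
  have hex : exists l, s - d <= p l by exists m.
  (* The first grid point at or beyond [s - d] lies within [d] of the minimiser [s]: its predecessor
     is below [s - d] and the mesh is at most [d]. *)
  have [l hl lmin] := ex_minnP hex.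
  have lm : (l <= m)%N by exact: lmin.
  have ls : `|p l - s| <= d.
    case: l => [|l] in hl lmin lm *; first by rewrite ler_norml; lra.
    have : p l < s - d.
      by rewrite ltNge; apply/negP => /lmin; rewrite ltnn.
    have /andP[_] := pS _ lm.
    by rewrite ler_norml; lra.
  have := fd _ _ ls; have := rmax_ge (fun l => f (p l) - f (p 0%N)) lm.
  move: p0u; rewrite !ler_norml => /andP[h1 h2] h3 /andP[h4 h5]; lra.
rewrite lerBlDr; apply/rmax_leP => l lm.
(* A grid point outside the interval is projected onto it; this moves it by at most [d]. *)
pose s := Num.max u (Num.min (p l) v).
have p1 := p_ge _ lm.
have p2 : p l <= p m by have := p_le (m - l)%N; rewrite subKn.
have suv : u <= s <= v by rewrite le_max lexx/= ge_max uv/= ge_min lexx orbT.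
have ls : `|p l - s| <= d.
  rewrite ler_norml /s; case: (leP (p l) v) => h1.
    by case: (leP u (p l)) => h2; lra.
  by case: (leP u v) => h2; lra.
have := fd _ _ ls; have := drop_ge suv.
move: p0u; rewrite !ler_norml => /andP[h1 h2] h3 /andP[h4 h5]; lra.
Qed.

End drop_theory.

Definition gpos (n i : nat) : R := i%:R / n%:R.
Definition incr f n i : R := f (gpos n i.+1) - f (gpos n i).
Definition mixed f g n k i : R := if (i < k)%N then incr f n i else incr g n i.
Definition small (X : nat -> R) n d := [forall i : 'I_n, `|X i| <= d].
Definition gidx n t : nat := Num.truncn (n%:R * t).

Lemma smallP X n d :
  reflect (forall i, (i < n)%N -> `|X i| <= d) (small X n d).
Proof.
by apply: (iffP forallP) => [h i ni|h i]; [exact: (h (Ordinal ni))|exact: h].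
Qed.

Lemma gpos0 n : gpos n 0 = 0. Proof. by rewrite /gpos mul0r. Qed.

Lemma gposnn n : (0 < n)%N -> gpos n n = 1.
Proof. by move=> n0; rewrite /gpos divff// pnatr_eq0 -lt0n. Qed.

Lemma gposS n i : gpos n i.+1 = gpos n i + n%:R^-1.
Proof. by rewrite /gpos -natr1 mulrDl mul1r. Qed.

Lemma gpos_le n i j : (i <= j)%N -> gpos n i <= gpos n j.
Proof. by move=> ij; rewrite ler_wpM2r ?invr_ge0// ler_nat. Qed.

Lemma gpos_itv n i : (i <= n)%N -> 0 <= gpos n i <= 1.
Proof.
move=> ni; rewrite divr_ge0//=; have [->|n0] := posnP n; first by rewrite /gpos invr0 mulr0.
by rewrite ler_pdivrMr ?ltr0n// mul1r ler_nat.
Qed.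

Lemma walk_incr f n l : walk (incr f n) l = f (gpos n l) - f 0.
Proof.
elim: l => [|l IH]; first by rewrite walk0 gpos0 subrr.
by rewrite walkS IH /incr addrC addrA subrK.
Qed.

Lemma walk_mixed f g n k l : (l <= k)%N ->
  walk (mixed f g n k) l = f (gpos n l) - f 0.
Proof.
move=> lk; rewrite -walk_incr; apply: walk_ext => i il.
by rewrite /mixed (leq_trans il lk).
Qed.

Lemma zwalk_mixed f g n k l :
  zwalk k (mixed f g n k) l = g (gpos n (k + l)) - g (gpos n k).
Proof.
rewrite /zwalk; elim: l => [|l IH]; first by rewrite addn0 !subrr.
rewrite addnS walkS addrAC IH /mixed ltnNge leq_addr /= /incr.
by rewrite addrC addrA subrK.
Qed.

Lemma mixed_ff f n k : mixed f f n k = incr f n.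
Proof. by apply/funext => i; rewrite /mixed; case: ifP. Qed.

Lemma gidx_le n t : 0 <= t <= 1 -> (gidx n t <= n)%N.
Proof.
move=> /andP[t0 t1]; rewrite -(@ler_nat R) (@le_trans _ _ (n%:R * t))//.
  by have /andP[] := truncn_itv (mulr_ge0 (ler0n R n) t0).
by rewrite ler_piMr.
Qed.

Lemma gidx_itv n t : (0 < n)%N -> 0 <= t -> gpos n (gidx n t) <= t <= gpos n (gidx n t) + n%:R^-1.
Proof.
move=> n0 t0; have /andP[h1 h2] := truncn_itv (mulr_ge0 (ler0n R n) t0).
rewrite -gposS /gpos ler_pdivrMr ?ler_pdivlMr ?ltr0n// ![t * _]mulrC.
by rewrite h1 ltW.
Qed.

Lemma near_mesh d : 0 < d -> \forall n \near \oo, (0 < n)%N /\ n%:R^-1 <= d.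
Proof.
move=> d0; near=> n.
have n0 : (0 < n)%N by near: n; exists 1%N.
split=> //; rewrite -(invrK d) lef_pV2 ?posrE ?ltr0n ?invr_gt0//.
near: n; exact: nbhs_infty_ger.
Unshelve. all: by end_near. Qed.

Lemma gidx_near n t d : (0 < n)%N -> 0 <= t -> n%:R^-1 <= d ->
  `|gpos n (gidx n t) - t| <= d.
Proof. by move=> n0 t0 nd; have := gidx_itv n0 t0; rewrite ler_norml; lra. Qed.

Lemma near_incr f d : ucont f -> 0 < d ->
  \forall n \near \oo, forall i, `|incr f n i| <= d.
Proof.
move=> uf d0; have [d' d'0 h] := uf d d0.
near=> n => i; apply: h; rewrite gposS addrAC subrr add0r ger0_norm ?invr_ge0//.
by have [] : (0 < n)%N /\ n%:R^-1 <= d' by near: n; exact: near_mesh.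
Unshelve. all: by end_near. Qed.

Lemma min_dist (a b a' b' : R) c : `|a - a'| <= c -> `|b - b'| <= c ->
  `|Num.min a b - Num.min a' b'| <= c.
Proof.
rewrite !ler_norml => h1 h2.
by case: (leP a b) => h3; case: (leP a' b') => h4; lra.
Qed.

Section mixed_limit.
Variables (u v : R -> R) (f g : R -> R) (t e d : R).
Hypotheses (cu : continuous u) (cv : continuous v) (uf : ucont f) (ug : ucont g).
Hypotheses (t01 : 0 <= t <= 1) (e0 : 0 <= e) (d0 : 0 < d).

Let k n := gidx n t.
Let X n := mixed f g n (k n).

Definition rsum n k (X : nat -> R) : R :=
  (small X n d)%:R * \sum_(j < n - k) rterm n k u v e X j.+1.

Definition rlim : R :=
  u (f t - f 0) * v (g 1 - g t) * (maxdrop f 0 t <= e)%R%:R *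
  Num.min (maxdrop g t 1) (f t - f 0 + e).

Let t0 : 0 <= t. Proof. by case/andP: t01. Qed.
Let t1 : t <= 1. Proof. by case/andP: t01. Qed.

Let cvg_k h : ucont h -> h (gpos n (k n)) @[n --> \oo] --> h t.
Proof.
move=> uh; apply/cvgrPdist_le => c c0; have [c' c'0 hc] := uh c c0.
near=> n; rewrite distrC; apply: hc.
have [n0 nc] : (0 < n)%N /\ n%:R^-1 <= c' by near: n; exact: near_mesh.
exact: gidx_near.
Unshelve. all: by end_near. Qed.

Lemma walk_mixed_cvg : walk (X n) (k n) @[n --> \oo] --> f t - f 0.
Proof.
under eq_fun do rewrite walk_mixed//.
by apply: cvgB; [exact: cvg_k|exact: cvg_cst].
Qed.

Lemma zwalk_mixed_cvg : zwalk (k n) (X n) (n - k n) @[n --> \oo] --> g 1 - g t.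
Proof.
apply: (@cvg_trans _ ((g 1 - g (gpos n (k n))) @[n --> \oo])).
  apply: near_eq_cvg; near=> n.
  rewrite zwalk_mixed subnKC ?gidx_le// gposnn//.
  by near: n; exists 1%N.
by apply: cvgB; [exact: cvg_cst|exact: cvg_k].
Unshelve. all: by end_near. Qed.

Let grid_step n c i : n%:R^-1 <= c -> gpos n i <= gpos n i.+1 <= gpos n i + c.
Proof. by move=> h; rewrite gposS lerDl invr_ge0 ler0n/= lerD2l. Qed.

Lemma rmax_walk_mixed_cvg : rmax (walk (X n)) (k n) @[n --> \oo] --> maxdrop f 0 t.
Proof.
apply/cvgrPdist_le => c c0; have [c' c'0 hc] := grid_drop uf t0 c0.
near=> n; rewrite distrC.
have [n0 nc] : (0 < n)%N /\ n%:R^-1 <= c' by near: n; exact: near_mesh.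
rewrite (@rmax_ext _ _ (fun l => f (gpos n l) - f (gpos n 0))); last first.
  by move=> l lk; rewrite walk_mixed// gpos0.
apply: hc => [i _||]; first exact: grid_step.
  by rewrite gpos0 subrr normr0 ltW.
exact: gidx_near.
Unshelve. all: by end_near. Qed.

Lemma rmax_zwalk_mixed_cvg : rmax (zwalk (k n) (X n)) (n - k n) @[n --> \oo] --> maxdrop g t 1.
Proof.
apply/cvgrPdist_le => c c0; have [c' c'0 hc] := grid_drop ug t1 c0.
near=> n; rewrite distrC.
have [n0 nc] : (0 < n)%N /\ n%:R^-1 <= c' by near: n; exact: near_mesh.
rewrite (@rmax_ext _ _ (fun l => g (gpos n (k n + l)) - g (gpos n (k n + 0)))); last first.
  by move=> l lk; rewrite zwalk_mixed addn0.
apply: (hc (fun l => gpos n (k n + l))) => [i _||].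
- by rewrite addnS; exact: grid_step.
- by rewrite addn0; exact: gidx_near.
- by rewrite subnKC ?gidx_le// gposnn// subrr normr0 ltW.
Unshelve. all: by end_near. Qed.

Let b_le n : (0 < n)%N -> rmax (walk (X n)) (k n) <= maxdrop f 0 t.
Proof.
move=> n0; apply/rmax_leP => l lk; rewrite walk_mixed// opprB.
apply: drop_ge => //; have /andP[-> _]/= := gpos_itv (leq_trans lk (gidx_le n t01)).
by rewrite (le_trans (gpos_le _ lk))//; have /andP[] := gidx_itv n0 t0.
Qed.

(** The record sum is squeezed between two minima whose windows differ by one step size. The
    indicator is discontinuous at [maxdrop f 0 t = e], but a grid depth never exceeds the true one,
    so in the case [maxdrop f 0 t <= e] it equals 1 along the whole sequence. *)
Lemma rsum_cvg : rsum n (k n) (X n) @[n --> \oo] --> rlim.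
Proof.
have sm : \forall n \near \oo, small (X n) n d.
  near=> n; apply/smallP => i _; rewrite /X /mixed; case: ifP => _.
    by move: i; near: n; exact: near_incr.
  by move: i; near: n; exact: near_incr.
pose S n := \sum_(j < n - k n) (rmax (zwalk (k n) (X n)) j.+1 - rmax (zwalk (k n) (X n)) j) *
   (rmax (zwalk (k n) (X n)) (n - k n) <= rmax (zwalk (k n) (X n)) j.+1 + (walk (X n) (k n) + e))%R%:R.
pose H n := u (walk (X n) (k n)) * v (zwalk (k n) (X n) (n - k n)) *
  (rmax (walk (X n)) (k n) <= e)%R%:R.
have cvg_uv : u (walk (X n) (k n)) * v (zwalk (k n) (X n) (n - k n)) @[n --> \oo] -->
    u (f t - f 0) * v (g 1 - g t).
  apply: cvgM; first by apply: (cvg_comp _ _ (@walk_mixed_cvg)); exact: cu.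
  by apply: (cvg_comp _ _ (@zwalk_mixed_cvg)); exact: cv.
suff : H n * S n @[n --> \oo] --> rlim.
  apply: cvg_trans; apply: near_eq_cvg; near=> n.
  rewrite /rsum; have -> : small (X n) n d = true by near: n.
  by rewrite mul1r mulr_sumr.
rewrite /rlim /H; have [be|eb] := leP (maxdrop f 0 t) e; last first.
  rewrite mulr0 mul0r; apply: (@cvg_trans _ (cst 0 n @[n --> \oo])); last exact: cvg_cst.
  apply: near_eq_cvg; near=> n.
  rewrite leNgt (_ : e < _)%R ?mulr0 ?mul0r//.
  near: n; exact: (cvgr_gt _ (@rmax_walk_mixed_cvg)).
rewrite mulr1.
apply: (@cvg_trans _ (u (walk (X n) (k n)) * v (zwalk (k n) (X n) (n - k n)) * S n @[n --> \oo])).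
  apply: near_eq_cvg; near=> n.
  have n0 : (0 < n)%N by near: n; exists 1%N.
  by rewrite (le_trans (b_le n0) be) mulr1.
apply: cvgM; first exact: cvg_uv.
apply/cvgrPdist_le => c c0.
have cm : Num.min (rmax (zwalk (k n) (X n)) (n - k n)) (walk (X n) (k n) + e) @[n --> \oo] -->
    Num.min (maxdrop g t 1) (f t - f 0 + e).
  have cb : walk (X n) (k n) + e @[n --> \oo] --> f t - f 0 + e.
    by apply: cvgD; [exact: (@walk_mixed_cvg)|exact: cvg_cst].
  apply/cvgrPdist_le => c' c'0; near=> n; apply: min_dist.
    by near: n; move/cvgrPdist_le : (@rmax_zwalk_mixed_cvg); apply.
  by near: n; move/cvgrPdist_le : cb; apply.
have c2 : 0 < c / 2 by rewrite divr_gt0.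
have inc := near_incr ug c2.
near=> n.
have n0 : (0 < n)%N by near: n; exists 1%N.
have z0 : zwalk (k n) (X n) 0 = 0 by rewrite /zwalk addn0 subrr.
have w0 : 0 <= walk (X n) (k n) + e.
  have := rmax_ge (walk (X n)) (leqnn (k n)); have := b_le n0; lra.
have h1 := record_sum_ge (n - k n) z0 w0.
have h2 : S n <= Num.min (rmax (zwalk (k n) (X n)) (n - k n)) (walk (X n) (k n) + e + c / 2).
  apply: record_sum_le => //; first exact: ltW.
  move=> i _; rewrite !zwalk_mixed opprB addrA subrK addnS.
  rewrite -/(incr g n (k n + i)).
  have hi : forall i, `|incr g n i| <= c / 2 by near: n; exact: inc.
  exact: hi.
have h3 : `|Num.min (maxdrop g t 1) (f t - f 0 + e) -
  Num.min (rmax (zwalk (k n) (X n)) (n - k n)) (walk (X n) (k n) + e)| <= c / 2.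
  by near: n; move/cvgrPdist_le : cm; apply.
move: h1 h2 h3; rewrite -/(S n).
set a := rmax _ _; set b := walk _ _ + e; set m := Num.min (maxdrop _ _ _) _ => h1 h2.
have h4 : Num.min a (b + c / 2) <= Num.min a b + c / 2.
  by case: (leP a b) => ab; case: (leP a (b + c/2)) => ab'; lra.
rewrite !ler_norml => /andP[h5 h6]; lra.
Unshelve. all: by end_near. Qed.

End mixed_limit.
End paths.

(** * Bounds on the discrete sums, uniform in the mesh *)

Section sum_bounds.
Variables (R : realType) (u v : R -> R) (C K : R).
Hypotheses (u0 : forall x, 0 <= u x <= C) (v0 : forall x, 0 <= v x <= C).
Hypotheses (K0 : 0 <= K) (uK : forall x, K <= x -> u x = 0).
Implicit Types (e d : R) (n k : nat) (X : nat -> R).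

Definition lsum e d n k X : R :=
  (small X n d)%:R * \sum_(j < n - k) lterm n k u v e X j.+1.

Let C0 : 0 <= C. Proof. by have /andP[h1 h2] := u0 0; exact: le_trans h2. Qed.

Let uvC x y : 0 <= u x * v y <= C * C.
Proof.
have /andP[a b] := u0 x; have /andP[c d] := v0 y.
by rewrite mulr_ge0//= ler_pM.
Qed.

Lemma weight_ge0 (s : nat -> R) j (b : bool) : 0 <= (rmax s j.+1 - rmax s j) * b%:R.
Proof. by rewrite mulr_ge0// subr_ge0; exact: rmax_nd. Qed.

Lemma weight_sum_le e d n m X : 0 <= e -> 0 <= d -> (m <= n)%N -> small X n d ->
  \sum_(j < m) (rmax (walk X) j.+1 - rmax (walk X) j) *
     (rmax (walk X) n <= rmax (walk X) j.+1 + e)%R%:R <= e + d.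
Proof.
move=> e0 d0 mn sX.
apply: (@le_trans _ _ (\sum_(j < n) (rmax (walk X) j.+1 - rmax (walk X) j) *
     (rmax (walk X) n <= rmax (walk X) j.+1 + e)%R%:R)).
  rewrite -(subnKC mn) big_split_ord/= lerDl sumr_ge0// => i _; exact: weight_ge0.
apply: le_trans (record_sum_le (walk0 X) e0 d0 _) _.
  by move=> i ni; rewrite walkS addrAC subrr add0r; exact: (smallP _ _ _ sX).
by rewrite ge_min lexx orbT.
Qed.

Lemma lsum_bound e d n k X : 0 <= e -> 0 <= d -> (k <= n)%N ->
  0 <= lsum e d n k X <= C * C * (e + d).
Proof.
move=> e0 d0 kn; rewrite /lsum; have [sX|_] := boolP (small X n d); last first.
  by rewrite mul0r lexx/= !mulr_ge0// addr_ge0.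
rewrite mul1r; apply/andP; split.
  apply: sumr_ge0 => i _; rewrite /lterm mulr_ge0//; last exact: weight_ge0.
  by have /andP[] := uvC (walk X (i.+1 + k)%N - walk X i.+1) (walk X n - (walk X (i.+1 + k)%N - walk X i.+1)).
apply: le_trans (ler_wpM2l (mulr_ge0 C0 C0) (weight_sum_le e0 d0 (leq_subr k n) sX)).
rewrite mulr_sumr; apply: ler_sum => i _; rewrite /lterm.
apply: ler_wpM2r; first exact: weight_ge0.
by have /andP[] := uvC (walk X (i.+1 + k)%N - walk X i.+1) (walk X n - (walk X (i.+1 + k)%N - walk X i.+1)).
Qed.

(** Here the window is [walk X k + e], which is random and unbounded; [u] vanishing beyond [K]
    limits it to [K + e]. *)
Lemma rsum_bound e d n k X : 0 <= e -> 0 <= d -> (k <= n)%N ->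
  0 <= rsum u v e d n k X <= C * C * (K + e + d).
Proof.
move=> e0 d0 kn.
have CCK : 0 <= C * C * (K + e + d) by rewrite !mulr_ge0 ?addr_ge0.
rewrite /rsum; have [sX|_] := boolP (small X n d); last first.
  by rewrite mul0r lexx.
rewrite mul1r -mulr_sumr.
have [be|_] := boolP (rmax (walk X) k <= e); last by rewrite mulr0 mul0r lexx.
have [Kw|wK] := leP K (walk X k); first by rewrite uK// !mul0r lexx.
rewrite mulr1; set x := u _ * v _; have /andP[x0 xC] : 0 <= x <= C * C by exact: uvC.
have S0 : 0 <= \sum_(j < n - k) (rmax (zwalk k X) j.+1 - rmax (zwalk k X) j) *
   (rmax (zwalk k X) (n - k) <= rmax (zwalk k X) j.+1 + (walk X k + e))%R%:R.
  by apply: sumr_ge0 => i _; exact: weight_ge0.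
rewrite mulr_ge0//=.
apply: ler_pM => //.
have y0 : 0 <= walk X k + e by have := rmax_ge (walk X) (leqnn k); lra.
have z0 : zwalk k X 0 = 0 by rewrite /zwalk addn0 subrr.
apply: le_trans (record_sum_le z0 y0 d0 _) _.
  move=> i ni; rewrite /zwalk opprB addrA subrK addnS walkS addrAC subrr add0r.
  by apply: (smallP _ _ _ sX); rewrite -ltn_subRL.
by rewrite ge_min; apply/orP; right; lra.
Qed.

End sum_bounds.

(** * Concentration of the weights at a unique argmin *)

Section unique_argmin_limit.
Variables (R : realType) (u v f : R -> R) (C t tau : R).
Hypotheses (cu : continuous u) (cv : continuous v) (uf : ucont f).
Hypotheses (u0 : forall x, 0 <= u x <= C) (v0 : forall x, 0 <= v x <= C).
Hypotheses (t01 : 0 < t < 1) (tau01 : 0 < tau <= 1).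
Hypothesis argmin : forall s : R, 0 <= s <= 1 -> s != tau -> f tau < f s.
Hypothesis taut : tau != 1 - t.
Variable n_ : nat -> nat.
Hypothesis n_oo : forall N, \forall q \near \oo, (N <= n_ q)%N.

Let e (q : nat) : R := q.+1%:R^-1.
Let k q := gidx (n_ q) t.
Let X q := incr f (n_ q).

(* For a path with argmin [tau] and Vervaat transform [V] this is
   [u (V t) * v (f 1 - f 0 - V t)], on the event where [V t] does not wrap around. *)
Definition vtarget : R :=
  if tau <= 1 - t then
    u (f (tau + t) - f tau) * v (f 1 - f 0 - (f (tau + t) - f tau)) else 0.

(** Outside the [c]-neighbourhood of [tau] there remain two compact pieces; on each the minimum is
    attained and exceeds [f tau]. An empty piece gets the arbitrary gap 1. *)
Lemma argmin_isolated (c : R) : 0 < c -> exists2 r : R, 0 < r &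
  forall s : R, 0 <= s <= 1 -> f s <= f tau + r -> `|s - tau| <= c.
Proof.
move=> c0.
have half (a b : R) : 0 <= a -> b <= 1 -> (forall s : R, a <= s <= b -> s != tau) ->
    exists2 r : R, 0 < r & forall s : R, a <= s <= b -> f tau + r < f s.
  move=> a0 b1 ntau; have [ab|ba] := leP a b; last first.
    exists 1; rewrite ?ltr01// => s /andP[h1 h2].
    by have := lt_le_trans ba h1; rewrite ltNge h2.
  have cf : {within `[a, b], continuous f}.
    by apply: continuous_subspaceT; exact: ucont_continuous.
  have [m mab fm] := EVT_min ab cf.
  rewrite in_itv /= in mab.
  have ftm : f tau < f m.
    by apply: argmin; [lra|exact: ntau].
  exists ((f m - f tau) / 2); first by rewrite divr_gt0// subr_gt0.
  move=> s sab; have := fm s; rewrite in_itv => /(_ sab); lra.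
have [r1 r10 h1] : exists2 r : R, 0 < r &
    forall s : R, 0 <= s <= tau - c -> f tau + r < f s.
  have hc1 : tau - c <= 1 by case/andP: tau01 => h1 h2; lra.
  apply: (half 0 (tau - c) (lexx 0) hc1).
  by move=> s sab; apply/eqP => st; lra.
have [r2 r20 h2] : exists2 r : R, 0 < r &
    forall s : R, tau + c <= s <= 1 -> f tau + r < f s.
  have hc1 : 0 <= tau + c by case/andP: tau01 => tau0 _; lra.
  apply: (half (tau + c) 1 hc1 (lexx 1)).
  by move=> s sab; apply/eqP => st; lra.
exists (Num.min r1 r2); first by rewrite lt_min r10.
move=> s s01 fs; rewrite ler_norml; apply/andP; split.
  rewrite leNgt; apply/negP => sl.
  have /h1 : 0 <= s <= tau - c by lra.
  have : Num.min r1 r2 <= r1 by rewrite ge_min lexx.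
  by lra.
rewrite leNgt; apply/negP => sl.
have /h2 : tau + c <= s <= 1 by lra.
have : Num.min r1 r2 <= r2 by rewrite ge_min lexx orbT.
by lra.
Qed.

Let e0 q : 0 < e q. Proof. by rewrite invr_gt0 ltr0n. Qed.

Let near_e (c : R) : 0 < c -> \forall q \near \oo, e q <= c.
Proof.
move=> c0; near=> q.
have [q0 qc] : (0 < q)%N /\ q%:R^-1 <= c by near: q; exact: near_mesh.
by rewrite (le_trans _ qc)// lef_pV2 ?posrE ?ltr0n// ler_nat.
Unshelve. all: by end_near. Qed.

Let near_n (c : R) : 0 < c -> \forall q \near \oo, (0 < n_ q)%N /\ (n_ q)%:R^-1 <= c.
Proof.
move=> c0; have [N _ hN] := near_mesh c0.
by near=> q; apply: hN => /=; near: q; exact: n_oo.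
Unshelve. all: by end_near. Qed.

Let tau_le : 0 <= tau <= 1. Proof. by case/andP: tau01 => /ltW -> ->. Qed.

Let dropE : maxdrop f 0 1 = f 0 - f tau.
Proof.
apply/eqP; rewrite eq_le; apply/andP; split; last exact: drop_ge.
apply: drop_le => // s s01; rewrite lerB//.
by have [->//|st] := eqVneq s tau; rewrite ltW// argmin.
Qed.

Let near_R (c : R) : 0 < c ->
  \forall q \near \oo, `|rmax (walk (X q)) (n_ q) - (f 0 - f tau)| <= c.
Proof.
move=> c0; have [c' c'0 hc] := grid_drop uf ler01 c0.
near=> q; rewrite -dropE.
have [n0 nc] : (0 < n_ q)%N /\ (n_ q)%:R^-1 <= c' by near: q; exact: near_n.
rewrite (@rmax_ext _ _ (fun l => f (gpos R (n_ q) l) - f (gpos R (n_ q) 0))); last first.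
  by move=> l lk; rewrite walk_incr gpos0.
apply: hc => [i _||].
- by rewrite gposS lerDl invr_ge0 ler0n/= lerD2l.
- by rewrite gpos0 subrr normr0 ltW.
- by rewrite gposnn// subrr normr0 ltW.
Unshelve. all: by end_near. Qed.

(** At a record the running depth is the depth of the path itself, so a record within [e q] of the
    final depth is a point where [f] is nearly minimal. *)
Lemma near_record (c : R) : 0 < c -> \forall q \near \oo, forall i, (i < n_ q)%N ->
  rmax (walk (X q)) i.+1 != rmax (walk (X q)) i ->
  rmax (walk (X q)) (n_ q) <= rmax (walk (X q)) i.+1 + e q ->
  `|gpos R (n_ q) i.+1 - tau| <= c.
Proof.
move=> c0; have [r r0 hr] := argmin_isolated c0.
have r2 : 0 < r / 2 by rewrite divr_gt0.
near=> q => i ni /= RR Re; apply: hr; first exact: gpos_itv.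
have RS : rmax (walk (X q)) i.+1 = - walk (X q) i.+1.
  by move: RR => /=; case: leP => //; rewrite eqxx.
have h1 : e q <= r / 2 by near: q; exact: near_e.
have : `|rmax (walk (X q)) (n_ q) - (f 0 - f tau)| <= r / 2 by near: q; exact: near_R.
move: Re; rewrite -/(rmax (walk (X q)) i.+1) RS walk_incr ler_norml => Re /andP[h2 h3]; lra.
Unshelve. all: by end_near. Qed.

Let H (s t' : R) := u (f (s + t') - f s) * v (f 1 - f 0 - (f (s + t') - f s)).

Let H_cont (c : R) : 0 < c -> exists2 r : R, 0 < r &
  forall s t', `|s - tau| <= r -> `|t' - t| <= r -> `|H s t' - H tau t| <= c.
Proof.
move=> c0.
pose G x := u x * v (f 1 - f 0 - x).
have cG : continuous G.
  move=> x; apply: cvgM; first exact: cu.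
  apply: (cvg_comp (fun x => f 1 - f 0 - x) v); last exact: cv.
  by apply: cvgB; [exact: cvg_cst|exact: cvg_id].
have [r1 r10 hr1] := (continuousP_le _ _).1 (cG (f (tau + t) - f tau)) c c0.
have [r2 r20 hr2] := uf (divr_gt0 r10 (ltr0n _ 2)).
exists (r2 / 2); first by rewrite divr_gt0.
move=> s t' hs ht; rewrite distrC; apply: hr1.
have h1 : `|f s - f tau| <= r1 / 2 by apply: hr2; apply: le_trans hs _; lra.
have h2 : `|f (s + t') - f (tau + t)| <= r1 / 2.
  apply: hr2; move: hs ht; rewrite !ler_norml => /andP[? ?] /andP[? ?]; lra.
move: h1 h2; rewrite !ler_norml => /andP[? ?] /andP[? ?]; lra.
Qed.

Let HC s t' : 0 <= H s t' <= C * C.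
Proof.
rewrite /H; set x := f _ - _; set y := _ - x.
have /andP[a b] := u0 x; have /andP[c d] := v0 y.
by rewrite mulr_ge0//= ler_pM.
Qed.

Let ltermE q i : (0 < n_ q)%N -> lterm (n_ q) (k q) u v (e q) (X q) i.+1 =
  H (gpos R (n_ q) i.+1) (gpos R (n_ q) (k q)) *
  ((rmax (walk (X q)) i.+1 - rmax (walk (X q)) i) *
     (rmax (walk (X q)) (n_ q) <= rmax (walk (X q)) i.+1 + e q)%R%:R) :> R.
Proof.
move=> n0; rewrite /lterm !walk_incr gposnn// /H.
have -> : gpos R (n_ q) (i.+1 + k q) = gpos R (n_ q) i.+1 + gpos R (n_ q) (k q).
  by rewrite /gpos natrD mulrDl.
by rewrite [X in u X](_ : _ = f (gpos R (n_ q) i.+1 + gpos R (n_ q) (k q)) - f (gpos R (n_ q) i.+1))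
  ?[X in v (_ - X)](_ : _ = f (gpos R (n_ q) i.+1 + gpos R (n_ q) (k q)) - f (gpos R (n_ q) i.+1));
  try ring.
Qed.

(** The weights have total mass [e q] up to [e q ^+ 2] and sit near [tau], so division by [e q]
    gives an average of [H] near [(tau, t)]. The factor [small] stays in the limit statement: the
    cut-off shrinks with [q], and a given path need not satisfy it for all large [q]. *)
Lemma lsum_cvg : lsum u v (e q) (e q ^+ 2) (n_ q) (k q) (X q) / e q -
    (small (X q) (n_ q) (e q ^+ 2))%:R * vtarget @[q --> \oo] --> 0.
Proof.
have [t0 t1] : 0 < t /\ t < 1 by case/andP: t01.
have [tau0 tau1] : 0 < tau /\ tau <= 1 by case/andP: tau01.
have CC0 : 0 <= C * C by have /andP[h1 h2] := HC 0 0; exact: le_trans h2.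
pose w q i := (rmax (walk (X q)) i.+1 - rmax (walk (X q)) i) *
     (rmax (walk (X q)) (n_ q) <= rmax (walk (X q)) i.+1 + e q)%R%:R.
have w0 q i : 0 <= w q i by exact: weight_ge0.
have wn0 q i : w q i != 0 -> rmax (walk (X q)) i.+1 != rmax (walk (X q)) i /\
    rmax (walk (X q)) (n_ q) <= rmax (walk (X q)) i.+1 + e q.
  rewrite /w mulf_eq0 negb_or subr_eq0 pnatr_eq0 eqb0 negbK => /andP[h1 h2].
  by split.
apply/cvgrPdist_le => c c0.
have c4 : 0 < c / 4 by rewrite divr_gt0.
have kt (r : R) : 0 < r -> \forall q \near \oo, [/\ (0 < n_ q)%N, `|gpos R (n_ q) (k q) - t| <= r
    & forall i, (gpos R (n_ q) i <= 1 - t)%R -> (i <= n_ q - k q)%N].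
  move=> r0; near=> q.
  have [n0 nr] : (0 < n_ q)%N /\ (n_ q)%:R^-1 <= r by near: q; exact: near_n.
  split=> //; first by apply: gidx_near => //; exact: ltW.
  move=> i; have /andP[h1 _] := gidx_itv n0 (ltW t0) => h2.
  have : gpos R (n_ q) (i + k q) <= 1 by rewrite /gpos natrD mulrDl; rewrite /gpos in h1 h2; lra.
  rewrite /gpos ler_pdivrMr ?ltr0n// mul1r ler_nat => h3.
  have kn : (k q <= n_ q)%N by apply: gidx_le; rewrite !ltW.
  by rewrite leq_subRL// addnC.
rewrite /vtarget; case: leP => [tt|tt].
  have {}tt : tau < 1 - t by rewrite lt_neqAle taut.
  have [r1 r10 hr1] := H_cont c4.
  (* The second bound keeps every weighted grid point at or before [1 - t], so stopping the sum at
     [n - k] loses no weight. *)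
  pose r := Num.min r1 (1 - t - tau).
  have r0 : 0 < r by rewrite lt_min r10/= subr_gt0.
  have eD : 0 < c / 2 / (1 + C * C) by rewrite !divr_gt0// ltr_pwDl.
  have fM : 0 < (f 0 - f tau) / 2.
    by rewrite divr_gt0// subr_gt0 argmin ?lexx ?ler01// lt_eqF.
  near=> q.
  have [n0 hk hi] : [/\ (0 < n_ q)%N, `|gpos R (n_ q) (k q) - t| <= r
    & forall i, (gpos R (n_ q) i <= 1 - t)%R -> (i <= n_ q - k q)%N] by near: q; exact: kt.
  have hrec : forall i, (i < n_ q)%N ->
    rmax (walk (X q)) i.+1 != rmax (walk (X q)) i ->
    rmax (walk (X q)) (n_ q) <= rmax (walk (X q)) i.+1 + e q ->
    `|gpos R (n_ q) i.+1 - tau| <= r by near: q; exact: near_record.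
  have e1 : e q <= 1 by near: q; exact: near_e.
  have eC : e q <= c / 2 / (1 + C * C) by near: q; exact: near_e.
  have ReM : e q <= rmax (walk (X q)) (n_ q).
    have h1 : e q <= (f 0 - f tau) / 2 by near: q; exact: near_e.
    have : `|rmax (walk (X q)) (n_ q) - (f 0 - f tau)| <= (f 0 - f tau) / 2.
      by near: q; exact: near_R.
    by rewrite ler_norml => /andP[h2 h3]; lra.
  rewrite sub0r normrN /lsum.
  have [sX|_] := boolP (small _ _ _); last by rewrite !mul0r subr0 normr0 ltW.
  rewrite !mul1r.
  set m := (n_ q - k q)%N.
  have mn : (m <= n_ q)%N by exact: leq_subr.
  have tail : \sum_(i < m) w q i = \sum_(i < n_ q) w q i.
    rewrite -(subnKC mn) big_split_ord/= [X in _ = _ + X]big1 ?addr0// => i _.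
    apply/eqP/negPn/negP => /wn0[h1 h2].
    have ni : (m + i < n_ q)%N by rewrite -[X in (_ < X)%N](subnKC mn) ltn_add2l.
    have := hrec _ ni h1 h2.
    have h3 : (r <= 1 - t - tau)%R by rewrite ge_min lexx orbT.
    rewrite ler_norml => /andP[_ h4].
    have /hi : gpos R (n_ q) (m + i).+1 <= 1 - t by lra.
    by rewrite -/m ltnNge leq_addr.
  have Wle : \sum_(i < m) w q i <= e q + e q ^+ 2.
    by apply: weight_sum_le => //; [exact: ltW | rewrite exprn_ge0// ltW].
  have Wge : e q <= \sum_(i < m) w q i.
    rewrite tail; apply: le_trans (record_sum_ge (n_ q) (walk0 (X q)) (ltW (e0 q))).
    by rewrite le_min ReM lexx.
  have dist : `|\sum_(i < m) lterm (n_ q) (k q) u v (e q) (X q) i.+1 - H tau t * \sum_(i < m) w q i|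
      <= c / 4 * \sum_(i < m) w q i.
    rewrite !mulr_sumr -sumrB; apply: le_trans (ler_norm_sum _ _ _) _.
    apply: ler_sum => i _; rewrite ltermE// -/(w q i) -mulrBl normrM (ger0_norm (w0 _ _)).
    have [->|/wn0[h1 h2]] := eqVneq (w q i) 0; first by rewrite !mulr0.
    apply: ler_wpM2r => //.
    have ni : (i < n_ q)%N := leq_trans (ltn_ord i) mn.
    have rr1 : r <= r1 by rewrite ge_min lexx.
    by apply: hr1; [exact: le_trans (hrec _ ni h1 h2) rr1 | exact: le_trans rr1].
  set L := \sum_(i < m) lterm _ _ _ _ _ _ _ in dist *.
  set W := \sum_(i < m) w q i in dist Wge Wle *.
  rewrite -/(H tau t).
  have /andP[H0 H1] := HC tau t.
  have -> : L / e q - H tau t = ((L - H tau t * W) + H tau t * (W - e q)) / e q.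
    by field; rewrite gt_eqF.
  (* Two errors, each at most [c / 2 * e q]: the variation of [H] over the weighted points, and the
     excess of the total weight over [e q]. *)
  rewrite normrM (gtr0_norm (x := (e q)^-1)) ?invr_gt0// ler_pdivrMr//.
  apply: le_trans (ler_normD _ _) _.
  rewrite normrM (ger0_norm H0) (ger0_norm (x := W - e q)); last by rewrite subr_ge0.
  have h1 : H tau t * (W - e q) <= C * C * e q ^+ 2.
    by apply: ler_pM => //; lra.
  have h2 : c / 4 * W <= c / 4 * (2 * e q).
    rewrite ler_pM2l//.
    have : e q ^+ 2 <= e q by rewrite expr2 ler_piMl// ltW.
    lra.
  have h3 : C * C * e q <= c / 2.
    move: eC; rewrite ler_pdivlMr; last by rewrite ltr_pwDl.
    have := e0 q; lra.
  have h4 : C * C * e q ^+ 2 <= c / 2 * e q.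
    by rewrite expr2 mulrA ler_pM2r.
  by lra.
(* A weighted index [i] would give a grid point within [r] of [tau] whose sum with a point within
   [r] of [t] is at most 1. Two errors of a third of the gap cannot close the gap, so all terms
   vanish. *)
pose r := (tau - (1 - t)) / 3.
have r0 : 0 < r by rewrite divr_gt0// subr_gt0.
near=> q.
have [n0 hk hi] : [/\ (0 < n_ q)%N, `|gpos R (n_ q) (k q) - t| <= r
  & forall i, (gpos R (n_ q) i <= 1 - t)%R -> (i <= n_ q - k q)%N] by near: q; exact: kt.
have hrec : forall i, (i < n_ q)%N ->
  rmax (walk (X q)) i.+1 != rmax (walk (X q)) i ->
  rmax (walk (X q)) (n_ q) <= rmax (walk (X q)) i.+1 + e q ->
  `|gpos R (n_ q) i.+1 - tau| <= r by near: q; exact: near_record.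
rewrite mulr0 subr0 sub0r normrN /lsum big1 ?mulr0 ?mul0r ?normr0 ?ltW// => i _.
rewrite ltermE// -/(w q i).
have [->|/wn0[h1 h2]] := eqVneq (w q i) 0; first by rewrite mulr0.
have kn : (k q <= n_ q)%N by apply: gidx_le; rewrite !ltW.
have im := ltn_ord i.
have ni : (i < n_ q)%N := leq_trans im (leq_subr _ _).
have := hrec _ ni h1 h2; move: hk; rewrite !ler_norml => /andP[h3 h4] /andP[h5 h6].
have : gpos R (n_ q) (i.+1 + k q) <= 1.
  have ikn : (i.+1 + k q <= n_ q)%N by rewrite addnC addnS -ltn_subRL.
  by have /andP[] := @gpos_itv R (n_ q) (i.+1 + k q)%N ikn.
rewrite /gpos natrD mulrDl -/(gpos R _ i.+1) -/(gpos R _ (k q)) => h7.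
by rewrite /r in h3 h4 h5 h6; lra.
Unshelve. all: by end_near. Qed.

End unique_argmin_limit.

(** * Gaussian densities *)

Section density.
Local Open Scope ereal_scope.
Context {d : measure_display} {T : measurableType d} {R : realType}.
Variables (mu nu : {measure set T -> \bar R}) (g : T -> R).
Hypotheses (mg : measurable_fun setT g) (g0 : forall x, (0 <= g x)%R).
Hypothesis nuE : forall A, measurable A -> nu A = \int[mu]_(x in A) (g x)%:E.

Import HBNNSimple.

(** On indicators this is the hypothesis [nuE]; linearity and monotone convergence along simple
    functions extend it. *)
Lemma ge0_integral_density (f : T -> \bar R) :
  measurable_fun setT f -> (forall x, 0 <= f x) ->
  \int[nu]_x f x = \int[mu]_x (f x * (g x)%:E).
Proof.
move=> mf f0.
pose f_ := nnsfun_approx measurableT mf.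
have ind (A : set T) : measurable A ->
    \int[mu]_x ((\1_A x)%:E * (g x)%:E) = nu A.
  move=> mA; rewrite nuE// [RHS]integral_mkcond; apply: eq_integral => x _.
  by rewrite patchE indicE; case: ifP => _; rewrite ?mul1e ?mul0e.
transitivity (limn (fun n => \int[nu]_x (f_ n x)%:E)).
  rewrite -monotone_convergence//.
  - apply: eq_integral => y _; apply/esym/cvg_lim => //.
    by apply: cvg_nnsfun_approx => // *; apply: f0.
  - by move=> n; exact/measurable_EFinP/measurable_funP.
  - by move=> n y _; rewrite lee_fin.
  - by move=> y _ m n mn; rewrite lee_fin; exact/lefP/nd_nnsfun_approx.
transitivity (limn (fun n => \int[mu]_x ((f_ n x)%:E * (g x)%:E))); last first.
  rewrite -monotone_convergence//.
  - apply: eq_integral => y _; apply/cvg_lim => //.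
    apply: cvgeZr => //.
    by apply: cvg_nnsfun_approx => // *; apply: f0.
  - move=> n; apply: emeasurable_funM; last exact/measurable_EFinP.
    exact/measurable_EFinP/measurable_funP.
  - by move=> n y _; rewrite mule_ge0// lee_fin.
  - move=> y _ m n mn; apply: lee_wpmul2r; first by rewrite lee_fin.
    by rewrite lee_fin; exact/lefP/nd_nnsfun_approx.
congr (limn _); apply/funext => n.
transitivity (\sum_(k \in range (f_ n)) k%:E * nu (f_ n @^-1` [set k])).
  under eq_integral do rewrite fimfunE -fsumEFin//.
  rewrite ge0_integral_fsum//; last 2 first.
  - by move=> y; exact/measurable_EFinP/measurable_funM.
  - by move=> y x _; rewrite nnfun_muleindic_ge0.
  apply: eq_fsbigr => r _; rewrite integralZl_indic_nnsfun// integral_indic//=.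
  by rewrite setIT.
transitivity (\sum_(k \in range (f_ n))
    \int[mu]_x ((k * \1_(f_ n @^-1` [set k]) x)%:E * (g x)%:E)).
  apply: eq_fsbigr => r; rewrite inE => -[z _ <-].
  under eq_integral do rewrite EFinM -muleA.
  rewrite ge0_integralZl//; first by rewrite ind.
  - apply: emeasurable_funM; last exact/measurable_EFinP.
    exact/measurable_EFinP/measurable_indic.
  - by move=> x _; rewrite mule_ge0// lee_fin.
  - by rewrite lee_fin.
rewrite -ge0_integral_fsum//; last 2 first.
- move=> y; apply: emeasurable_funM; last exact/measurable_EFinP.
  by apply/measurable_EFinP/measurable_funM => //; exact/measurable_indic.
- by move=> y x _; rewrite mule_ge0 ?nnfun_muleindic_ge0// lee_fin.
apply: eq_integral => x _.
rewrite [in RHS]fimfunE -fsumEFin// ge0_mule_fsuml// => r.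
by rewrite nnfun_muleindic_ge0.
Qed.

End density.

Section lebesgue_symmetries.
Local Open Scope ereal_scope.
Context {R : realType}.
Local Notation mu := (@lebesgue_measure R).
Implicit Types f : R -> \bar R.

Lemma ge0_integralN f : measurable_fun setT f -> (forall x, 0 <= f x) ->
  \int[mu]_x f (- x)%R = \int[mu]_x f x.
Proof.
move=> mf f0.
transitivity (\int[pushforward mu (-%R : _ -> measurableTypeR R)]_y f y).
  by rewrite ge0_integral_pushforward// preimage_setT.
by apply: eq_measure_integral => A mA _; exact: lebesgue_measureN.
Qed.

Let addc (c : R) (x : measurableTypeR R) : measurableTypeR R := (x + c)%R.

Let maddc c : measurable_fun setT (addc c).
Proof. by apply: measurable_funD. Qed.

Lemma lebesgue_measure_shift c (A : set R) : measurable A ->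
  pushforward mu (addc c) A = mu A.
Proof.
move=> mA.
pose ac : {mfun measurableTypeR R >-> measurableTypeR R} :=
  HB.pack (addc c) (isMeasurableFun.Build _ _ _ _ _ (maddc c)).
apply/esym/(@lebesgue_measure_unique _ (pushforward mu ac)) => //= _ [[a b]] _ <-.
rewrite /pushforward.
have -> : addc c @^-1` `]a, b] = `](a - c)%R, (b - c)%R]%classic.
  by apply/seteqP; split => x; rewrite /addc /= !in_itv /= ltrBlDr lerBrDr.
rewrite !lebesgue_measure_itv/= !lte_fin ltrD2r.
by case: ifP => // _; rewrite -!EFinD; congr EFin; ring.
Qed.

Lemma ge0_integral_shift c f : measurable_fun setT f -> (forall x, 0 <= f x) ->
  \int[mu]_x f (x + c)%R = \int[mu]_x f x.
Proof.
move=> mf f0.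
transitivity (\int[pushforward mu (addc c : _ -> measurableTypeR R)]_y f y).
  by rewrite ge0_integral_pushforward// preimage_setT.
by apply: eq_measure_integral => A mA _; exact: lebesgue_measure_shift.
Qed.

End lebesgue_symmetries.

Section gaussian_density.
Context {R : realType}.
Local Notation mu := (@lebesgue_measure R).

(* [l] is the variance, while [normal_pdf] expects the standard deviation. *)
Definition gpdf (l x : R) : R := normal_pdf 0 (Num.sqrt l) x.

Lemma gpdfE l x : 0 < l ->
  gpdf l x = (Num.sqrt (l * pi *+ 2))^-1 * expR (- (x ^+ 2 / (l *+ 2))).
Proof.
move=> l0; rewrite /gpdf normal_pdfE ?gt_eqF ?sqrtr_gt0//.
by rewrite /normal_peak /normal_fun subr0 sqr_sqrtr ?ltW// mulNr.
Qed.

Lemma gpdfN l x : 0 < l -> gpdf l (- x) = gpdf l x.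
Proof. by move=> l0; rewrite !gpdfE// sqrrN. Qed.

Lemma gpdf_gt0 l x : 0 < l -> 0 < gpdf l x.
Proof.
move=> l0; rewrite gpdfE// mulr_gt0 ?expR_gt0// invr_gt0 sqrtr_gt0.
by rewrite pmulrn_rgt0// mulr_gt0// pi_gt0.
Qed.

Lemma gpdf_ge0 l x : 0 <= gpdf l x. Proof. exact: normal_pdf_ge0. Qed.

Lemma measurable_gpdf l : measurable_fun setT (gpdf l).
Proof. exact: measurable_normal_pdf. Qed.

Lemma integral_gpdf l : (\int[mu]_x (gpdf l x)%:E = 1)%E.
Proof. exact: integral_normal_pdf. Qed.

Lemma normal_probN l (A : set R) : 0 < l -> measurable A ->
  normal_prob 0 (Num.sqrt l) [set x | A (- x)] = normal_prob 0 (Num.sqrt l) A.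
Proof.
move=> l0 mA; rewrite /normal_prob [LHS]integral_mkcond [RHS]integral_mkcond.
pose f x := (((fun x => (gpdf l x)%:E) \_ A) x)%E.
rewrite -[RHS](@ge0_integralN _ f).
- apply: eq_integral => x _; rewrite /f !patchE /=.
  have -> : (x \in [set x | A (- x)]) = (- x \in A) by apply/idP/idP; rewrite !inE.
  by rewrite gpdfN.
- apply/(measurable_restrictT _ mA)/measurable_EFinP; apply: measurable_funTS; exact: measurable_gpdf.
- by move=> x; rewrite /f patchE; case: ifP => // _; rewrite lee_fin gpdf_ge0.
Qed.

End gaussian_density.

Section gaussian_law.
Context {d : measure_display} {T : measurableType d} {R : realType}.
Variables (P : probability T R) (Y : T -> R) (l : R).
Hypotheses (mY : measurable_fun setT Y)
  (YE : forall A, measurable A -> P [set w | A (Y w)] = normal_prob 0 (Num.sqrt l) A).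
Local Notation mu := (@lebesgue_measure R).

Lemma ge0_integral_gaussian (f : R -> \bar R) :
  measurable_fun setT f -> (forall x, 0 <= f x)%E ->
  (\int[P]_w f (Y w) = \int[mu]_x (f x * (gpdf l x)%:E))%E.
Proof.
move=> mf f0.
pose nu : {measure set (measurableTypeR R) -> \bar R} := normal_prob 0 (Num.sqrt l).
rewrite -(@ge0_integral_density _ _ _ mu nu (gpdf l))//; last 2 first.
- exact: measurable_gpdf.
- exact: gpdf_ge0.
pose YM : {mfun T >-> measurableTypeR R} := HB.pack (Y : T -> measurableTypeR R)
  (isMeasurableFun.Build _ _ _ _ (Y : T -> measurableTypeR R) mY).
transitivity (\int[pushforward P YM]_y f y)%E.
  by rewrite ge0_integral_pushforward// preimage_setT.
by apply: eq_measure_integral => A mA _; rewrite /pushforward/= -YE.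
Qed.

Lemma Ex_gaussian (f : R -> R) : bdm f ->
  \int[P]_w f (Y w) = \int[mu]_x (f x * gpdf l x).
Proof.
move=> [mf [C hC]]; rewrite /Rintegral; congr fine.
rewrite integralE [RHS]integralE; congr (_ - _)%E.
- transitivity (\int[P]_w (Num.max (f (Y w)) 0)%:E)%E.
    by apply: eq_integral => w _; rewrite funeposE EFin_max.
  rewrite (@ge0_integral_gaussian (fun x => (Num.max (f x) 0)%:E))//.
  + apply: eq_integral => x _; rewrite funeposE -EFin_max -EFinM; congr EFin.
    by rewrite maxr_pMl ?gpdf_ge0// mul0r.
  + by apply/measurable_EFinP/measurable_maxr.
  + by move=> x; rewrite lee_fin le_max lexx orbT.
- transitivity (\int[P]_w (Num.max (- f (Y w)) 0)%:E)%E.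
    by apply: eq_integral => w _; rewrite funenegE EFin_max.
  rewrite (@ge0_integral_gaussian (fun x => (Num.max (- f x) 0)%:E))//.
  + apply: eq_integral => x _; rewrite funenegE -EFinN -EFin_max -EFinM; congr EFin.
    by rewrite maxr_pMl ?gpdf_ge0// mul0r mulNr.
  + by apply/measurable_EFinP/measurable_maxr => //; apply: measurableT_comp.
  + by move=> x; rewrite lee_fin le_max lexx orbT.
Qed.

End gaussian_law.

(** * Measurable functionals of finitely many increments *)

Section path_functionals.
Variable R : realType.
Implicit Types (F : (nat -> R) -> R) (n : nat).

(** Measurability is quantified over the source space because one functional is evaluated on a path,
    on a pair of independent paths and on tuples. *)
Definition mfn F := forall d (S : measurableType d) (Y : nat -> S -> R),
  (forall i, measurable_fun setT (Y i)) ->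
  measurable_fun setT (fun s => F (fun i => Y i s)).

Definition local n F := forall x y : nat -> R,
  (forall i, (i < n)%N -> x i = y i) -> F x = F y.

Lemma mfn_cst c : mfn (fun _ => c). Proof. by move=> d S Y mY. Qed.

Lemma mfn_proj i : mfn (fun X => X i). Proof. by move=> d S Y mY. Qed.

Lemma mfnD F G : mfn F -> mfn G -> mfn (fun X => F X + G X).
Proof. by move=> mF mG d S Y mY; apply: measurable_funD; [exact: mF|exact: mG]. Qed.

Lemma mfnB F G : mfn F -> mfn G -> mfn (fun X => F X - G X).
Proof. by move=> mF mG d S Y mY; apply: measurable_funB; [exact: mF|exact: mG]. Qed.

Lemma mfnM F G : mfn F -> mfn G -> mfn (fun X => F X * G X).
Proof. by move=> mF mG d S Y mY; apply: measurable_funM; [exact: mF|exact: mG]. Qed.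

Lemma mfn_comp (u : R -> R) F : continuous u -> mfn F -> mfn (fun X => u (F X)).
Proof.
move=> cu mF d S Y mY; apply: (measurableT_comp (f := u)); last exact: mF.
exact: continuous_measurable_fun.
Qed.

Lemma mfn_compm (u : R -> R) F : measurable_fun setT u -> mfn F -> mfn (fun X => u (F X)).
Proof. by move=> mu mF d S Y mY; apply: (measurableT_comp (f := u)) => //; exact: mF. Qed.

Lemma mfn_max F G : mfn F -> mfn G -> mfn (fun X => Num.max (F X) (G X)).
Proof. by move=> mF mG d S Y mY; apply: measurable_maxr; [exact: mF|exact: mG]. Qed.

Lemma measurable_natr d (S : measurableType d) (b : S -> bool) :
  measurable_fun setT b -> measurable_fun setT (fun s => (b s)%:R : R).
Proof. by move=> mb; have [] := @bdm_bool _ _ R b mb. Qed.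

Lemma mfn_le F G : mfn F -> mfn G -> mfn (fun X => (F X <= G X)%R%:R).
Proof.
move=> mF mG d S Y mY; apply: measurable_natr.
by apply: measurable_fun_ler; [exact: mF|exact: mG].
Qed.

Lemma mfn_lt F G : mfn F -> mfn G -> mfn (fun X => (F X < G X)%R%:R).
Proof.
move=> mF mG d S Y mY; apply: measurable_natr.
by apply: measurable_fun_ltr; [exact: mF|exact: mG].
Qed.

Lemma mfn_sum n (F : nat -> (nat -> R) -> R) :
  (forall i, mfn (F i)) -> mfn (fun X => \sum_(i < n) F i X).
Proof. by move=> mF d S Y mY; apply: measurable_sum => i; exact: mF. Qed.

Lemma mfn_prod n (F : nat -> (nat -> R) -> R) :
  (forall i, mfn (F i)) -> mfn (fun X => \prod_(i < n) F i X).
Proof.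
move=> mF; elim: n => [|n IH].
  by move=> d S Y mY; under eq_fun do rewrite big_ord0; exact: measurable_cst.
move=> d S Y mY; under eq_fun do rewrite big_ord_recr/=.
by apply: measurable_funM; [exact: IH|exact: mF].
Qed.

Lemma mfn_walk j : mfn (fun X => walk X j).
Proof. by apply: (@mfn_sum j (fun i X => X i)) => i; exact: mfn_proj. Qed.

Lemma mfn_rmax (s : (nat -> R) -> nat -> R) j :
  (forall l, mfn (fun X => s X l)) -> mfn (fun X => rmax (s X) j).
Proof.
have mN l : (forall l, mfn (fun X => s X l)) -> mfn (fun X => - s X l).
  by move=> ms d S Y mY; apply: measurableT_comp => //; exact: ms.
by move=> ms; elim: j => [|j IH] /=; [exact: mN | apply: mfn_max => //; exact: mN].
Qed.

Lemma mfn_zwalk k l : mfn (fun X => zwalk k X l).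
Proof. by apply: mfnB; exact: mfn_walk. Qed.

Lemma prod_bool n (b : nat -> bool) : \prod_(i < n) (b i)%:R = [forall i : 'I_n, b i]%:R :> R.
Proof.
elim: n => [|n IH].
  by rewrite big_ord0 (_ : [forall _, _]) //; apply/forallP => -[].
rewrite big_ord_recr/= IH -natrM mulnb; congr (nat_of_bool _)%:R.
apply/andP/forallP => [[/forallP h1 h2] i|h].
  by case: (unliftP ord_max i) => [j ->|->//]; have := h1 j; rewrite lift_max.
split; last exact: (h ord_max).
by apply/forallP => l; have := h (widen_ord (leqnSn _) l).
Qed.

Lemma mfn_small n d : mfn (fun X => (small X n d)%:R).
Proof.
have -> : (fun X : nat -> R => (small X n d)%:R) = fun X => \prod_(i < n) (`|X i| <= d)%R%:R :> R.
  by apply/funext => X; rewrite (prod_bool _ (fun i => `|X i| <= d)).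
apply: (@mfn_prod n (fun i X => (`|X i| <= d)%R%:R)) => i; apply: mfn_le; last exact: mfn_cst.
by apply: (@mfn_comp Num.norm); [exact: norm_continuous|exact: mfn_proj].
Qed.

Section core_functionals.
Variables (u v : R -> R) (n k : nat) (e : R).
Hypotheses (cu : continuous u) (cv : continuous v) (kn : (k <= n)%N).

Let mcu F : mfn F -> mfn (fun X => u (F X)). Proof. exact: mfn_comp. Qed.
Let mcv F : mfn F -> mfn (fun X => v (F X)). Proof. exact: mfn_comp. Qed.

Lemma mfn_lterm j : mfn (fun X => lterm n k u v e X j).
Proof.
have mS := mfn_walk; have mR l : mfn (fun X => rmax (walk X) l) by exact: mfn_rmax.
apply: mfnM; first apply: mfnM.
- by apply: mcu; apply: mfnB.
- by apply: mcv; do 2 apply: mfnB => //.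
- apply: mfnM; first exact: mfnB.
  by apply: mfn_le => //; apply: mfnD => //; exact: mfn_cst.
Qed.

Lemma mfn_rterm j : mfn (fun X => rterm n k u v e X j).
Proof.
have mS := mfn_walk; have mR l : mfn (fun X => rmax (walk X) l) by exact: mfn_rmax.
have mZ := mfn_zwalk k; have mRZ l : mfn (fun X => rmax (zwalk k X) l) by exact: mfn_rmax.
apply: mfnM; first apply: mfnM.
- by apply: mfnM; [exact: mcu|exact: mcv].
- by apply: mfn_le => //; exact: mfn_cst.
- apply: mfnM; first exact: mfnB.
  by apply: mfn_le => //; do 2 apply: mfnD => //; exact: mfn_cst.
Qed.

Lemma local_walk j : (j <= n)%N -> local n (fun X => walk X j).
Proof. by move=> jn x y xy; apply: walk_ext => i ij; apply: xy; exact: leq_trans jn. Qed.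

Lemma local_rmax_walk j : (j <= n)%N -> local n (fun X => rmax (walk X) j).
Proof.
move=> jn x y xy; apply: rmax_ext => l lj; apply: local_walk xy; exact: leq_trans jn.
Qed.

Lemma local_zwalk j : (j <= n - k)%N -> local n (fun X => zwalk k X j).
Proof.
move=> jn x y xy; rewrite /zwalk; congr (_ - _); last exact: local_walk xy.
by apply: local_walk xy; rewrite -(subnKC kn) leq_add2l.
Qed.

Lemma local_rmax_zwalk j : (j <= n - k)%N -> local n (fun X => rmax (zwalk k X) j).
Proof.
move=> jn x y xy; apply: rmax_ext => l lj; apply: local_zwalk xy; exact: leq_trans jn.
Qed.

Lemma local_lterm j : (j <= n - k)%N -> local n (fun X => lterm n k u v e X j).
Proof.
move=> jn x y xy.
have jkn : (j + k <= n)%N by rewrite addnC -leq_subRL.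
have jn' : (j <= n)%N := leq_trans (leq_addr k j) jkn.
have jp : (j.-1 <= n)%N := leq_trans (leq_pred j) jn'.
rewrite /lterm (local_walk jkn xy) (local_walk jn' xy) (local_walk (leqnn n) xy).
by rewrite (local_rmax_walk jn' xy) (local_rmax_walk jp xy) (local_rmax_walk (leqnn n) xy).
Qed.

Lemma local_rterm j : (j <= n - k)%N -> local n (fun X => rterm n k u v e X j).
Proof.
move=> jn x y xy; have jp : (j.-1 <= n - k)%N := leq_trans (leq_pred j) jn.
rewrite /rterm (local_walk kn xy) (local_zwalk (leqnn _) xy) (local_rmax_walk kn xy).
by rewrite (local_rmax_zwalk jn xy) (local_rmax_zwalk jp xy) (local_rmax_zwalk (leqnn _) xy).
Qed.

Lemma local_small d : local n (fun X => (small X n d)%:R).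
Proof.
by move=> x y xy; rewrite /small; congr (nat_of_bool _)%:R; apply: eq_forallb => i; rewrite xy.
Qed.

End core_functionals.
End path_functionals.

Lemma mfn_law_uniq (R : realType) d d' (T : measurableType d) (T' : measurableType d')
    (P : probability T R) (P' : probability T' R) n (X : nat -> T -> R) (X' : nat -> T' -> R)
    (F : (nat -> R) -> R) :
  (forall i, (i < n)%N -> measurable_fun setT (X i)) ->
  (forall i, (i < n)%N -> measurable_fun setT (X' i)) ->
  (forall A : nat -> set R, (forall i, measurable (A i)) ->
    P [set w | forall i, (i < n)%N -> A i (X i w)] =
    P' [set w | forall i, (i < n)%N -> A i (X' i w)]) ->
  mfn F -> local n F ->
  \int[P]_w F (fun i => X i w) = \int[P']_w F (fun i => X' i w).
Proof.
move=> mX mX' XX' mF lF; apply: integral_law_uniq XX' _ _ _ => //.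
apply: mF => i; have [ni|ni] := ltnP i n.
  by under eq_fun do rewrite -(tnth_nth 0 _ (Ordinal ni)); exact: measurable_tnth.
by under eq_fun do rewrite nth_default ?size_tuple//; exact: measurable_cst.
Qed.

(** * Brownian increments *)

(* The values of [B] outside [[0, 1]] are normalised so that each bpath is
   uniformly continuous on the whole line. *)
Record uniform_bm (d : measure_display) (T : measurableType d) (R : realType)
    (P : probability T R) (B : R -> T -> R) : Prop := {
  ubm_bm : standard_brownian_motion P B ;
  ubm_measurable : forall t, measurable_fun [set: T] (B t) ;
  ubm_ucont : forall w, ucont (fun t => B t w)
}.

Section brownian_increments.
Context {d : measure_display} {T : measurableType d} {R : realType}.
Variables (P : probability T R) (B : R -> T -> R).
Hypothesis hB : uniform_bm P B.
Implicit Types (A : nat -> set R) (F : (nat -> R) -> R) (n k : nat).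

Local Notation gauss l := (normal_prob 0 (Num.sqrt (l : R))).

Let mB t : measurable_fun setT (B t). Proof. exact: ubm_measurable hB t. Qed.

Definition bpath (w : T) (s : R) : R := B s w.

Lemma bpath_ucont w : ucont (bpath w). Proof. exact: ubm_ucont hB w. Qed.

Lemma bpath0 w : bpath w 0 = 0. Proof. exact: bm_start (ubm_bm hB) w. Qed.

Section strict_grid.
Variables (n : nat) (p : nat -> R).
Hypotheses (p0 : 0 <= p 0%N) (p_lt : forall i, (i < n)%N -> p i < p i.+1) (p1 : p n <= 1).

Definition ginc i (w : T) : R := bpath w (p i.+1) - bpath w (p i).

Lemma measurable_ginc i : measurable_fun setT (ginc i).
Proof. by apply: measurable_funB; exact: mB. Qed.

Let p_ge i : (i <= n)%N -> 0 <= p i.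
Proof.
elim: i => // i IH ni; rewrite (le_trans (IH (ltnW ni)))// ltW//; exact: p_lt.
Qed.

Let p_le i : p (n - i)%N <= 1.
Proof.
elim: i => [|i IH]; first by rewrite subn0.
have [ni|ni] := leqP n i.
  have /eqP -> : (n - i.+1 == 0)%N by rewrite subn_eq0 leqW.
  by move: ni; rewrite -subn_eq0 => /eqP e; rewrite -{1}e.
have e : (n - i)%N = (n - i.+1).+1 by rewrite subnSK.
by apply: le_trans IH; rewrite e ltW// p_lt// -e leq_subr.
Qed.

Lemma grid_prob A : (forall i, measurable (A i)) ->
  (P [set w | forall i, (i < n)%N -> A i (ginc i w)] =
   \prod_(i < n) gauss (p i.+1 - p i) (A i))%E.
Proof.
move=> mA.
have := @bm_independent _ _ _ _ _ (ubm_bm hB) n p p0 (fun i ni => ltW (p_lt ni)) p1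
  (fun i : 'I_n => A i) (fun i => mA i).
rewrite (_ : [set w | forall i : 'I_n, _] = [set w | forall i, (i < n)%N -> A i (ginc i w)]); last first.
  by apply/seteqP; split => w /= h i; [move=> ni; exact: (h (Ordinal ni)) | exact: h].
move=> ->; apply: eq_bigr => i _.
have ni := ltn_ord i.
rewrite -(@bm_gaussian _ _ _ _ _ (ubm_bm hB))//.
- exact/p_ge/ltnW.
- exact: p_lt.
- by have := p_le (n - i.+1)%N; rewrite subKn.
Qed.

(** The increments are independent and each centred Gaussian is symmetric, so flipping any
    deterministic set of signs preserves the joint law. *)
Lemma flip_law (sg : nat -> bool) F : mfn F -> local n F ->
  \int[P]_w F (fun i => ginc i w) = \int[P]_w F (fun i => (-1) ^+ sg i * ginc i w).
Proof.
move=> mF lF; apply: (@mfn_law_uniq _ _ _ _ _ _ _ n ginc (fun i w => (-1) ^+ sg i * ginc i w)) => //.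
- by move=> i _; exact: measurable_ginc.
- by move=> i _; apply: measurable_funM => //; exact: measurable_ginc.
move=> A mA; rewrite grid_prob//.
pose A' i := if sg i then [set x | A i (- x)] else A i.
have mN i : measurable [set x | A i (- x)].
  by have := @oppr_measurable R setT measurableT _ (mA i); rewrite setTI.
have mA' i : measurable (A' i) by rewrite /A'; case: ifP.
rewrite (_ : [set w | _] = [set w | forall i, (i < n)%N -> A' i (ginc i w)]); last first.
  apply/seteqP; split => w /= h i ni; have := h i ni; rewrite /A';
    by case: (sg i); rewrite /= ?mulN1r ?mul1r.
rewrite grid_prob//; apply: eq_bigr => i _; rewrite /A'; case: ifP => // _.
by rewrite normal_probN// subr_gt0 p_lt.
Qed.

End strict_grid.

Section uniform_grid.
Variable n : nat.
Hypothesis n0 : (0 < n)%N.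

Let p_lt i : (i < n)%N -> gpos R n i < gpos R n i.+1.
Proof. by move=> _; rewrite gposS ltrDl invr_gt0 ltr0n. Qed.

Let p0 : 0 <= gpos R n 0. Proof. by rewrite gpos0. Qed.
Let p1 : gpos R n n <= 1. Proof. by rewrite gposnn. Qed.

Let uniform_prob A : (forall i, measurable (A i)) ->
  (P [set w | forall i, (i < n)%N -> A i (incr (bpath w) n i)] =
   \prod_(i < n) gauss (n%:R^-1) (A i))%E.
Proof.
move=> mA; rewrite -[LHS]/(P [set w | forall i, (i < n)%N -> A i (ginc (gpos R n) i w)]).
rewrite (grid_prob p0 p_lt p1 mA); apply: eq_bigr => i _.
by rewrite gposS addrAC subrr add0r.
Qed.

Lemma measurable_incr i : measurable_fun setT (fun w => incr (bpath w) n i).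
Proof. by apply: measurable_funB; exact: mB. Qed.

Lemma perm_law (s s' : nat -> nat) F :
  (forall i, (i < n)%N -> (s i < n)%N /\ s' (s i) = i) ->
  (forall i, (i < n)%N -> (s' i < n)%N /\ s (s' i) = i) ->
  mfn F -> local n F ->
  \int[P]_w F (incr (bpath w) n) = \int[P]_w F (incr (bpath w) n \o s).
Proof.
move=> ss' s's mF lF.
apply: (@mfn_law_uniq _ _ _ _ _ _ _ n (fun i w => incr (bpath w) n i)
  (fun i w => incr (bpath w) n (s i))) => //.
- by move=> i _; exact: measurable_incr.
- by move=> i _; exact: measurable_incr.
move=> A mA; rewrite uniform_prob//.
rewrite [X in _ = P X](_ : _ = [set w | forall i, (i < n)%N -> A (s' i) (incr (bpath w) n i)]); last first.
  apply/seteqP; split => w /= h i ni.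
    by have [a b] := s's i ni; have := h _ a; rewrite b.
  by have [a b] := ss' i ni; have := h _ a; rewrite b.
rewrite (uniform_prob (A := fun i => A (s' i)))//.
rewrite -(big_mkord xpredT (fun i => gauss n%:R^-1 (A i))).
rewrite -(big_mkord xpredT (fun i => gauss n%:R^-1 (A (s' i)))) /index_iota subn0.
rewrite -(big_map s' xpredT (fun i => gauss n%:R^-1 (A i))).
apply: perm_big; apply: uniq_perm; rewrite ?iota_uniq//.
  rewrite map_inj_in_uniq ?iota_uniq// => i j; rewrite !mem_iota !add0n => /s's[_ h1] /s's[_ h2] e.
  by rewrite -h1 -h2 e.
move=> i; rewrite mem_iota add0n; apply/idP/mapP => [ni|[j]].
  by have [a b] := ss' i ni; exists (s i); rewrite ?mem_iota ?add0n.
by rewrite mem_iota add0n => /s's[a _] ->.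
Qed.

(** On a uniform grid the increments are identically distributed; the inverse permutation [s'] moves
    the block back. *)
Lemma block_front_law k j F : (j + k <= n)%N -> mfn F -> local n F ->
  \int[P]_w F (incr (bpath w) n) = \int[P]_w F (incr (bpath w) n \o block_front k j).
Proof.
move=> jkn; pose s' i := if (i < k)%N then (j + i)%N else if (i < k + j)%N then (i - k)%N else i.
apply: (@perm_law _ s') => i ni; rewrite /block_front /s'.
  have [ij|ij] := ltnP i j.
    rewrite (ltnNge (k + i)%N k) leq_addr/= ltn_add2l ij addKn; split=> //.
    by apply: leq_trans jkn; rewrite addnC ltn_add2r.
  have [ijk|ijk] := ltnP i (j + k).
    have -> : (i - j < k)%N by rewrite ltn_subLR.
    by rewrite subnKC//; split=> //; apply: leq_ltn_trans ni; exact: leq_subr.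
  by rewrite (ltnNge i k) (leq_trans (leq_addl j k) ijk)/= (ltnNge i (k + j)%N) (addnC k) ijk/=.
have [ik|ik] := ltnP i k.
  rewrite (ltnNge (j + i)%N j) leq_addr/= ltn_add2l ik addKn; split=> //.
  by apply: leq_trans jkn; rewrite ltn_add2l.
have [ijk|ijk] := ltnP i (k + j).
  have -> : (i - k < j)%N by rewrite ltn_subLR.
  by rewrite subnKC//; split=> //; apply: leq_ltn_trans ni; exact: leq_subr.
by rewrite (ltnNge i j) (leq_trans (leq_addl k j) ijk)/= (ltnNge i (j + k)%N) (addnC j) ijk/=.
Qed.

(** By independence the first [k] increments and the others may come from two independent copies.
    This lets Fubini separate the blocks without conditioning on the Brownian motion. *)
Lemma mixed_law k F : (k <= n)%N -> mfn F -> local n F ->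
  \int[P]_w F (incr (bpath w) n) =
  \int[(P \x P)%E]_w F (mixed (bpath w.1) (bpath w.2) n k).
Proof.
move=> kn mF lF.
apply: (@mfn_law_uniq _ _ _ _ _ _ _ n (fun i w => incr (bpath w) n i)
  (fun i w => mixed (bpath w.1) (bpath w.2) n k i)) => //.
- by move=> i _; exact: measurable_incr.
- move=> i _; rewrite /mixed; case: (i < k)%N.
    by apply: (measurableT_comp (measurable_incr i)).
  by apply: (measurableT_comp (measurable_incr i)).
move=> A mA.
pose A1 i := if (i < k)%N then A i else setT.
pose A2 i := if (i < k)%N then setT else A i.
have mA1 i : measurable (A1 i) by rewrite /A1; case: ifP.
have mA2 i : measurable (A2 i) by rewrite /A2; case: ifP.
rewrite [X in _ = _ X](_ : _ = [set w | forall i, (i < n)%N -> A1 i (incr (bpath w) n i)] `*`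
   [set w | forall i, (i < n)%N -> A2 i (incr (bpath w) n i)]); last first.
  apply/seteqP; split => -[w1 w2] /= h.
    split=> i ni; have := h i ni; rewrite /mixed /A1 /A2; by case: ifP.
  move=> i ni; have := h.1 i ni; have := h.2 i ni; rewrite /mixed /A1 /A2; by case: ifP.
have mr A' : (forall i, measurable (A' i)) ->
    measurable [set w | forall i, (i < n)%N -> A' i (incr (bpath w) n i)].
  move=> mA'; apply: (@measurable_forall_lt _ _ n (fun i => [set w | A' i (incr (bpath w) n i)])) => i _.
  by rewrite -[X in measurable X]setTI; exact: measurable_incr.
apply: (@eq_trans _ _ (P [set w | forall i, (i < n)%N -> A1 i (incr (bpath w) n i)] *
  P [set w | forall i, (i < n)%N -> A2 i (incr (bpath w) n i)])%E); last first.
  by rewrite [RHS](product_measure1E P P (mr _ mA1) (mr _ mA2)).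
rewrite (uniform_prob mA) (uniform_prob mA1) (uniform_prob mA2) -big_split/=.
apply: eq_bigr => i _; rewrite /A1 /A2.
by case: ifP => _; rewrite probability_setT ?mule1 ?mul1e.
Qed.

End uniform_grid.
End brownian_increments.

(** * End value and depth of a block: the reflection principle *)

Section block.
Context {d : measure_display} {T : measurableType d} {R : realType}.
Variables (P : probability T R) (B : R -> T -> R).
Hypothesis hB : uniform_bm P B.
Variables a b : R.
Hypotheses (a0 : 0 <= a) (ab : a < b) (b1 : b <= 1).

Local Notation f w := (bpath B w).

Let uf w : ucont (f w). Proof. exact: bpath_ucont hB w. Qed.
Let mB t : measurable_fun setT (B t). Proof. exact: ubm_measurable hB t. Qed.

Definition bpos (m i : nat) : R := a + (b - a) * (i%:R / m%:R).

Let bpos0 m : bpos m 0 = a. Proof. by rewrite /bpos mul0r mulr0 addr0. Qed.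

Let bposm m : (0 < m)%N -> bpos m m = b.
Proof. by move=> m0; rewrite /bpos divff ?pnatr_eq0 -?lt0n// mulr1 addrC subrK. Qed.

Let bposS m i : bpos m i.+1 = bpos m i + (b - a) / m%:R.
Proof. by rewrite /bpos -natr1 (mulrDl i%:R) mulrDr addrA mul1r. Qed.

Let bpos_lt m : (0 < m)%N -> forall i, (i < m)%N -> bpos m i < bpos m i.+1.
Proof.
by move=> m0 i _; rewrite bposS ltrDl divr_gt0// ?subr_gt0// ltr0n.
Qed.

Definition bS m (w : T) : nat -> R := walk (fun i => ginc B (bpos m) i w).

Let bSE m w l : bS m w l = f w (bpos m l) - f w a.
Proof.
rewrite /bS; elim: l => [|l IH]; first by rewrite walk0 bpos0 subrr.
by rewrite walkS IH /ginc addrC addrA subrK.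
Qed.

Definition bZ (w : T) : R := B b w - B a w.
Definition bM (w : T) : R := maxdrop (f w) a b.

Let bSm m w : (0 < m)%N -> bS m w m = bZ w.
Proof. by move=> m0; rewrite bSE bposm. Qed.

Let near_step (c : R) : 0 < c -> \forall m \near \oo, (0 < m)%N /\ (b - a) / m%:R <= c.
Proof.
move=> c0; have ba0 : 0 < b - a by rewrite subr_gt0.
near=> m.
have [m0 mc] : (0 < m)%N /\ m%:R^-1 <= c / (b - a).
  by near: m; apply: near_mesh; rewrite divr_gt0.
by split=> //; move: mc; rewrite ler_pdivlMr// mulrC.
Unshelve. all: by end_near. Qed.

Lemma bM_cvg w : rmax (bS m w) m @[m --> \oo] --> bM w.
Proof.
apply/cvgrPdist_le => c c0; have [c' c'0 hc] := grid_drop (uf w) (ltW ab) c0.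
near=> m; rewrite distrC.
have [m0 mc] : (0 < m)%N /\ (b - a) / m%:R <= c' by near: m; exact: near_step.
rewrite (@rmax_ext _ _ (fun l => f w (bpos m l) - f w (bpos m 0))); last first.
  by move=> l _; rewrite bSE bpos0.
apply: hc => [i _||].
- by rewrite bposS lerD2l mc andbT lerDl divr_ge0// subr_ge0 ltW.
- by rewrite bpos0 subrr normr0 ltW.
- by rewrite bposm// subrr normr0 ltW.
Unshelve. all: by end_near. Qed.

Let bpos_itv m l : (l <= m)%N -> a <= bpos m l <= b.
Proof.
move=> lm; have [->|m0] := posnP m.
  by rewrite /bpos invr0 !mulr0 addr0 lexx ltW.
have /andP[h1 h2] := @gpos_itv R m l lm.
have ba : 0 <= b - a by rewrite subr_ge0 ltW.
by rewrite /bpos lerDl mulr_ge0//= -lerBrDl ler_piMr.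
Qed.

Lemma rmax_bM m w : rmax (bS m w) m <= bM w.
Proof.
apply/rmax_leP => l lm; rewrite bSE opprB.
by apply: drop_ge => //; [exact: ltW | exact: bpos_itv].
Qed.

Lemma mbS m l : measurable_fun setT (fun w => bS m w l).
Proof. by apply: (@mfn_walk R l) => i; exact: (measurable_ginc hB). Qed.

Lemma measurable_bM : measurable_fun setT bM.
Proof.
apply: (@measurable_fun_cvg _ _ _ setT (fun m w => rmax (bS m w) m)).
- move=> m; have mR := @mfn_rmax R (@walk R) m (@mfn_walk R).
  by apply: (mR _ _ (fun i w => ginc B (bpos m) i w)) => i; exact: (measurable_ginc hB).
- by move=> w _; exact: bM_cvg.
Qed.

Lemma measurable_bZ : measurable_fun setT bZ.
Proof. by apply: measurable_funB; exact: mB. Qed.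

Lemma bZ_gaussian C : measurable C ->
  P [set w | C (bZ w)] = normal_prob 0 (Num.sqrt (b - a)) C.
Proof. by move=> mC; rewrite (@bm_gaussian _ _ _ _ _ (ubm_bm hB)). Qed.

Lemma bZ_neq x : {ae P, forall w, bZ w != x}.
Proof.
exists [set w | [set x] (bZ w)]; split.
- by rewrite -[X in measurable X]setTI; exact: measurable_bZ.
- rewrite bZ_gaussian//.
  have := @normal_prob_dominates R 0 (Num.sqrt (b - a)).
  move=> /null_content_dominatesP; apply => //.
  exact: lebesgue_measure_set1.
- by move=> w /= /negP; rewrite negbK => /eqP.
Qed.

Lemma bM_ge0 w : 0 <= bM w. Proof. by apply: drop_ge0 => //; exact: ltW. Qed.

Lemma bM_geN w : - bZ w <= bM w.
Proof.
have : f w a - f w b <= bM w by apply: (drop_ge (uf w) (ltW ab)); rewrite (ltW ab) lexx.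
by rewrite /bZ /bpath opprB.
Qed.

Section reflection.
Variables (g : R -> R) (C c : R).
Hypotheses (cg : continuous g) (gC : forall x, `|g x| <= C) (c0 : 0 < c).

(** The antisymmetric extension of [g] across [- c]: it equals [g] above [- c], is 0 at [- c], and
    changes sign under reflection about [- c]. *)
Definition refl (z : R) : R :=
  g z * (- c < z)%R%:R - g (- (2 * c) - z) * (z < - c)%R%:R.

Let mg : measurable_fun setT g. Proof. exact: continuous_measurable_fun. Qed.

Let refl_anti z : refl (- (2 * c) - z) = - refl z.
Proof.
have e : - (2 * c) - (- (2 * c) - z) = z by ring.
have e1 : (- c < - (2 * c) - z) = (z < - c) by apply/idP/idP; lra.
have e2 : (- (2 * c) - z < - c) = (- c < z) by apply/idP/idP; lra.
by rewrite /refl e e1 e2; ring.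
Qed.

Let refl_bound z : `|refl z| <= C.
Proof.
have C0 : 0 <= C by exact: le_trans (gC 0).
rewrite /refl; have [h|h] := ltP (- c) z.
  by rewrite (_ : (z < - c) = false) ?mulr1 ?mulr0 ?subr0//; lra.
rewrite mulr0 sub0r normrN; case: (z < - c); last by rewrite mulr0 normr0.
by rewrite mulr1.
Qed.

Let refl_pos x : - c < x -> refl x = g x.
Proof. by move=> xc; rewrite /refl xc (_ : (x < - c) = false) ?mulr1 ?mulr0 ?subr0//; lra. Qed.

Let refl_neg x : x < - c -> refl x = - g (- (2 * c) - x).
Proof. by move=> xc; rewrite /refl xc (_ : (- c < x) = false) ?mulr1 ?mulr0 ?sub0r//; lra. Qed.

Let refl_cont (z : R) : z != - c -> forall e : R, 0 < e -> exists2 r : R, 0 < r &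
  forall y : R, `|z - y| <= r -> `|refl z - refl y| <= e.
Proof.
move=> zc e e0; have [h|h] := ltP (- c) z.
  have [r r0 hr] := (continuousP_le _ _).1 (@cg z) e e0.
  exists (Num.min r ((z + c) / 2)).
    by rewrite lt_min r0 divr_gt0//; lra.
  move=> y; rewrite le_min => /andP[yr yc].
  have yc' : - c < y by move: yc; rewrite ler_norml => /andP[_]; lra.
  by rewrite !refl_pos//; exact: hr.
have {}h : z < - c by rewrite lt_neqAle zc.
have [r r0 hr] := (continuousP_le _ _).1 (@cg (- (2 * c) - z)) e e0.
exists (Num.min r ((- c - z) / 2)).
  by rewrite lt_min r0 divr_gt0//; lra.
move=> y; rewrite le_min => /andP[yr yc].
have yc' : y < - c by move: yc; rewrite ler_norml => /andP[]; lra.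
rewrite !refl_neg// -opprD normrN; apply: hr.
by rewrite opprD addrACA subrr add0r opprK addrC distrC.
Qed.

Let mrefl : measurable_fun setT refl.
Proof.
apply: measurable_funB; apply: measurable_funM => //.
- by apply: measurable_natr; apply: measurable_fun_ltr.
- by apply: (measurableT_comp mg); apply: measurable_funB.
- by apply: measurable_natr; apply: measurable_fun_ltr.
Qed.

(* [hit m X i] marks the step at which the walk first exceeds depth [c]. *)
Let hit (X : nat -> R) i : R := (rmax (walk X) i <= c)%R%:R * (c < rmax (walk X) i.+1)%R%:R.

Let hit_sum X m : \sum_(i < m) hit X i = 1 - (rmax (walk X) m <= c)%R%:R.
Proof.
elim: m => [|m IH].
  by rewrite big_ord0 /= walk0 oppr0 (ltW c0) subrr.
rewrite big_ord_recr/= IH /hit.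
have := rmax_nd (walk X) (leqnSn m).
have [h1|h1] := leP (rmax (walk X) m) c; have [h2|h2] := leP (rmax (walk X) m.+1) c => h3;
  rewrite /= ?(subrr, mulr0, mulr1, mul0r, subr0, addr0, add0r)//; lra.
Qed.

Let hit_ge0 X i : 0 <= hit X i. Proof. by rewrite mulr_ge0. Qed.

(** Cost of discreteness: the walk is reflected about its value just after crossing, which
    overshoots [- c] by [bS m w i.+1 + c]. *)
Let err m (w : T) : R := \sum_(i < m)
  (refl (bZ w) - refl (bZ w - 2 * (bS m w i.+1 + c))) * hit (fun i => ginc B (bpos m) i w) i.

Let mhit i : mfn (fun X => hit X i).
Proof.
have mR l := @mfn_rmax R (@walk R) l (@mfn_walk R).
by apply: mfnM; [apply: mfn_le|apply: mfn_lt] => //; exact: mfn_cst.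
Qed.

Let hit_01 X i : hit X i = 0 \/ hit X i = 1.
Proof.
by rewrite /hit; case: (_ <= c); case: (c < _); rewrite ?(mulr0, mulr1); [right|left|left|left].
Qed.

Let bdm_refl (Y : T -> R) : measurable_fun setT Y -> bdm (fun w => refl (Y w)).
Proof. by move=> mY; split; [exact: measurableT_comp | exists C => w; exact: refl_bound]. Qed.

Let mginc m i : measurable_fun setT (fun w => ginc B (bpos m) i w).
Proof. exact: (measurable_ginc hB). Qed.

Let bdm_hit m i : bdm (fun w => hit (fun i => ginc B (bpos m) i w) i).
Proof.
split; first by apply: (@mhit i _ _ (fun i w => ginc B (bpos m) i w)).
by exists 1 => w; have [->|->] := hit_01 (fun i => ginc B (bpos m) i w) i; rewrite ?normr0 ?normr1.
Qed.

Let measurable_over m i : measurable_fun setT (fun w => bZ w - 2 * (bS m w i.+1 + c)).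
Proof.
apply: measurable_funB; first exact: measurable_bZ.
by apply: measurable_funM => //; apply: measurable_funD => //; exact: mbS.
Qed.

Let err_bdm m i : bdm (fun w => (refl (bZ w) - refl (bZ w - 2 * (bS m w i.+1 + c))) *
  hit (fun i => ginc B (bpos m) i w) i).
Proof.
apply: bdmM; last exact: bdm_hit.
by apply: bdmB; apply: bdm_refl; [exact: measurable_bZ | exact: measurable_over].
Qed.

Let walk_flip (X : nat -> R) i q : walk (fun l => (-1) ^+ (i < l)%N * X l) (i.+1 + q)%N =
  2 * walk X i.+1 - walk X (i.+1 + q)%N.
Proof.
elim: q => [|q IH].
  rewrite addn0 (@walk_ext _ _ X); first by ring.
  by move=> l; rewrite ltnS => li; rewrite ltnNge li mul1r.
by rewrite addnS [LHS]walkS [walk X (i.+1 + q).+1]walkS IH leq_addr expr1; ring.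
Qed.

Let walk_flip_le (X : nat -> R) i l : (l <= i.+1)%N ->
  walk (fun l => (-1) ^+ (i < l)%N * X l) l = walk X l.
Proof.
by move=> li; apply: walk_ext => j jl; rewrite ltnNge -ltnS (leq_trans jl li) mul1r.
Qed.

(** Split by the crossing step [i]. Flipping the later increments preserves the law and the crossing
    event, and sends the end value [Z] to [2 * S - Z], with [S] the value after crossing. By
    antisymmetry [refl] there is minus [refl] at [Z - 2 * (S + c)]. Adding the two expressions for
    the same mean yields the factor 2. *)
Let flip_err m : (0 < m)%N ->
  2 * (\int[P]_w refl (bZ w) -
    \int[P]_w (refl (bZ w) * (rmax (bS m w) m <= c)%R%:R)) = \int[P]_w err m w.
Proof.
move=> m0; pose X w i := ginc B (bpos m) i w.
have br := bdm_refl measurable_bZ.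
have bl : bdm (fun w => (rmax (bS m w) m <= c)%R%:R : R).
  apply: bdm_bool; apply: measurable_fun_ler => //.
  have mR := @mfn_rmax R (@walk R) m (@mfn_walk R).
  by apply: (mR _ _ (fun i w => ginc B (bpos m) i w)) => i; exact: mginc.
rewrite -ExB//; last exact: bdmM.
have -> : \int[P]_w (refl (bZ w) - refl (bZ w) * (rmax (bS m w) m <= c)%R%:R) =
    \int[P]_w \sum_(i < m) refl (bZ w) * hit (X w) i.
  by apply: eq_Rintegral => w _; rewrite -mulr_sumr hit_sum mulrBr mulr1.
rewrite (@Ex_sum _ _ _ P m (fun i w => refl (bZ w) * hit (X w) i)); last first.
  by move=> i im; apply: bdmM => //; exact: bdm_hit.
rewrite [RHS](@Ex_sum _ _ _ P m (fun i w => (refl (bZ w) - refl (bZ w - 2 * (bS m w i.+1 + c))) *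
  hit (X w) i)); last by move=> i im; exact: err_bdm.
rewrite mulr_sumr; apply: eq_bigr => i _.
pose F (X : nat -> R) := refl (walk X m) * hit X i.
have mF : mfn F by apply: mfnM => //; apply: mfn_compm => //; exact: mfn_walk.
have im := ltn_ord i.
have lF : local m F.
  move=> x y xy; rewrite /F /hit (local_walk (leqnn m) xy).
  by rewrite (local_rmax_walk (ltnW im) xy) (local_rmax_walk im xy).
have FE w : F (X w) = refl (bZ w) * hit (X w) i by rewrite /F -[walk _ m]/(bS m w m) bSm.
have := @flip_law _ _ _ _ _ hB m (bpos m) _ (bpos_lt m0) _ (fun l => i < l)%N F mF lF.
rewrite bpos0 bposm// => /(_ a0 b1) fl.
transitivity (\int[P]_w (refl (bZ w) * hit (X w) i) +
    \int[P]_w F (fun l => (-1) ^+ (i < l)%N * X w l)).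
  by rewrite -fl mulr_natl mulr2n; congr (_ + _); apply: eq_Rintegral => w _; rewrite FE.
have F2 w : F (fun l => (-1) ^+ (i < l)%N * X w l) =
    - refl (bZ w - 2 * (bS m w i.+1 + c)) * hit (X w) i.
  rewrite /F; congr (_ * _).
    have := walk_flip (X w) i (m - i.+1); rewrite subnKC// => ->.
    rewrite -refl_anti; congr refl.
    by rewrite -[walk (X w) m]/(bS m w m) bSm// -[walk (X w) i.+1]/(bS m w i.+1); ring.
  rewrite /hit; congr ((_ <= c)%R%:R * (c < _)%R%:R); apply: rmax_ext => l li; apply: walk_flip_le => //.
  exact: leqW.
rewrite -ExD; last 2 first.
- by apply: bdmM => //; exact: bdm_hit.
- rewrite (_ : (fun w => _) = fun w => - refl (bZ w - 2 * (bS m w i.+1 + c)) * hit (X w) i).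
    by apply: bdmM; [apply: bdmN; apply: bdm_refl; exact: measurable_over | exact: bdm_hit].
  by apply/funext => w; exact: F2.
by apply: eq_Rintegral => w _; rewrite F2; ring.
Qed.

Let err_bound m w : `|err m w| <= 2 * C.
Proof.
have C0 : 0 <= C by exact: le_trans (refl_bound 0).
apply: le_trans (ler_norm_sum _ _ _) _.
apply: (@le_trans _ _ (\sum_(i < m) 2 * C * hit (fun i => ginc B (bpos m) i w) i)).
  apply: ler_sum => i _; rewrite normrM (ger0_norm (hit_ge0 _ _)) ler_wpM2r//.
  apply: le_trans (ler_normB _ _) _; rewrite (mulr_natl C) mulr2n.
  by apply: lerD; exact: refl_bound.
by rewrite -mulr_sumr hit_sum ler_piMr ?mulr_ge0// gerBl.
Qed.

(** At most one crossing term is nonzero, its overshoot is bounded by the oscillation of the path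
    over one step, and [refl] is continuous away from [- c]. *)
Let err_cvg w : bZ w != - c -> err m w @[m --> \oo] --> 0.
Proof.
move=> Zc; apply/cvgrPdist_le => e e0; rewrite /=.
have [r r0 hr] := refl_cont Zc e0.
have [d' d'0 hd] := uf w (divr_gt0 r0 (ltr0n _ 2)).
near=> m; rewrite sub0r normrN.
have [m0 md] : (0 < m)%N /\ (b - a) / m%:R <= d' by near: m; exact: near_step.
apply: le_trans (ler_norm_sum _ _ _) _.
apply: (@le_trans _ _ (\sum_(i < m) e * hit (fun i => ginc B (bpos m) i w) i)).
  apply: ler_sum => i _; rewrite normrM (ger0_norm (hit_ge0 _ _)).
  have [h1|h1] := leP (rmax (bS m w) i) c; last first.
    by rewrite /hit -/(bS m w) (leNgt (rmax _ i) c) h1 !mul0r !mulr0.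
  have [h2|h2] := leP (rmax (bS m w) i.+1) c.
    by rewrite /hit -/(bS m w) (ltNge c) h2 !mulr0.
  apply: ler_wpM2r => //; apply: hr.
  have : c < - bS m w i.+1.
    by move: h2 => /=; rewrite lt_max => /orP[|//]; rewrite ltNge h1.
  have := rmax_ge (bS m w) (leqnn i).
  have : `|f w (bpos m i.+1) - f w (bpos m i)| <= r / 2.
    apply: hd; rewrite bposS addrAC subrr add0r ger0_norm//.
    by rewrite divr_ge0// subr_ge0 ltW.
  rewrite !bSE subKr !ler_norml => /andP[h3 h4] h5 h6; lra.
by rewrite -mulr_sumr hit_sum ler_piMr ?(ltW e0)// gerBl.
Unshelve. all: by end_near. Qed.

Let measurable_err m : measurable_fun setT (err m).
Proof. by apply: measurable_sum => i; have [] := err_bdm m i. Qed.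

(** As the overshoot disappears, [refl] of the end value has mean 0 on the event that depth [c] is
    exceeded. On the complement the end value is above [- c] almost surely, where [refl] is [g]. *)
Lemma reflection :
  \int[P]_w (g (bZ w) * (bM w <= c)%R%:R) = \int[P]_w refl (bZ w).
Proof.
have bl m : bdm (fun w => (rmax (bS m w) m <= c)%R%:R : R).
  apply: bdm_bool; apply: measurable_fun_ler => //.
  have mR := @mfn_rmax R (@walk R) m (@mfn_walk R).
  by apply: (mR _ _ (fun i w => ginc B (bpos m) i w)) => i; exact: mginc.
have br := bdm_refl measurable_bZ.
have mM : measurable_fun setT (fun w => (bM w <= c)%R%:R : R).
  by apply: measurable_natr; apply: measurable_fun_ler => //; exact: measurable_bM.
have c1 : \int[P]_w err m w @[m --> \oo] --> \int[P]_w (0 : R).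
  apply: (@bounded_cvg _ _ _ P err (fun _ => 0) (2 * C)) => //.
  by apply: filterS (bZ_neq (- c)) => w; exact: err_cvg.
have c2 : \int[P]_w (refl (bZ w) * (rmax (bS m w) m <= c)%R%:R) @[m --> \oo] -->
    \int[P]_w (g (bZ w) * (bM w <= c)%R%:R).
  apply: (@bounded_cvg _ _ _ P (fun m w => refl (bZ w) * (rmax (bS m w) m <= c)%R%:R) _ C) => //.
  - by move=> m; apply: measurable_funM; [have [] := br|have [] := bl m].
  - by apply: measurable_funM => //; apply: (measurableT_comp mg); exact: measurable_bZ.
  - by move=> m w; case: (_ <= c); rewrite ?mulr1 ?mulr0 ?normr0// (le_trans _ (refl_bound 0)).
  - apply: filterS (bZ_neq (- c)) => w Zc.
    have [Mc|Mc] := leP (bM w) c.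
      rewrite -refl_pos; last first.
        by rewrite lt_neqAle eq_sym Zc/= lerNl (le_trans (bM_geN w)).
      apply: (@cvg_trans _ (cst (refl (bZ w) * 1) m @[m --> \oo])); last exact: cvg_cst.
      apply: near_eq_cvg; near=> m => /=.
      by rewrite (le_trans (rmax_bM m w) Mc).
    rewrite mulr0; apply: (@cvg_trans _ (cst 0 m @[m --> \oo])); last exact: cvg_cst.
    apply: near_eq_cvg; near=> m => /=.
    rewrite leNgt (_ : c < rmax (bS m w) m)%R ?mulr0//.
    by near: m; apply: (cvgr_gt (bM w)) => //; exact: bM_cvg.
have c3 : 2 * (\int[P]_w refl (bZ w) -
    \int[P]_w (refl (bZ w) * (rmax (bS m w) m <= c)%R%:R)) @[m --> \oo] -->
    2 * (\int[P]_w refl (bZ w) - \int[P]_w (g (bZ w) * (bM w <= c)%R%:R)).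
  by apply: cvgM; [exact: cvg_cst|apply: cvgB => //; exact: cvg_cst].
have c4 : \int[P]_w err m w @[m --> \oo] -->
    2 * (\int[P]_w refl (bZ w) - \int[P]_w (g (bZ w) * (bM w <= c)%R%:R)).
  apply: cvg_trans c3; apply: near_eq_cvg; near=> m.
  by rewrite flip_err//; near: m; exists 1%N.
have := cvg_lim (@Rhausdorff R) c4; rewrite (cvg_lim (@Rhausdorff R) c1) Ex_cst.
move=> hlim; have /eqP : 2 * (\int[P]_w refl (bZ w) - \int[P]_w (g (bZ w) * (bM w <= c)%R%:R)) = 0 by exact/esym/hlim.
by rewrite mulf_eq0 pnatr_eq0/= subr_eq0 => /eqP.
Unshelve. all: by end_near. Qed.

End reflection.
End block.

(** * The argmin of Brownian motion *)

Section indicator_expectation.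
Context {d : measure_display} {T : measurableType d} {R : realType}.
Variable P : probability T R.

Lemma Ex_bool (b : T -> bool) : measurable_fun setT b ->
  (P [set w | b w] = (\int[P]_w (b w)%:R)%:E)%E.
Proof.
move=> mb; rewrite -ExE; last exact: bdm_bool.
have mS : measurable [set w | b w].
  by have := mb measurableT [set true]; rewrite setTI; exact.
rewrite -(setIT [set w | b w]) -integral_indic//; apply: eq_integral => w _.
rewrite indicE; congr (nat_of_bool _)%:R%:E.
by apply/idP/idP; rewrite inE.
Qed.

Lemma Ex_bool0 (b : T -> bool) : measurable_fun setT b ->
  \int[P]_w (b w)%:R = 0 :> R -> {ae P, forall w, ~~ b w}.
Proof.
move=> mb e0; exists [set w | b w]; split.
- by have := mb measurableT [set true]; rewrite setTI; exact.
- by rewrite Ex_bool// e0.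
- by move=> w /= /negP; rewrite negbK.
Qed.

End indicator_expectation.

Section null_events.
Context {d : measure_display} {T : measurableType d} {R : realType}.
Variables (P : probability T R) (B : R -> T -> R).
Hypothesis hB : uniform_bm P B.
Local Notation f w := (bpath B w).

Let uf w : ucont (f w). Proof. exact: bpath_ucont hB w. Qed.
Let mB t : measurable_fun setT (B t). Proof. exact: ubm_measurable hB t. Qed.

Section block_max_law.
Variables a b : R.
Hypotheses (a0 : 0 <= a) (ab : a < b) (b1 : b <= 1).
Local Notation Z := (bZ B a b).
Local Notation M := (bM B a b).

Let mZ : measurable_fun setT Z. Proof. exact: measurable_bZ hB a b. Qed.
Let mM : measurable_fun setT M. Proof. exact: (measurable_bM hB ab). Qed.

Lemma bZ_sym (g : R -> R) : bdm g -> \int[P]_w g (- Z w) = \int[P]_w g (Z w).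
Proof.
move=> hg; have gZ := @bZ_gaussian _ _ _ P B hB a b a0 ab b1.
rewrite (Ex_gaussian mZ gZ hg).
have mN : measurable_fun setT (fun w => - Z w) by exact: measurableT_comp.
apply: (Ex_gaussian mN _ hg) => A mA.
rewrite -normal_probN ?subr_gt0// -gZ//.
by have := @oppr_measurable R setT measurableT _ mA; rewrite setTI.
Qed.

Let bdm_ltr (F G : T -> R) : measurable_fun setT F -> measurable_fun setT G ->
  bdm (fun w => (F w < G w)%R%:R : R).
Proof. by move=> mF mG; apply: bdm_bool; exact: measurable_fun_ltr. Qed.

Let bdm_ler (F G : T -> R) : measurable_fun setT F -> measurable_fun setT G ->
  bdm (fun w => (F w <= G w)%R%:R : R).
Proof. by move=> mF mG; apply: bdm_bool; exact: measurable_fun_ler. Qed.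

Lemma bM_cdf c : 0 < c -> \int[P]_w (M w <= c)%R%:R =
  \int[P]_w ((- c < Z w)%R%:R - (c < Z w)%R%:R) :> R.
Proof.
move=> c0.
have c1 : continuous (fun _ : R => 1 : R) by move=> x; exact: cvg_cst.
have n1 (x : R) : `|1 : R| <= 1 by rewrite normr1.
have := @reflection _ _ _ P B hB a b a0 ab b1 (fun _ => 1) 1 c c1 n1 c0.
under eq_Rintegral do rewrite mul1r.
move=> ->; rewrite /refl; under eq_Rintegral do rewrite !mul1r.
rewrite ExB; [|exact: bdm_ltr|exact: bdm_ltr].
rewrite ExB; [|exact: bdm_ltr|exact: bdm_ltr].
congr (_ - _).
have := @bZ_sym (fun x => (c < x)%R%:R) _ => <-.
  by apply: eq_Rintegral => w _; congr (nat_of_bool _)%:R; rewrite ltrNr.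
by apply: bdm_bool; exact: measurable_fun_ltr.
Qed.

Let J c (z : R) : R := (- c < z)%R%:R - (c < z)%R%:R.

Let J1 c z : `|z| < c -> J c z = 1.
Proof.
rewrite ltr_norml => /andP[h1 h2]; rewrite /J h1.
by rewrite (_ : (c < z) = false) ?subr0//; apply/negbTE; rewrite -leNgt ltW.
Qed.

Let J0 c z : 0 <= c -> c < `|z| -> J c z = 0.
Proof.
move=> c0; rewrite /J real_ltr_normr ?num_real// => /orP[h|h].
  by rewrite h (_ : - c < z) ?subrr//; lra.
rewrite (_ : (- c < z) = false); last by apply/negbTE; rewrite -leNgt; lra.
by rewrite (_ : (c < z) = false) ?subrr//; apply/negbTE; rewrite -leNgt; lra.
Qed.

Let bJ c : bdm (fun w => J c (Z w)).
Proof. by apply: bdmB; exact: bdm_ltr. Qed.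

(** An atom at [x] is bounded by the mass of shrinking intervals around [x]; [bM_cdf] turns these
    into intervals of the Gaussian end value around [x] and [- x], whose mass tends to 0. *)
Lemma bM_neq x : {ae P, forall w, M w != x}.
Proof.
have [x0|x0] := ltP x 0.
  by apply: nearW => w; rewrite gt_eqF// (lt_le_trans x0)//; exact: (bM_ge0 hB).
have mE : measurable_fun setT (fun w => M w == x) by exact: measurable_fun_eqr.
apply: (Ex_bool0 mE).
pose e n : R := n.+1%:R^-1.
have e0 n : 0 < e n by rewrite invr_gt0 ltr0n.
(* [bM_cdf] requires a positive level; at level 0 the function [J] is identically 0, so no mass is
   subtracted there. *)
pose lo n := Num.max 0 (x - e n).
pose D n w := J (x + e n) (Z w) - J (lo n) (Z w).
have bD n : bdm (D n) by apply: bdmB.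
have hE : bdm (fun w => (M w == x)%:R : R) by exact: bdm_bool.
have le_D n : \int[P]_w (M w == x)%:R <= \int[P]_w D n w.
  have xe : 0 < x + e n by rewrite ltr_wpDl.
  have lox : lo n < x + e n by rewrite gt_max xe/= ltrD2l gtrN.
  have Mx : x <= x + e n by rewrite lerDl ltW.
  rewrite ExB// -[X in _ <= X - _]bM_cdf//.
  have [l0|l0] := ltP 0 (lo n).
    rewrite -[X in _ <= _ - X]bM_cdf// -ExB; [|exact: bdm_ler|exact: bdm_ler].
    apply: le_Ex => //; first by apply: bdmB; exact: bdm_ler.
    move=> w; have [->|_] := eqVneq (M w) x; last first.
      rewrite subr_ge0 ler_nat; have [h|//] := leP (M w) (lo n).
      by rewrite (le_trans h (ltW lox)).
    rewrite Mx (_ : (x <= lo n) = false) ?subr0//.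
    apply/negbTE; rewrite -ltNge /lo gt_max gtrBl e0 andbT.
    by move: l0; rewrite lt_max ltxx/=; have := e0 n; lra.
  have -> : lo n = 0 by apply/eqP; rewrite eq_le l0 le_max lexx.
  rewrite /J; under [X in _ <= _ - X]eq_Rintegral do rewrite oppr0 subrr.
  rewrite Ex_cst subr0; apply: le_Ex => //; first exact: bdm_ler.
  by move=> w; have [->|_] := eqVneq (M w) x => //; rewrite Mx.
have cvD : \int[P]_w D n w @[n --> \oo] --> \int[P]_w (0 : R).
  apply: (@bounded_cvg _ _ _ P D (fun _ => 0) 2) => //.
  - by move=> n; have [] := bD n.
  - move=> n w; rewrite /D /J.
    by do 4 case: (_ < _)%R => /=; rewrite ler_norml; lra.
  - apply: filterS2 (bZ_neq hB a0 ab b1 x) (bZ_neq hB a0 ab b1 (- x)) => w Zx ZNx.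
    have Zx' : 0 < `| `|Z w| - x |.
      rewrite normr_gt0 subr_eq0; apply/eqP => h.
      move: h Zx ZNx; case: (ger0P (Z w)) => _ <-; rewrite ?opprK ?eqxx//.
    apply: (@cvg_trans _ (cst 0 n @[n --> \oo])); last exact: cvg_cst.
    apply: near_eq_cvg; near=> n; rewrite /= /D.
    have en : e n < `| `|Z w| - x |.
      by near: n; exact: (near_infty_natSinv_lt (PosNum Zx')).
    have xl : 0 <= lo n by rewrite le_max lexx.
    move: en; rewrite real_ltr_normr ?num_real// => /orP[en|en].
      have h : x + e n < `|Z w| by lra.
      have xe0 : 0 <= x + e n by rewrite addr_ge0// ltW.
      have h2 : lo n < `|Z w|.
        by apply: le_lt_trans h; rewrite ge_max xe0/= lerD2l; have := e0 n; lra.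
      by rewrite (J0 xe0 h) (J0 xl h2) subrr.
    have h : `|Z w| < x - e n by lra.
    have h1 : `|Z w| < x + e n by have := e0 n; lra.
    have h2 : `|Z w| < lo n by rewrite lt_max h orbT.
    by rewrite (J1 h1) (J1 h2) subrr.
have := limr_ge (cvgP _ cvD) (nearW _ le_D).
rewrite (cvg_lim (@Rhausdorff R) cvD) Ex_cst => h.
apply/eqP; rewrite eq_le h/=; apply: Rintegral_ge0 => w _; exact: ler0n.
Unshelve. all: by end_near. Qed.

End block_max_law.

Let minc n i : measurable_fun setT (fun w => incr (f w) n i).
Proof. by apply: measurable_funB; exact: mB. Qed.

Lemma measurable_mixed n k i :
  measurable_fun setT (fun w : T * T => mixed (f w.1) (f w.2) n k i).
Proof.
by rewrite /mixed; case: (i < k)%N; apply: (measurableT_comp (minc n i)).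
Qed.

Section two_blocks.
Variable t : R.
Hypothesis t01 : 0 < t < 1.

Let t0 : 0 < t. Proof. by case/andP: t01. Qed.
Let t1 : t < 1. Proof. by case/andP: t01. Qed.
Let t01' : 0 <= t <= 1. Proof. by rewrite !ltW. Qed.

Local Notation M1 := (bM B 0 t).
Local Notation M2 := (bM B t 1).

Let mM1 : measurable_fun setT M1. Proof. exact: (measurable_bM hB t0). Qed.
Let mM2 : measurable_fun setT M2. Proof. exact: (measurable_bM hB t1). Qed.

(** This is the value at [t] minus the minimum over [[0, t]], so [M2 w = U w] says that the two
    blocks have the same minimum. *)
Let U w := f w t - f w 0 + M1 w.

Let mU : measurable_fun setT U.
Proof. by apply: measurable_funD => //; apply: measurable_funB; exact: mB. Qed.

(** Independence is known on grids only; a continuous bounded test function carries it to the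
    limiting depths. *)
Lemma two_block_mixing (phi : R -> R) C : continuous phi -> (forall x, `|phi x| <= C) ->
  \int[P]_w phi (M2 w - U w) = \int[(P \x P)%E]_w phi (M2 w.2 - U w.1).
Proof.
move=> cphi phiC.
have mphi : measurable_fun setT phi by exact: continuous_measurable_fun.
pose k n := gidx n t.
pose F n (X : nat -> R) := phi (rmax (zwalk (k n) X) (n - k n) - (walk X (k n) + rmax (walk X) (k n))).
have mF n : mfn (F n).
  apply: mfn_compm => //; apply: mfnB.
    by apply: (@mfn_rmax R (@zwalk R (k n))) => l; exact: mfn_zwalk.
  by apply: mfnD; [exact: mfn_walk | apply: (@mfn_rmax R (@walk R)) => l; exact: mfn_walk].
have kn n : (k n <= n)%N by exact: gidx_le.
have lF n : local n (F n).
  move=> x y xy; rewrite /F (local_walk (kn n) xy) (local_rmax_walk (kn n) xy).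
  by rewrite (local_rmax_zwalk (kn n) (leqnn _) xy).
have cvF (f1 f2 : R -> R) : ucont f1 -> ucont f2 ->
    F n (mixed f1 f2 n (k n)) @[n --> \oo] -->
    phi (maxdrop f2 t 1 - (f1 t - f1 0 + maxdrop f1 0 t)).
  move=> u1 u2; apply: (cvg_comp _ phi); last exact: cphi.
  apply: cvgB; first exact: rmax_zwalk_mixed_cvg.
  by apply: cvgD; [exact: walk_mixed_cvg|exact: rmax_walk_mixed_cvg].
have c1 : \int[P]_w F n (incr (f w) n) @[n --> \oo] --> \int[P]_w phi (M2 w - U w).
  apply: (@bounded_cvg _ _ _ P (fun n w => F n (incr (f w) n)) _ C) => //.
  - by move=> n; apply: (mF n _ _ (fun i w => incr (f w) n i)).
  - by apply: (measurableT_comp mphi); apply: measurable_funB.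
  - by move=> n w; exact: phiC.
  - apply: nearW => w; have := cvF _ _ (uf w) (uf w).
    by apply: cvg_trans; apply: near_eq_cvg; apply: nearW => n; rewrite mixed_ff.
have c2 : \int[(P \x P)%E]_w F n (mixed (f w.1) (f w.2) n (k n)) @[n --> \oo] -->
    \int[(P \x P)%E]_w phi (M2 w.2 - U w.1).
  apply: (@bounded_cvg _ _ _ (P \x P)%E (fun n w => F n (mixed (f w.1) (f w.2) n (k n))) _ C) => //.
  - move=> n; apply: (mF n _ _ (fun i w => mixed (f w.1) (f w.2) n (k n) i)) => i.
    exact: measurable_mixed.
  - apply: (measurableT_comp mphi); apply: measurable_funB.
      exact: (measurableT_comp mM2).
    exact: (measurableT_comp mU).
  - by move=> n w; exact: phiC.
  - by apply: nearW => w; exact: cvF.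
have c3 : \int[(P \x P)%E]_w F n (mixed (f w.1) (f w.2) n (k n)) @[n --> \oo] -->
    \int[P]_w phi (M2 w - U w).
  apply: cvg_trans c1; apply: near_eq_cvg; near=> n.
  by apply: (mixed_law hB) => //; near: n; exists 1%N.
by rewrite -(cvg_lim (@Rhausdorff R) c2); apply/esym/(cvg_lim (@Rhausdorff R) c3).
Unshelve. all: by end_near. Qed.

(** Tent functions decrease to the indicator of 0, which moves the question to the product space;
    there, for a fixed first path, the depth of the second block has no atom. *)
Lemma two_block_neq : {ae P, forall w, M2 w != U w}.
Proof.
pose e n : R := n.+1%:R^-1.
have e0 n : 0 < e n by rewrite invr_gt0 ltr0n.
pose phi n (x : R) := Num.max 0 (1 - `|x| / e n).
have phi01 n x : 0 <= phi n x <= 1.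
  by rewrite /phi le_max lexx/= ge_max ler01 gerBl divr_ge0// ltW.
have cphi n : continuous (phi n).
  move=> x; apply/continuousP_le => c c0; exists (c * e n); first by rewrite mulr_gt0.
  move=> y xy; have : `| `|x| - `|y| | <= c * e n by exact: le_trans (ler_dist_dist _ _) xy.
  rewrite -ler_pdivrMr// => h.
  have {}h : `| `|x| / e n - `|y| / e n | <= c.
    by rewrite -mulrBl normrM (gtr0_norm (x := (e n)^-1)) ?invr_gt0.
  move: h; rewrite /phi !ler_norml => /andP[h1 h2].
  by case: (leP 0 (1 - `|x| / e n)) => h3; case: (leP 0 (1 - `|y| / e n)) => h4; lra.
have phi_cvg x : phi n x @[n --> \oo] --> ((x == 0)%:R : R).
  have [->|x0] := eqVneq x 0.
    rewrite (_ : (fun n => _) = cst 1); first exact: cvg_cst.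
    by apply/funext => n; rewrite /phi normr0 mul0r subr0 max_r.
  have nx : 0 < `|x| by rewrite normr_gt0.
  apply: (@cvg_trans _ (cst (0 : R) n @[n --> \oo])); last exact: cvg_cst.
  apply: near_eq_cvg; near=> n; rewrite /= /phi.
  have en : e n < `|x| by near: n; exact: (near_infty_natSinv_lt (PosNum nx)).
  by rewrite max_l// subr_le0 ler_pdivlMr// mul1r ltW.
have phi1 n x : `|phi n x| <= 1 by have /andP[h1 h2] := phi01 n x; rewrite ger0_norm.
have mphi n : measurable_fun setT (phi n) by exact: continuous_measurable_fun.
have mU1 : measurable_fun setT (fun w : T * T => U w.1) by exact: (measurableT_comp mU).
have mM22 : measurable_fun setT (fun w : T * T => M2 w.2) by exact: (measurableT_comp mM2).
have mE : measurable_fun setT (fun w => M2 w == U w) by exact: measurable_fun_eqr.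
have mEE : measurable_fun setT (fun w : T * T => M2 w.2 == U w.1) by exact: measurable_fun_eqr.
have c1 : \int[P]_w phi n (M2 w - U w) @[n --> \oo] --> \int[P]_w ((M2 w == U w)%:R : R).
  apply: (@bounded_cvg _ _ _ P (fun n w => phi n (M2 w - U w)) _ 1) => //.
  - by move=> n; apply: (measurableT_comp (mphi n)); exact: measurable_funB.
  - exact: measurable_natr.
  - by apply: nearW => w; rewrite -subr_eq0; exact: phi_cvg.
have c2 : \int[(P \x P)%E]_w phi n (M2 w.2 - U w.1) @[n --> \oo] -->
    \int[(P \x P)%E]_w ((M2 w.2 == U w.1)%:R : R).
  apply: (@bounded_cvg _ _ _ (P \x P)%E (fun n w => phi n (M2 w.2 - U w.1)) _ 1) => //.
  - by move=> n; apply: (measurableT_comp (mphi n)); exact: measurable_funB.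
  - exact: measurable_natr.
  - by apply: nearW => w; rewrite -subr_eq0; exact: phi_cvg.
apply: (Ex_bool0 mE).
rewrite -(cvg_lim (@Rhausdorff R) c1).
under eq_fun do rewrite (two_block_mixing (cphi _) (phi1 _)).
rewrite (cvg_lim (@Rhausdorff R) c2) /Rintegral.
pose G (w : T * T) := ((M2 w.2 == U w.1)%:R : R)%:E.
have mG : measurable_fun setT G by apply/measurable_EFinP; exact: measurable_natr.
have G0 w : (0 <= G w)%E by rewrite lee_fin.
rewrite -/G (fubini_tonelli1 G mG G0).
rewrite integral0_eq// => w _ /=.
have mx : measurable_fun setT (fun w' => M2 w' == U w) by exact: measurable_fun_eqr.
rewrite /fubini_F/= ExE; last exact: bdm_bool.
rewrite -Ex_bool//.
have mS : measurable [set w' | M2 w' == U w].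
  by have := mx measurableT [set true]; rewrite setTI; exact.
have := bM_neq (ltW t0) t1 (lexx 1) (U w) => hn.
apply/(negligibleP P mS).
by apply: negligibleS hn => w' /= h; apply/negP; rewrite negbK.
Unshelve. all: by end_near. Qed.

End two_blocks.


Lemma ae_grid_neq : {ae P, forall w, forall n i, (0 < i < n)%N ->
  bM B (gpos R n i) 1 w != f w (gpos R n i) - f w 0 + bM B 0 (gpos R n i) w}.
Proof.
apply: ae_foralln => n; apply: ae_foralln => i.
have [/andP[i0 ni]|h] := boolP (0 < i < n)%N; last by apply: nearW => w.
have ni0 : (0 < n)%N by exact: ltn_trans ni.
have t01 : 0 < gpos R n i < 1.
  by rewrite divr_gt0 ?ltr0n//= ltr_pdivrMr ?ltr0n// mul1r ltr_nat.
by apply: filterS (two_block_neq t01) => w h _.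
Qed.

End null_events.

Section first_argmin_path.
Variables (R : realType) (f : R -> R).
Hypothesis uf : ucont f.
Local Notation tau := (first_argmin f).

(** The infimum is approached by minimisers, and uniform continuity makes it a minimiser itself. *)
Lemma first_argminP : [/\ 0 <= tau <= 1, forall s, 0 <= s <= 1 -> f tau <= f s &
  forall s, argmin_set f s -> tau <= s].
Proof.
have cf : {within `[0, 1], continuous f}.
  by apply: continuous_subspaceT; exact: ucont_continuous.
have [m] := EVT_min ler01 cf; rewrite in_itv /= => m01 fm.
have fm' s : 0 <= s <= 1 -> f m <= f s by move=> s01; apply: fm; rewrite in_itv.
have Am : argmin_set f m by split.
have lb0 : lbound (argmin_set f) 0 by move=> s [/andP[]].
have hi : has_inf (argmin_set f) by split; [exists m|exists 0].
have tle s : argmin_set f s -> tau <= s by move=> As; apply: ge_inf => //; exists 0.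
have t0 : 0 <= tau by apply: lb_le_inf => //; exists m.
have t1 : tau <= 1 by apply: le_trans (tle _ Am) _; case/andP: m01.
split=> //; first by rewrite t0.
move=> s s01; apply: le_trans (fm' _ s01); apply/ler_addgt0Pr => e e0.
have [d d0 hd] := uf e0.
have [s' As' s'd] := inf_adherent d0 hi.
have : `|tau - s'| <= d.
  rewrite distrC ger0_norm; first by rewrite lerBlDr addrC ltW.
  by rewrite subr_ge0 tle.
move/hd; rewrite ler_norml => /andP[_].
by have := As'.2 m m01; lra.
Qed.

(** Two minimisers would have a grid point strictly after the first and before the second, and the
    blocks on its two sides would share their minimum. Countably many grid points suffice, so this
    is excluded almost surely. *)
Lemma argmin_uniq :
  (forall n i, (0 < i < n)%N -> maxdrop f (gpos R n i) 1 !=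
     f (gpos R n i) - f 0 + maxdrop f 0 (gpos R n i)) ->
  forall s, 0 <= s <= 1 -> s != tau -> f tau < f s.
Proof.
move=> hneq s s01 st; have [/andP[t0 t1] fmin tle] := first_argminP.
rewrite lt_neqAle fmin// andbT; apply/eqP => fts.
have {}st : tau < s.
  by rewrite lt_neqAle eq_sym st tle//; split=> // v v01; rewrite -fts fmin.
pose d := s - tau; have d0 : 0 < d by rewrite subr_gt0.
(* The grid point following [tau] is at most [tau + n^-1], hence before [s]. *)
have [n n2] : exists n, n%:R^-1 < d / 2 /\ (0 < n)%N.
  have d2 : 0 < d / 2 by rewrite divr_gt0.
  have [N _ hN] := near_mesh (divr_gt0 d2 (ltr0n R 2)).
  have [N0 NN] := hN N (leqnn N); exists N; split=> //.
  by apply: le_lt_trans NN _; rewrite ltr_pdivrMr// ltr_pMr// ltr1n.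
have {n2} [n2 n0] := n2.
pose i := (gidx n tau).+1.
have /andP[h1 h2] := gidx_itv n0 t0.
have iE : gpos R n i = gpos R n (gidx n tau) + n%:R^-1 by rewrite gposS.
have ti : tau <= gpos R n i by rewrite iE.
have is_ : gpos R n i < s by rewrite iE /d in n2 *; lra.
have s1 : s <= 1 by case/andP: s01.
have ni : (0 < i < n)%N.
  rewrite /= -(ltr_nat R); have := lt_le_trans is_ s1.
  by rewrite /gpos ltr_pdivrMr ?ltr0n// mul1r.
have i1 : 0 <= gpos R n i by rewrite (le_trans t0).
have i2 : gpos R n i <= 1 by rewrite ltW// (lt_le_trans is_).
move/eqP: (hneq n i ni); apply.
have -> : maxdrop f (gpos R n i) 1 = f (gpos R n i) - f s.
  apply/eqP; rewrite eq_le; apply/andP; split; last by apply: drop_ge => //; rewrite s1 ltW.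
  apply: drop_le => // v /andP[v1 v2]; rewrite lerB// -fts fmin// v2 andbT.
  by rewrite (le_trans i1).
have -> : maxdrop f 0 (gpos R n i) = f 0 - f tau.
  apply/eqP; rewrite eq_le; apply/andP; split; last by apply: drop_ge => //; rewrite t0.
  by apply: drop_le => // v /andP[v1 v2]; rewrite lerB// fmin// v1 (le_trans v2).
by rewrite -fts; ring.
Qed.

Lemma first_argmin_neq u : 0 <= u <= 1 -> maxdrop f u 1 != 0 -> tau != u.
Proof.
move=> /andP[u0 u1]; apply: contraNN => /eqP tu; have [_ fmin _] := first_argminP.
rewrite eq_le drop_ge0// andbT; apply: drop_le => // s /andP[s0 s1].
by rewrite subr_le0 -tu fmin// s1 (le_trans u0).
Qed.

(** The right-hand side compares the minima over [[0, u]] and [[u, 1]]; a tie favours the left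
    because [tau] is the first minimiser. Both minima are measurable in the path, whence the
    measurability of the argmin. *)
Lemma first_argmin_le u : 0 <= u <= 1 ->
  (tau <= u) = (f u - maxdrop f u 1 >= f 0 - maxdrop f 0 u).
Proof.
move=> /andP[u0 u1]; have [/andP[t0 t1] fmin tle] := first_argminP.
apply/idP/idP => [tu|h].
  have -> : maxdrop f 0 u = f 0 - f tau.
    apply/eqP; rewrite eq_le; apply/andP; split; last by apply: drop_ge => //; rewrite t0.
    by apply: drop_le => // v /andP[v1 v2]; rewrite lerB// fmin// v1 (le_trans v2).
  rewrite opprB addrC subrK lerBrDr addrC -lerBrDr.
  by apply: drop_le => // v /andP[v1 v2]; rewrite lerB// fmin// v2 (le_trans u0).
have [s /andP[s0 su] [hs _]] := drop_attained uf u0.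
apply: (le_trans _ su); apply: tle; split; first by rewrite s0 (le_trans su).
move=> v /andP[v0 v1]; have [vu|uv] := leP v u.
  by have := @drop_ge _ f 0 u uf u0 v; rewrite v0 vu hs => /(_ isT); lra.
have := @drop_ge _ f u 1 uf u1 v; rewrite v1 (ltW uv) => /(_ isT).
by move: h; rewrite hs; lra.
Qed.

End first_argmin_path.

Section argmin_measurable.
Context {d : measure_display} {T : measurableType d} {R : realType}.
Variables (P : probability T R) (B : R -> T -> R).
Hypothesis hB : uniform_bm P B.
Local Notation f w := (bpath B w).
Local Notation tau w := (first_argmin (f w)).

Let uf w : ucont (f w). Proof. exact: bpath_ucont hB w. Qed.
Let mB t : measurable_fun setT (B t). Proof. exact: ubm_measurable hB t. Qed.

Lemma measurable_maxdrop a b : a <= b -> measurable_fun setT (fun w => maxdrop (f w) a b).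
Proof.
rewrite le_eqVlt => /predU1P[<-|ab]; last exact: (measurable_bM hB ab).
rewrite (_ : (fun _ => _) = cst 0); first exact: measurable_cst.
apply/funext => w; apply/eqP; rewrite eq_le drop_ge0// andbT; apply: drop_le => // s.
by rewrite -eq_le => /eqP ->; rewrite subrr.
Qed.

Lemma measurable_argmin : measurable_fun setT (fun w => tau w).
Proof.
apply: (measurability _ (RGenOInfty.measurableE R)) => //.
move=> /= _ [_ [u ->] <-]; rewrite setTI.
have [u0|u0] := ltP u 0.
  rewrite (_ : _ @^-1` _ = setT); first exact: measurableT.
  apply/seteqP; split => // w _ /=; rewrite in_itv /= andbT.
  by have [/andP[t0 _] _ _] := first_argminP (uf w); rewrite (lt_le_trans u0).
have [u1|u1] := leP 1 u.
  rewrite (_ : _ @^-1` _ = set0); first exact: measurable0.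
  apply/seteqP; split => // w /=; rewrite in_itv /= andbT ltNge => /negP; apply.
  by have [/andP[_ t1] _ _] := first_argminP (uf w); rewrite (le_trans t1).
have u01 : 0 <= u <= 1 by rewrite u0 ltW.
rewrite (_ : _ @^-1` _ = [set w | f w u - maxdrop (f w) u 1 < f w 0 - maxdrop (f w) 0 u]); last first.
  by apply/seteqP; split => w /=; rewrite in_itv/= andbT (ltNge u) first_argmin_le// -ltNge.
have mb : measurable_fun setT (fun w => f w u - maxdrop (f w) u 1 < f w 0 - maxdrop (f w) 0 u).
  apply: measurable_fun_ltr; apply: measurable_funB; try exact: mB.
    by apply: measurable_maxdrop; exact: ltW.
  exact: measurable_maxdrop.
by have := mb measurableT [set true]; rewrite setTI; exact.
Qed.

(** Continuity makes [B] at a random time the limit of its values at the grid time just below. The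
    range goes up to 2 because the time [tau + t] may exceed 1. *)
Lemma measurable_at_time (s : T -> R) : measurable_fun setT s ->
  (forall w, 0 <= s w <= 2) -> measurable_fun setT (fun w => B (s w) w).
Proof.
move=> ms s02.
pose S n w := \sum_(j < (2 * n).+1) B (gpos R n j) w *
  ((j%:R <= n%:R * s w)%R%:R * (n%:R * s w < j.+1%:R)%R%:R).
apply: (@measurable_fun_cvg _ _ _ setT S).
  move=> n; apply: measurable_sum => j; apply: measurable_funM => //.
  by apply: measurable_funM; apply: measurable_natr;
    [apply: measurable_fun_ler|apply: measurable_fun_ltr] => //; exact: measurable_funM.
move=> w _; have /andP[s0 s2] := s02 w.
have SE n : S n w = f w (gpos R n (gidx n (s w))).
  have ns0 : 0 <= n%:R * s w by rewrite mulr_ge0.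
  have /andP[h1 h2] := truncn_itv ns0.
  have gn : (gidx n (s w) < (2 * n).+1)%N.
    rewrite ltnS -(ler_nat R) natrM (le_trans h1)// mulrC ler_wpM2r//.
  rewrite /S (bigD1 (Ordinal gn))//= h1 h2 !mulr1 big1 ?addr0// => j jn.
  suff -> : (j%:R <= n%:R * s w)%R%:R * (n%:R * s w < j.+1%:R)%R%:R = 0 :> R by rewrite mulr0.
  have [h3|_] := leP j%:R (n%:R * s w); last by rewrite mul0r.
  have [h4|_] := ltP (n%:R * s w) j.+1%:R; last by rewrite mulr0.
  have a1 : (j < (gidx n (s w)).+1)%N by rewrite -(ltr_nat R) (le_lt_trans h3 h2).
  have a2 : (gidx n (s w) < j.+1)%N by rewrite -(ltr_nat R) (le_lt_trans h1 h4).
  have je : j = Ordinal gn by apply/val_inj/eqP; rewrite /= eqn_leq -ltnS a1 -ltnS a2.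
  by rewrite je eqxx in jn.
under eq_fun do rewrite SE.
apply/cvgrPdist_le => c c0; have [c' c'0 hc] := uf w c0.
near=> n; rewrite distrC; apply: hc.
have [n0 nc] : (0 < n)%N /\ n%:R^-1 <= c' by near: n; exact: near_mesh.
exact: gidx_near.
Unshelve. all: by end_near. Qed.

Lemma measurable_vtarget (u v : R -> R) t : continuous u -> continuous v -> 0 <= t <= 1 ->
  measurable_fun setT (fun w => vtarget u v (f w) t (tau w)).
Proof.
move=> cu cv /andP[t0 t1].
have mt := measurable_argmin.
have mY : measurable_fun setT (fun w => f w (tau w + t) - f w (tau w)).
  apply: measurable_funB; apply: measurable_at_time => //.
  - exact: measurable_funD.
  - by move=> w; have [/andP[h1 h2] _ _] := first_argminP (uf w); lra.
  - by move=> w; have [/andP[h1 h2] _ _] := first_argminP (uf w); lra.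
apply: measurable_fun_ifT => //.
- exact: measurable_fun_ler.
- apply: measurable_funM.
    by apply: (measurableT_comp (f := u)) => //; exact: continuous_measurable_fun.
  apply: (measurableT_comp (f := v)); first exact: continuous_measurable_fun.
  by apply: measurable_funB => //; apply: measurable_funB; exact: mB.
Qed.

End argmin_measurable.

Lemma block_frontK k j i : block_front k j (block_front j k i) = i.
Proof.
rewrite /block_front; have [ik|ki] := ltnP i k.
  rewrite (ltnNge (j + i)%N j) leq_addr/= addKn ltn_add2l ik//.
have [ij|ji] := ltnP i (k + j).
  by rewrite ltn_subLR// ij subnKC.
by rewrite (ltnNge i j) (leq_trans (leq_addl k j) ji)/= (ltnNge i (j + k)%N) (addnC j) ji.
Qed.

Lemma block_front_lt n k j i : (j + k <= n)%N -> (i < n)%N -> (block_front k j i < n)%N.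
Proof.
move=> jkn ni; rewrite /block_front; case: ifP => ij.
  by apply: leq_trans jkn; rewrite addnC ltn_add2r.
by case: ifP => // _; apply: leq_ltn_trans ni; exact: leq_subr.
Qed.

Lemma small_block_front (R : realType) (X : nat -> R) n d k j : (j + k <= n)%N ->
  small (X \o block_front k j) n d = small X n d.
Proof.
move=> jkn; apply/smallP/smallP => h i ni; last exact/h/block_front_lt.
rewrite -(block_frontK k j i); apply: (h (block_front j k i)).
by apply: block_front_lt => //; rewrite addnC.
Qed.

(** * The exchange identity and its limits *)

Section core_identity.
Context {d : measure_display} {T : measurableType d} {R : realType}.
Variables (P : probability T R) (B : R -> T -> R).
Hypothesis hB : uniform_bm P B.
Local Notation f w := (bpath B w).
Local Notation tau w := (first_argmin (f w)).

Let uf w : ucont (f w). Proof. exact: bpath_ucont hB w. Qed.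
Let mB t : measurable_fun setT (B t). Proof. exact: ubm_measurable hB t. Qed.
Let minc n i : measurable_fun setT (fun w => incr (f w) n i).
Proof. by apply: measurable_funB; exact: mB. Qed.

Variables (u v : R -> R) (C K : R).
Hypotheses (cu : continuous u) (cv : continuous v).
Hypotheses (u0 : forall x, 0 <= u x <= C) (v0 : forall x, 0 <= v x <= C).
Hypotheses (K0 : 0 <= K) (uK : forall x, K <= x -> u x = 0).

Let uv0 x y : 0 <= u x * v y.
Proof. by have /andP[a _] := u0 x; have /andP[b _] := v0 y; rewrite mulr_ge0. Qed.

Let lterm_ge0 n k e X j : 0 <= lterm n k u v e X j.+1.
Proof. by rewrite /lterm mulr_ge0//; exact: weight_ge0. Qed.

Let rterm_ge0 n k e X j : 0 <= rterm n k u v e X j.+1.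
Proof. by rewrite /rterm mulr_ge0//; [rewrite mulr_ge0|exact: weight_ge0]. Qed.

Let term_bound (c y S a : R) : 0 <= c -> 0 <= a -> a <= S -> c * S <= y -> `|c * a| <= y.
Proof. by move=> c0 a0 aS cS; rewrite ger0_norm ?mulr_ge0// (le_trans _ cS)// ler_wpM2l. Qed.

(** Each index [j] uses its own permutation, so the sum is exchanged term by term; the cut-off
    [small] survives because it is symmetric in the increments. Each term is bounded since all are
    nonnegative and their sum is bounded. *)
Lemma lsum_rsum e c n k : (0 < n)%N -> (k <= n)%N -> 0 <= e -> 0 <= c ->
  \int[P]_w lsum u v e c n k (incr (f w) n) =
  \int[(P \x P)%E]_w rsum u v e c n k (mixed (f w.1) (f w.2) n k).
Proof.
move=> n0 kn e0 c0.
pose F j X := (small X n c)%:R * lterm n k u v e X j.+1.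
pose G j X := (small X n c)%:R * rterm n k u v e X j.+1.
have jk j : (j < n - k)%N -> (j.+1 + k <= n)%N by move=> h; rewrite addnC -leq_subRL.
have mF j : mfn (F j) by apply: mfnM; [exact: mfn_small|exact: mfn_lterm].
have mG j : mfn (G j) by apply: mfnM; [exact: mfn_small|exact: mfn_rterm].
have lF j : (j < n - k)%N -> local n (F j).
  by move=> h x y xy; rewrite /F (local_small _ xy) (local_lterm u v e kn h xy).
have lG j : (j < n - k)%N -> local n (G j).
  by move=> h x y xy; rewrite /G (local_small _ xy) (local_rterm u v e kn h xy).
have bF j : (j < n - k)%N -> bdm (fun w => F j (incr (f w) n)).
  move=> jn; split; first by apply: (mF j _ _ (fun i w => incr (f w) n i)).
  exists (C * C * (e + c)) => w; have /andP[_ h] := lsum_bound u0 v0 (incr (f w) n) e0 c0 kn.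
  apply: term_bound h => //; rewrite (bigD1 (Ordinal jn))//= lerDl.
  by apply: sumr_ge0.
have bG j : (j < n - k)%N -> bdm (fun w : T * T => G j (mixed (f w.1) (f w.2) n k)).
  move=> jn; split.
    apply: (mG j _ _ (fun i w => mixed (f w.1) (f w.2) n k i)) => i.
    exact: (measurable_mixed hB).
  exists (C * C * (K + e + c)) => w.
  have /andP[_ h] := rsum_bound u0 v0 K0 uK (mixed (f w.1) (f w.2) n k) e0 c0 kn.
  apply: term_bound h => //; rewrite (bigD1 (Ordinal jn))//= lerDl.
  by apply: sumr_ge0.
under eq_Rintegral do rewrite /lsum mulr_sumr.
under [RHS]eq_Rintegral do rewrite /rsum mulr_sumr.
rewrite (@Ex_sum _ _ _ P (n - k) (fun j w => F j (incr (f w) n)) bF).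
rewrite (@Ex_sum _ _ _ (P \x P)%E (n - k) (fun j (w : T * T) => G j (mixed (f w.1) (f w.2) n k)) bG).
apply: eq_bigr => -[j jn] _ /=.
rewrite (block_front_law hB n0 (jk _ jn) (mF j) (lF _ jn)).
rewrite -(mixed_law hB n0 kn (mG j) (lG _ jn)).
apply: eq_Rintegral => w _; rewrite /F /G small_block_front ?jk//.
by rewrite lterm_front.
Qed.

Variable t : R.
Hypothesis t01 : 0 < t < 1.
Let t0 : 0 < t. Proof. by case/andP: t01. Qed.
Let t1 : t < 1. Proof. by case/andP: t01. Qed.
Let t01' : 0 <= t <= 1. Proof. by rewrite !ltW. Qed.

Let mu : measurable_fun setT u. Proof. exact: continuous_measurable_fun. Qed.
Let mv : measurable_fun setT v. Proof. exact: continuous_measurable_fun. Qed.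

Definition last_exit_mean e := \int[(P \x P)%E]_w rlim u v (f w.1) (f w.2) t e.

Let m1 (g : T -> R) : measurable_fun setT g -> measurable_fun setT (fun w : T * T => g w.1).
Proof. by move=> mg; exact: (measurableT_comp mg). Qed.
Let m2 (g : T -> R) : measurable_fun setT g -> measurable_fun setT (fun w : T * T => g w.2).
Proof. by move=> mg; exact: (measurableT_comp mg). Qed.

Lemma measurable_rlim e : measurable_fun setT (fun w : T * T => rlim u v (f w.1) (f w.2) t e).
Proof.
have mX : measurable_fun setT (fun w => f w t - f w 0) by apply: measurable_funB; exact: mB.
have mX1 := m1 mX.
have mM : measurable_fun setT (fun w : T * T => maxdrop (f w.1) 0 t).
  by apply: (m1 (g := fun w => maxdrop (f w) 0 t)); apply: (measurable_maxdrop hB); exact: ltW.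
have mM2 : measurable_fun setT (fun w : T * T => maxdrop (f w.2) t 1).
  by apply: (m2 (g := fun w => maxdrop (f w) t 1)); apply: (measurable_maxdrop hB); exact: ltW.
rewrite /rlim; apply: measurable_funM; first apply: measurable_funM; first apply: measurable_funM.
- exact: (measurableT_comp mu).
- apply: (measurableT_comp mv); apply: (m2 (g := fun w => f w 1 - f w t)); apply: measurable_funB; exact: mB.
- by apply: measurable_natr; exact: measurable_fun_ler.
- by apply: measurable_minr => //; exact: measurable_funD.
Qed.

(** For a fixed window the limit in the mesh does not depend on the cut-off [c], which may therefore
    be tied to [e] afterwards. *)
Lemma last_exit_mean_cvg e c : 0 <= e -> 0 < c ->
  \int[P]_w lsum u v e c n (gidx n t) (incr (f w) n) @[n --> \oo] --> last_exit_mean e.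
Proof.
move=> e0 c0.
suff : \int[(P \x P)%E]_w rsum u v e c n (gidx n t) (mixed (f w.1) (f w.2) n (gidx n t)) @[n --> \oo]
    --> last_exit_mean e.
  apply: cvg_trans; apply: near_eq_cvg; near=> n.
  apply/esym/lsum_rsum => //; last exact: ltW.
    by near: n; exists 1%N.
  exact: gidx_le.
apply: (@bounded_cvg _ _ _ (P \x P)%E (fun n w => rsum u v e c n (gidx n t) (mixed (f w.1) (f w.2) n (gidx n t)))
  _ (C * C * (K + e + c))).
- move=> n; have mr : mfn (rsum u v e c n (gidx n t)).
    apply: mfnM; first exact: mfn_small.
    by apply: (@mfn_sum R (n - gidx n t) (fun j X => rterm n (gidx n t) u v e X j.+1)) => j; exact: mfn_rterm.
  apply: (mr _ _ (fun i w => mixed (f w.1) (f w.2) n (gidx n t) i)) => i.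
  exact: (measurable_mixed hB).
- exact: measurable_rlim.
- move=> n w; have /andP[h1 h2] := rsum_bound u0 v0 K0 uK (mixed (f w.1) (f w.2) n (gidx n t)) e0 (ltW c0) (gidx_le n t01').
  by rewrite ger0_norm.
- by apply: nearW => w; exact: rsum_cvg.
Unshelve. all: by end_near. Qed.

Lemma ae_unique_argmin : {ae P, forall w, [/\ 0 < tau w <= 1,
  forall s, 0 <= s <= 1 -> s != tau w -> f w (tau w) < f w s & tau w != 1 - t]}.
Proof.
have [a0 a1] : 0 <= 1 - t /\ 1 - t < 1 by have := t0; have := t1; lra.
have t1' : 0 <= 1 - t <= 1 by rewrite a0 ltW.
apply: filterS3 (ae_grid_neq hB) (@bM_neq _ _ _ P B hB 0 1 (lexx 0) ltr01 (lexx 1) 0)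
  (@bM_neq _ _ _ P B hB (1 - t) 1 a0 a1 (lexx 1) 0).
move=> w h1 h2 h3; split.
- have [/andP[h -> _ _]] := first_argminP (uf w); rewrite andbT lt_neqAle h andbT eq_sym.
  by apply: first_argmin_neq => //; rewrite lexx ler01.
- exact: argmin_uniq.
- exact: first_argmin_neq.
Qed.

Let e (q : nat) : R := q.+1%:R^-1.
Let e0 q : 0 < e q. Proof. by rewrite invr_gt0 ltr0n. Qed.

Lemma small_mean_cvg c : 0 < c ->
  \int[P]_w (small (incr (f w) n) n c)%:R @[n --> \oo] --> (1 : R).
Proof.
move=> c0; rewrite -[X in _ --> X](Ex_cst P).
apply: (@bounded_cvg _ _ _ P (fun n w => (small (incr (f w) n) n c)%:R) _ 1) => //.
- by move=> n; apply: (@mfn_small R n c _ _ (fun i w => incr (f w) n i)).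
- by move=> n w; case: small; rewrite ?normr1 ?normr0.
apply: nearW => w; apply: (@cvg_trans _ (cst (1 : R) n @[n --> \oo])); last exact: cvg_cst.
apply: near_eq_cvg; near=> n.
suff -> : small (incr (f w) n) n c by [].
by apply/smallP => i _; move: i; near: n; exact: near_incr.
Unshelve. all: by end_near. Qed.

(** Diagonal argument: with the mesh chosen from [q], the discrete mean is close to
    [last_exit_mean (e q)] and, after division by [e q], to the mean of the argmin target. *)
Lemma last_exit_cvg : last_exit_mean (e q) / e q @[q --> \oo] -->
  \int[P]_w vtarget u v (f w) t (tau w).
Proof.
pose L q n := \int[P]_w lsum u v (e q) (e q ^+ 2) n (gidx n t) (incr (f w) n).
pose S q n := \int[P]_w (small (incr (f w) n) n (e q ^+ 2))%:R : R.
have e20 q : 0 < e q ^+ 2 by rewrite exprn_gt0.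
(* An error of [e q ^+ 2] is still at most [e q] after the division, and the cut-off fails with
   probability at most [e q]. *)
have /choice[n_ hn] : forall q, exists n, [/\ (q <= n)%N,
    `|last_exit_mean (e q) - L q n| <= e q ^+ 2 & `|1 - S q n| <= e q].
  move=> q; have c1 := last_exit_mean_cvg (ltW (e0 q)) (e20 q).
  have c2 := small_mean_cvg (e20 q).
  near \oo => n; exists n; split.
  - by near: n; exists q.
  - by near: n; move/cvgrPdist_le : c1; apply.
  - by near: n; move/cvgrPdist_le : c2; apply.
have C0 : 0 <= C by have /andP[a b] := u0 0; exact: le_trans b.
have CC0 : 0 <= C * C by exact: mulr_ge0.
have vb w : 0 <= vtarget u v (f w) t (tau w) <= C * C.
  rewrite /vtarget; case: ifP => _; last by rewrite lexx.
  rewrite uv0/=; have /andP[a b] := u0 (f w (tau w + t) - f w (tau w)).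
  have /andP[a' b'] := v0 (f w 1 - f w 0 - (f w (tau w + t) - f w (tau w))).
  exact: ler_pM.
pose V w := vtarget u v (f w) t (tau w).
pose s q w : R := (small (incr (f w) (n_ q)) (n_ q) (e q ^+ 2))%:R.
pose l q w := lsum u v (e q) (e q ^+ 2) (n_ q) (gidx (n_ q) t) (incr (f w) (n_ q)).
have e1 q : e q <= 1 by rewrite invf_le1 ?ltr0n// ler1n.
have e21 q : e q ^+ 2 <= e q by rewrite expr2 ler_piMl// ltW.
have lb q w : 0 <= l q w <= C * C * (2 * e q).
  have /andP[h1 h2] := lsum_bound u0 v0 (incr (f w) (n_ q)) (ltW (e0 q)) (ltW (e20 q)) (gidx_le (n_ q) t01').
  rewrite /l h1/= (le_trans h2)// ler_wpM2l//; have := e21 q; lra.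
have ml q : measurable_fun setT (l q).
  have mr : mfn (lsum u v (e q) (e q ^+ 2) (n_ q) (gidx (n_ q) t)).
    apply: mfnM; first exact: mfn_small.
    by apply: (@mfn_sum R (n_ q - gidx (n_ q) t) (fun j X => lterm (n_ q) (gidx (n_ q) t) u v (e q) X j.+1)) => j; exact: mfn_lterm.
  by apply: (mr _ _ (fun i w => incr (f w) (n_ q) i)).
have ms q : measurable_fun setT (s q).
  by apply: (@mfn_small R (n_ q) (e q ^+ 2) _ _ (fun i w => incr (f w) (n_ q) i)).
have s01 q w : 0 <= s q w <= 1 by rewrite /s; case: small; rewrite ?lexx ler01.
have mV : measurable_fun setT V by exact: (measurable_vtarget hB).
have bV : bdm V by split=> //; exists (C * C) => w; have /andP[a b] := vb w; rewrite ger0_norm.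
have bs q : bdm (s q) by split=> //; exists 1 => w; have /andP[a b] := s01 q w; rewrite ger0_norm.
have bl q : bdm (l q) by split=> //; exists (C * C * (2 * e q)) => w; have /andP[a b] := lb q w; rewrite ger0_norm.
have cv0 : \int[P]_w (l q w / e q - s q w * V w) @[q --> \oo] --> \int[P]_w (0 : R).
  apply: (@bounded_cvg _ _ _ P (fun q w => l q w / e q - s q w * V w) (fun _ => 0) (C * C * 2 + C * C)) => //.
  - by move=> q; apply: measurable_funB; apply: measurable_funM.
  - move=> q w; apply: le_trans (ler_normB _ _) _; apply: lerD.
      have /andP[a b] := lb q w; rewrite ger0_norm ?divr_ge0 ?(ltW (e0 q))//.
      by rewrite ler_pdivrMr ?e0// -[leRHS]mulrA.
    have /andP[a b] := vb w; have /andP[a' b'] := s01 q w.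
    by rewrite ger0_norm ?mulr_ge0// (le_trans (ler_wpM2r a b'))// mul1r.
  - apply: filterS ae_unique_argmin => w [h1 h2 h3].
    apply: (lsum_cvg cu cv (uf w) u0 v0 t01 h1 h2 h3) => N.
    by exists N => // q /= Nq; have [qn _ _] := hn q; exact: leq_trans qn.
rewrite Ex_cst in cv0.
apply/cvgrPdist_le => c c0.
have c3 : 0 < c / 3 by rewrite divr_gt0.
have ce : 0 < Num.min (c / 3) (c / 3 / (C * C + 1)).
  by rewrite lt_min c3/= divr_gt0// ltr_wpDl.
near=> q; have [qn h1 h2] := hn q.
have h3 : `|\int[P]_w (l q w / e q - s q w * V w)| <= c / 3.
  by rewrite -normrN -sub0r; near: q; move/cvgrPdist_le : cv0; apply.
have h4 : e q < Num.min (c / 3) (c / 3 / (C * C + 1)).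
  by near: q; exact: (near_infty_natSinv_lt (PosNum ce)).
move: h4; rewrite lt_min => /andP[h4 h5].
have {}h5 : C * C * e q <= c / 3.
  move: h5; rewrite ltr_pdivlMr ?ltr_wpDl// => h5; apply: le_trans (ltW h5).
  by rewrite mulrC ler_wpM2l ?(ltW (e0 q))// lerDl.
have {}h1 : `|last_exit_mean (e q) / e q - L q (n_ q) / e q| <= c / 3.
  rewrite -mulrBl normrM (gtr0_norm (x := (e q)^-1)) ?invr_gt0// ler_pdivrMr//.
  apply: le_trans h1 _; rewrite expr2 ler_wpM2r ?(ltW (e0 q))//; exact: ltW.
have h6 : \int[P]_w (l q w / e q - s q w * V w) = L q (n_ q) / e q - \int[P]_w (s q w * V w).
  rewrite ExB; last exact: bdmM.
    by under eq_Rintegral do rewrite mulrC; rewrite ExZ// mulrC.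
  by under eq_fun do rewrite mulrC; apply: bdmM => //; exact: bdm_cst.
have h7 : `|\int[P]_w V w - \int[P]_w (s q w * V w)| <= c / 3.
  apply: le_trans _ h5; rewrite -ExB//; last exact: bdmM.
  apply: (@le_trans _ _ (\int[P]_w (C * C * (1 - s q w)))); last first.
    rewrite ExZ; last by apply: bdmB => //; exact: bdm_cst.
    rewrite ExB//; last exact: bdm_cst.
    by rewrite Ex_cst ler_wpM2l// (le_trans (ler_norm _) h2).
  have bD : bdm (fun w => V w - s q w * V w) by apply: bdmB => //; exact: bdmM.
  have D0 w : 0 <= V w - s q w * V w <= C * C * (1 - s q w).
    have /andP[a b] := vb w; have /andP[a' b'] := s01 q w; rewrite /V; nra.
  rewrite ger0_norm; last by apply: Rintegral_ge0 => w _; case/andP: (D0 w).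
  apply: le_Ex => //; last by move=> w; case/andP: (D0 w).
  by apply: bdmM; [exact: bdm_cst|apply: bdmB => //; exact: bdm_cst].
rewrite h6 in h3; move: h1 h3 h7; rewrite -/V.
move: (last_exit_mean (e q) / e q) (L q (n_ q) / e q) (\int[P]_w (s q w * V w)) (\int[P]_w V w) => x1 x2 x3 x4.
by rewrite !ler_norml; lra.
Unshelve. all: by end_near. Qed.

End core_identity.

(** * Passage to two independent blocks *)

Lemma Ex_fubini {d : measure_display} {T : measurableType d} {R : realType}
    (P : probability T R) (F : T * T -> R) : bdm F -> (forall w, 0 <= F w) ->
  \int[(P \x P)%E]_w F w = \int[P]_x \int[P]_y F (x, y).
Proof.
move=> [mF [C hC]] F0; rewrite /Rintegral; congr fine.
rewrite (fubini_tonelli1 (fun w => (F w)%:E)); last 2 first.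
- exact/measurable_EFinP.
- by move=> w; rewrite lee_fin.
apply: eq_integral => x _; rewrite /fubini_F/= ExE//.
split; last by exists C => y; exact: hC.
exact: (measurableT_comp mF (pair1_measurable x)).
Qed.

Lemma gpdf_shift (R : realType) (l x c : R) : 0 < l ->
  gpdf l (x + c) = expR (- (c * x / l + c ^+ 2 / (l *+ 2))) * gpdf l x.
Proof.
move=> l0; rewrite !gpdfE// mulrCA -expRD; congr (_ * expR _).
by field; rewrite gt_eqF.
Qed.

(** Translating a Gaussian variable is paid for by an exponential weight, the ratio of the shifted
    density to the original one. *)
Lemma Ex_gaussian_shift {d : measure_display} {T : measurableType d} {R : realType}
    (P : probability T R) (Y : T -> R) (l c : R) (f : R -> R) : 0 < l ->
  measurable_fun setT Y ->
  (forall A, measurable A -> P [set w | A (Y w)] = normal_prob 0 (Num.sqrt l) A) ->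
  measurable_fun setT f -> (forall x, 0 <= f x) ->
  \int[P]_w f (Y w) = \int[P]_w (f (Y w + c) * expR (- (c * Y w / l + c ^+ 2 / (l *+ 2)))).
Proof.
move=> l0 mY YE mf f0; rewrite /Rintegral; congr fine.
rewrite (ge0_integral_gaussian mY YE (f := fun x => (f x)%:E)); last 2 first.
- exact/measurable_EFinP.
- by move=> x; rewrite lee_fin.
have mE : measurable_fun setT (fun x : R => expR (- (c * x / l + c ^+ 2 / (l *+ 2)))).
  apply: measurableT_comp => //; apply: measurableT_comp => //.
  by apply: measurable_funD => //; apply: measurable_funM => //; exact: measurable_funM.
have msh : measurable_fun setT (fun x : R => f (x + c)).
  by apply: (measurableT_comp mf); exact: measurable_funD.
rewrite (ge0_integral_gaussian mY YE
  (f := fun x => (f (x + c) * expR (- (c * x / l + c ^+ 2 / (l *+ 2))))%:E)); last 2 first.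
- by apply/measurable_EFinP; apply: measurable_funM.
- by move=> x; rewrite lee_fin mulr_ge0// expR_ge0.
rewrite -[LHS](ge0_integral_shift c (f := fun x => ((f x)%:E * (gpdf l x)%:E)%E)).
- by apply: eq_integral => x _; rewrite gpdf_shift// !EFinM muleA.
- by apply: emeasurable_funM; apply/measurable_EFinP => //; exact: measurable_gpdf.
- by move=> x; rewrite mule_ge0// lee_fin// gpdf_ge0.
Qed.

Section sinh_quotient.
Variable R : realType.
Implicit Types s e : R.

Lemma expRN_le s : 0 <= s -> expR (- s) * (2 * s) <= expR s - expR (- s) <= expR s * (2 * s).
Proof.
move=> s0; apply/andP; split.
  have -> : expR s - expR (- s) = expR (- s) * (expR (2 * s) - 1).
    by rewrite mulrBr mulr1 -expRD; congr (expR _ - _); ring.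
  by rewrite ler_wpM2l ?expR_ge0// lerBrDl expR_ge1Dx.
have -> : expR s - expR (- s) = expR s * (1 - expR (- (2 * s))).
  by rewrite mulrBr mulr1 -expRD; congr (_ - expR _); ring.
by rewrite ler_wpM2l ?expR_ge0//; have := expR_ge1Dx (- (2 * s)); lra.
Qed.

Lemma cvg_expR_scale (e_ : nat -> R) s : e_ q @[q --> \oo] --> 0 ->
  expR (s * e_ q) @[q --> \oo] --> (1 : R).
Proof.
move=> e0; rewrite -[X in _ --> X]expR0 -(mulr0 s).
by apply: (cvg_comp _ (@expR R)); [apply: cvgMr|exact: continuous_expR].
Qed.

Lemma sinh_quotient_cvg (e_ : nat -> R) s : 0 <= s -> (forall q, 0 < e_ q) ->
  e_ q @[q --> \oo] --> 0 ->
  (expR (s * e_ q) - expR (- (s * e_ q))) / e_ q @[q --> \oo] --> 2 * s.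
Proof.
move=> s0 e0 ecv.
apply: (@squeeze_cvgr _ _ _ _ (fun q => expR (- s * e_ q) * (2 * s)) (fun q => expR (s * e_ q) * (2 * s))).
- apply: nearW => q; have /andP[h1 h2] := expRN_le (mulr_ge0 s0 (ltW (e0 q))).
  by rewrite ler_pdivlMr// ler_pdivrMr// mulNr -!mulrA h1 h2.
- by rewrite -[X in _ --> X]mul1r; apply: cvgMl; exact: cvg_expR_scale.
- by rewrite -[X in _ --> X]mul1r; apply: cvgMl; exact: cvg_expR_scale.
Qed.

End sinh_quotient.

Section two_block_formula.
Context {d : measure_display} {T : measurableType d} {R : realType}.
Variables (P : probability T R) (B : R -> T -> R).
Hypothesis hB : uniform_bm P B.
Local Notation f w := (bpath B w).
Local Notation tau w := (first_argmin (f w)).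
Variable t : R.
Hypothesis t01 : 0 < t < 1.
Let t0 : 0 < t. Proof. by case/andP: t01. Qed.
Let t1 : t < 1. Proof. by case/andP: t01. Qed.

Local Notation Z1 := (bZ B 0 t).
Local Notation M1 := (bM B 0 t).
Local Notation Z2 := (bZ B t 1).
Local Notation M2 := (bM B t 1).

Let mZ1 : measurable_fun setT Z1. Proof. exact: (measurable_bZ hB). Qed.
Let mZ2 : measurable_fun setT Z2. Proof. exact: (measurable_bZ hB). Qed.
Let mM1 : measurable_fun setT M1. Proof. exact: (measurable_bM hB t0). Qed.
Let mM2 : measurable_fun setT M2. Proof. exact: (measurable_bM hB t1). Qed.
Let M20 w : 0 <= M2 w. Proof. exact: (bM_ge0 hB t1). Qed.

Section bounded_weights.
Variables (u v : R -> R) (C K : R).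
Hypotheses (cu : continuous u) (cv : continuous v).
Hypotheses (u0 : forall x, 0 <= u x <= C) (v0 : forall x, 0 <= v x <= C).
Hypotheses (K0 : 0 <= K) (uK : forall x, K <= x -> u x = 0).

Let mu : measurable_fun setT u. Proof. exact: continuous_measurable_fun. Qed.
Let mv : measurable_fun setT v. Proof. exact: continuous_measurable_fun. Qed.
Let C0 : 0 <= C. Proof. by have /andP[h1 h2] := u0 0; exact: le_trans h2. Qed.

(** Contribution of the second block for window [x]. The positive part makes its mean [kap] vanish
    for [x <= 0]. *)
Let cap x w : R := v (Z2 w) * Num.min (M2 w) (Num.max 0 x).
Let kap x : R := \int[P]_w cap x w.

Let cap_bound x w : 0 <= cap x w <= C * Num.max 0 x.
Proof.
have /andP[h1 h2] := v0 (Z2 w).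
have h3 : 0 <= Num.min (M2 w) (Num.max 0 x) by rewrite le_min M20 le_max lexx.
by rewrite /cap mulr_ge0//= ler_pM// ge_min lexx orbT.
Qed.

Let bcap x : bdm (cap x).
Proof.
split; last by exists (C * Num.max 0 x) => w; have /andP[a b] := cap_bound x w; rewrite ger0_norm.
by apply: measurable_funM; [exact: (measurableT_comp mv)|exact: measurable_minr].
Qed.

Let kap_bound x : 0 <= kap x <= C * Num.max 0 x.
Proof.
rewrite /kap; apply/andP; split.
  by apply: Rintegral_ge0 => w _; case/andP: (cap_bound x w).
rewrite -[leRHS](Ex_cst P); apply: le_Ex => //; first exact: bdm_cst.
by move=> w; case/andP: (cap_bound x w).
Qed.

Let kap0 x : x <= 0 -> kap x = 0.
Proof.
move=> x0; apply/eqP; rewrite eq_le; have /andP[h1 h2] := kap_bound x.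
by rewrite h1 andbT (le_trans h2)// max_l// mulr0.
Qed.

Let ckap : continuous kap.
Proof.
move=> x; apply/continuousP_le => e e0; exists (e / (C + 1)).
  by rewrite divr_gt0// ltr_wpDl.
move=> y xy; rewrite /kap -ExB//.
apply: le_trans (le_norm_Ex P (bdmB (bcap x) (bcap y))) _.
rewrite -[leRHS](Ex_cst P); apply: le_Ex; [|exact: bdm_cst|].
  split; last first.
    have [m [D hD]] := bdmB (bcap x) (bcap y); exists D => w.
    by rewrite normr_id; exact: hD.
  by apply: measurableT_comp => //; have [] := bdmB (bcap x) (bcap y).
move=> w; rewrite /cap -mulrBr normrM.
have /andP[h1 h2] := v0 (Z2 w); rewrite (ger0_norm h1).
have h : `|Num.min (M2 w) (Num.max 0 x) - Num.min (M2 w) (Num.max 0 y)| <= `|x - y|.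
  apply: min_dist; first by rewrite subrr normr0.
  have h3 := ler_norm (x - y); have h4 := ler_norm (y - x); rewrite distrC in h4.
  by rewrite ler_norml; case: (leP 0 x) => hx; case: (leP 0 y) => hy; lra.
apply: (@le_trans _ _ (C * (e / (C + 1)))).
  by apply: ler_pM => //; exact: le_trans h xy.
by rewrite mulrCA ler_piMr ?(ltW e0)// ler_pdivrMr ?ltr_wpDl// mul1r lerDl.
Qed.

Let mkap : measurable_fun setT kap. Proof. exact: continuous_measurable_fun. Qed.

Section fixed_level.
Variable e : R.
Hypothesis e0 : 0 < e.

Let g y := u y * kap (y + e).

Let cg : continuous g.
Proof.
move=> y; apply: cvgM; first exact: cu.
apply: (cvg_comp (fun y => y + e) kap); last exact: ckap.
by apply: cvgD; [exact: cvg_id|exact: cvg_cst].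
Qed.

Let g_ge0 y : 0 <= g y.
Proof. by rewrite mulr_ge0//; [case/andP: (u0 y)|case/andP: (kap_bound (y + e))]. Qed.

Let g_le y : g y <= C * (C * (K + e)).
Proof.
have [Ky|yK] := leP K y.
  by rewrite /g uK// mul0r !mulr_ge0// addr_ge0// ltW.
have /andP[a b] := u0 y; have /andP[c c'] := kap_bound (y + e).
rewrite ler_pM// (le_trans c')// ler_wpM2l// ge_max lerD2r (ltW yK) andbT.
by rewrite addr_ge0// ltW.
Qed.

Let gC y : `|g y| <= C * (C * (K + e)). Proof. by rewrite ger0_norm. Qed.

(** Fubini integrates out the second block, then [reflection] is applied to the first at depth [e].
    Its indicators disappear: [kap] already annihilates [g (Z1 w)] for [Z1 w <= - e] and the
    reflected term for [Z1 w >= - e]. *)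
Lemma last_exit_mean_gauss :
  last_exit_mean P B u v t e = \int[P]_w g (Z1 w) - \int[P]_w g (- (2 * e) - Z1 w).
Proof.
rewrite /last_exit_mean.
pose F (w : T * T) : R := u (Z1 w.1) * (M1 w.1 <= e)%R%:R * cap (Z1 w.1 + e) w.2.
transitivity (\int[(P \x P)%E]_w F w).
  apply: eq_Rintegral => w _; rewrite /rlim /F /cap -/(bZ B 0 t w.1) -/(bZ B t 1 w.2).
  rewrite -/(bM B 0 t w.1) -/(bM B t 1 w.2).
  have [Me|_] := leP (M1 w.1) e; last by rewrite !mulr0 !mul0r.
  have := bM_geN hB t0 w.1 => h.
  rewrite (max_r (x := 0)); last by lra.
  by rewrite !mulr1 mulrA.
have mF : measurable_fun setT F.
  apply: measurable_funM; first apply: measurable_funM.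
  - by apply: (measurableT_comp mu); exact: (measurableT_comp mZ1).
  - apply: measurable_natr; apply: measurable_fun_ler => //.
    exact: (measurableT_comp mM1).
  - apply: measurable_funM.
      by apply: (measurableT_comp mv); exact: (measurableT_comp mZ2).
    apply: measurable_minr; first exact: (measurableT_comp mM2).
    apply: measurable_maxr => //; apply: measurable_funD => //.
    exact: (measurableT_comp mZ1).
have F0 w : 0 <= F w.
  rewrite !mulr_ge0//; first by case/andP: (u0 (Z1 w.1)).
    by case/andP: (v0 (Z2 w.2)).
  by rewrite le_min M20 le_max lexx.
rewrite Ex_fubini//; last first.
  split=> //; exists (C * (C * (K + e))) => w; rewrite ger0_norm// /F.
  have [Ky|yK] := leP K (Z1 w.1).
    by rewrite uK// !mul0r !mulr_ge0// addr_ge0// ltW.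
  have /andP[a b] := u0 (Z1 w.1); have /andP[c c'] := cap_bound (Z1 w.1 + e) w.2.
  apply: ler_pM => //.
  - by rewrite mulr_ge0.
  - apply: (le_trans _ b); rewrite ler_piMr//.
    by case: (M1 w.1 <= e)%R; rewrite ?ler01.
  - rewrite (le_trans c')// ler_wpM2l// ge_max lerD2r (ltW yK) andbT.
    by rewrite addr_ge0// ltW.
transitivity (\int[P]_w (g (Z1 w) * (M1 w <= e)%R%:R)).
  apply: eq_Rintegral => w _; rewrite /F /=.
  by rewrite ExZ//; rewrite /g -/(kap _) mulrAC.
rewrite (@reflection _ _ _ P B hB 0 t (lexx 0) t0 (ltW t1) g _ e cg gC e0).
have mg : measurable_fun setT g by exact: continuous_measurable_fun.
rewrite -ExB; last 2 first.
- split; first exact: (measurableT_comp mg).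
  by exists (C * (C * (K + e))) => w.
- split; last by exists (C * (C * (K + e))) => w.
  by apply: (measurableT_comp mg); exact: measurable_funB.
apply: eq_Rintegral => w _; rewrite /refl.
have [h1|h1] := ltP (- e) (Z1 w); have [h2|h2] := ltP (Z1 w) (- e).
- by have := lt_trans h1 h2; rewrite ltxx.
- rewrite mulr1 mulr0 subr0 [X in _ = _ - X](_ : _ = 0) ?subr0//.
  by rewrite /g kap0 ?mulr0//; lra.
- rewrite mulr1 mulr0 [in RHS](_ : g (Z1 w) = 0)//.
  by rewrite /g kap0 ?mulr0//; lra.
- have -> : Z1 w = - e by apply/eqP; rewrite eq_le h1 h2.
  by rewrite /g kap0 ?mulr0 ?mul0r; [rewrite kap0 ?mulr0//; lra|lra].
Qed.

Let sinh_form w := u (Z1 w - e) * kap (Z1 w) * expR (- (e ^+ 2 / (t *+ 2))) *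
    (expR (Z1 w / t * e) - expR (- (Z1 w / t * e))).

(** Shifting the first term by [- e], and the second, after a change of sign, by [e], brings both to
    the argument [Z1 w - e]. Only the two Gaussian weights differ, so the difference of order [e]
    becomes explicit without differentiating [g]. *)
Lemma last_exit_mean_sinh : bdm sinh_form /\ last_exit_mean P B u v t e = \int[P]_w sinh_form w.
Proof.
rewrite last_exit_mean_gauss.
have gZ := @bZ_gaussian _ _ _ P B hB 0 t (lexx 0) t0 (ltW t1); rewrite subr0 in gZ.
have mg : measurable_fun setT g by exact: continuous_measurable_fun.
have bg c : bdm (fun x : R => g (c + x)).
  split; last by exists (C * (C * (K + e))) => w.
  by apply: (measurableT_comp mg); exact: measurable_funD.
rewrite (bZ_sym hB (lexx 0) t0 (ltW t1) (bg (- (2 * e)))).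
rewrite (Ex_gaussian_shift (- e) t0 mZ1 gZ mg g_ge0).
rewrite (Ex_gaussian_shift e t0 mZ1 gZ (bg (- (2 * e))).1); last by move=> x; exact: g_ge0.
have gE x : g (x - e) = u (x - e) * kap x by rewrite /g subrK.
have bE s : bdm (fun w => g (Z1 w - e) * expR (s * Z1 w)).
  split.
    apply: measurable_funM; first by apply: (measurableT_comp mg); exact: measurable_funB.
    by apply: measurableT_comp => //; exact: measurable_funM.
  exists (C * (C * (K + e)) * expR (`|s| * (K + e))) => w.
  have [z0|z0] := leP (Z1 w) 0.
    by rewrite gE kap0// mulr0 mul0r normr0 !mulr_ge0 ?expR_ge0// addr_ge0// ltW.
  have [Kz|zK] := leP K (Z1 w - e).
    by rewrite gE uK// !mul0r normr0 !mulr_ge0 ?expR_ge0// addr_ge0// ltW.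
  rewrite normrM (ger0_norm (expR_ge0 _)) ler_pM ?expR_ge0//.
  rewrite ler_expR (le_trans (ler_norm _))// normrM (gtr0_norm z0) ler_wpM2l//.
  by rewrite -lerBlDr ltW.
pose q := expR (- (e ^+ 2 / (t *+ 2))).
have tn0 : t != 0 by rewrite gt_eqF.
have qE s : bdm (fun w => q * (g (Z1 w - e) * expR (s * Z1 w))).
  by apply: bdmM => //; exact: bdm_cst.
have FE : sinh_form = fun w => q * (g (Z1 w - e) * expR (e / t * Z1 w)) -
   q * (g (Z1 w - e) * expR (- (e / t) * Z1 w)).
  apply/funext => w; rewrite -mulrBr -mulrBr gE mulrA (mulrC q).
  by rewrite /sinh_form -/q; congr (_ * (expR _ - expR _)); field.
split; first by rewrite FE; exact: bdmB.
rewrite FE ExB//; congr (_ - _); apply: eq_Rintegral => w _.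
  rewrite [RHS]mulrCA -expRD; congr (_ * expR _).
  by field.
rewrite [RHS]mulrCA -expRD; congr (g _ * expR _); first by ring.
by field.
Qed.

End fixed_level.

(** Divided by [e], the difference of exponentials tends to [2 * Z1 / t]. Domination holds because
    the integrand vanishes unless [0 < Z1 < K + 1]. *)
Lemma bounded_vtarget_mean : \int[P]_w vtarget u v (f w) t (tau w) =
  \int[(P \x P)%E]_w (u (Z1 w.1) * v (Z2 w.2) * Num.min (M2 w.2) (Num.max 0 (Z1 w.1)) *
     (2 / t * Num.max 0 (Z1 w.1))).
Proof.
pose e (q : nat) : R := q.+1%:R^-1.
have e0 q : 0 < e q by rewrite invr_gt0 ltr0n.
have e1 q : e q <= 1 by rewrite invf_le1 ?ltr0n// ler1n.
have ecv : e q @[q --> \oo] --> 0 by exact: cvg_harmonic.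
have K1 : 0 <= K + 1 by rewrite addr_ge0.
pose h q w := u (Z1 w - e q) * kap (Z1 w) * expR (- (e q ^+ 2 / (t *+ 2))) *
    ((expR (Z1 w / t * e q) - expR (- (Z1 w / t * e q))) / e q).
pose k w := u (Z1 w) * kap (Z1 w) * 1 * (2 * (Z1 w / t)).
have mue q : measurable_fun setT (fun w => u (Z1 w - e q)).
  by apply: (measurableT_comp mu); exact: measurable_funB.
have mkZ : measurable_fun setT (fun w => kap (Z1 w)) by exact: (measurableT_comp mkap).
have hk : \int[P]_w h q w @[q --> \oo] --> \int[P]_w k w.
  apply: (@bounded_cvg _ _ _ P h k (C * (C * (K + 1)) * (expR ((K + 1) / t) * (2 * ((K + 1) / t))))).
  - move=> q; apply: measurable_funM; first apply: measurable_funM => //.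
      exact: measurable_funM.
    apply: measurable_funM => //; apply: measurable_funB.
      by apply: measurableT_comp => //; do 2 apply: measurable_funM => //.
    by apply: measurableT_comp => //; apply: measurableT_comp => //; do 2 apply: measurable_funM => //.
  - apply: measurable_funM; last by do 2 apply: measurable_funM => //.
    do 2 apply: measurable_funM => //; exact: (measurableT_comp mu).
  - move=> q w; have bn : 0 <= C * (C * (K + 1)) * (expR ((K + 1) / t) * (2 * ((K + 1) / t))).
      by rewrite !mulr_ge0 ?expR_ge0// invr_ge0 ltW.
    have [z0|z0] := leP (Z1 w) 0; first by rewrite /h kap0// mulr0 !mul0r normr0.
    have [Kz|zK] := leP K (Z1 w - e q); first by rewrite /h uK// !mul0r normr0.
    have zK1 : Z1 w <= K + 1 by have := e1 q; lra.
    have /andP[a a'] := u0 (Z1 w - e q); have /andP[b b'] := kap_bound (Z1 w).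
    have s0 : 0 <= Z1 w / t by rewrite divr_ge0// ltW.
    have s1 : Z1 w / t <= (K + 1) / t by rewrite ler_pM2r ?invr_gt0.
    have /andP[c c'] := expRN_le (mulr_ge0 s0 (ltW (e0 q))).
    have c0 : 0 <= expR (Z1 w / t * e q) - expR (- (Z1 w / t * e q)).
      by apply: le_trans c; rewrite mulr_ge0 ?expR_ge0// mulr_ge0// mulr_ge0// ltW.
    have qq : 0 <= expR (- (e q ^+ 2 / (t *+ 2))) <= 1.
      rewrite expR_ge0/= -expR0 ler_expR oppr_le0 divr_ge0 ?exprn_ge0 ?(ltW (e0 q))//.
      by rewrite mulrn_wge0// ltW.
    have /andP[qq0 qq1] := qq.
    rewrite /h ger0_norm; last first.
      by rewrite mulr_ge0 ?divr_ge0 ?(ltW (e0 q))// mulr_ge0// mulr_ge0.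
    apply: ler_pM.
    + by rewrite mulr_ge0// mulr_ge0.
    + by rewrite divr_ge0// ltW.
    + apply: (@le_trans _ _ (u (Z1 w - e q) * kap (Z1 w))).
        by rewrite ler_piMr// mulr_ge0.
      rewrite ler_pM// (le_trans b')// ler_wpM2l// ge_max K1//.
    + rewrite ler_pdivrMr//; apply: le_trans c' _.
      rewrite -[leRHS]mulrA; apply: ler_pM; rewrite ?expR_ge0//.
      * by rewrite mulr_ge0// mulr_ge0// ltW.
      * by rewrite ler_expR (le_trans _ s1)// ler_piMr.
      * by rewrite [leLHS]mulrA; apply: ler_wpM2r; [exact: ltW|exact: ler_wpM2l].
  - apply: nearW => w.
    have [z0|z0] := leP (Z1 w) 0.
      rewrite /h /k kap0// mulr0 !mul0r.
      by under eq_fun do rewrite mulr0 !mul0r; exact: cvg_cst.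
    have s0 : 0 <= Z1 w / t by rewrite divr_ge0// ltW.
    apply: cvgM; last exact: sinh_quotient_cvg.
    apply: cvgM; first apply: cvgM; last 2 first.
    + exact: cvg_cst.
    + apply: (@cvg_trans _ (expR (- (t *+ 2)^-1 * (e q * e q)) @[q --> \oo])).
        apply: near_eq_cvg; apply: nearW => q; congr expR.
        by rewrite expr2 mulNr mulrC.
      apply: (@cvg_expR_scale R (fun q => e q * e q)).
      by rewrite -[X in _ --> X](mulr0 0); exact: cvgM.
    + apply: (cvg_comp (fun q => Z1 w - e q) u); last exact: cu.
      rewrite -[X in _ `=>` nbhs X](subr0 (Z1 w)); apply: cvgB; [exact: cvg_cst|exact: ecv].
have lk : last_exit_mean P B u v t (e q) / e q @[q --> \oo] --> \int[P]_w k w.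
  apply: cvg_trans hk; apply: near_eq_cvg; apply: nearW => q.
  have [bh ->] := last_exit_mean_sinh (e0 q).
  rewrite mulrC -ExZ//; apply: eq_Rintegral => w _.
  by rewrite /h [RHS]mulrC mulrA.
have mU : measurable_fun setT (fun w : T * T => u (Z1 w.1)).
  by apply: (measurableT_comp mu); exact: (measurableT_comp mZ1).
have mX : measurable_fun setT (fun w : T * T => Num.max 0 (Z1 w.1)).
  by apply: measurable_maxr => //; exact: (measurableT_comp mZ1).
have c2 := last_exit_cvg hB cu cv u0 v0 K0 uK t01.
rewrite -(cvg_lim (@Rhausdorff R) c2) (cvg_lim (@Rhausdorff R) lk).
pose F (w : T * T) : R := u (Z1 w.1) * v (Z2 w.2) * Num.min (M2 w.2) (Num.max 0 (Z1 w.1)) *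
     (2 / t * Num.max 0 (Z1 w.1)).
have F0 w : 0 <= F w.
  have /andP[a _] := u0 (Z1 w.1); have /andP[b _] := v0 (Z2 w.2).
  have m0 : 0 <= Num.max 0 (Z1 w.1) by rewrite le_max lexx.
  by rewrite /F !mulr_ge0// ?invr_ge0 ?(ltW t0)// le_min M20.
have mF : measurable_fun setT F.
  apply: measurable_funM; last exact: measurable_funM.
  apply: measurable_funM; first apply: measurable_funM => //.
    by apply: (measurableT_comp mv); exact: (measurableT_comp mZ2).
  by apply: measurable_minr => //; exact: (measurableT_comp mM2).
have FE w : F w = u (Z1 w.1) * (2 / t * Num.max 0 (Z1 w.1)) * cap (Z1 w.1) w.2.
  by rewrite /F /cap -!mulrA; congr (_ * _); rewrite mulrCA [RHS]mulrCA; ring.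
transitivity (\int[(P \x P)%E]_w F w); last by [].
rewrite Ex_fubini//; last first.
  split=> //; exists (C * (2 / t * K) * (C * K)) => w; rewrite ger0_norm// FE.
  have t20 : 0 <= 2 / t by rewrite divr_ge0// ltW.
  have [Kz|zK] := leP K (Z1 w.1); first by rewrite uK// !mul0r !mulr_ge0 // invr_ge0 (ltW t0).
  have /andP[a a'] := u0 (Z1 w.1); have /andP[b b'] := cap_bound (Z1 w.1) w.2.
  have m0 : 0 <= Num.max 0 (Z1 w.1) by rewrite le_max lexx.
  have m1 : Num.max 0 (Z1 w.1) <= K by rewrite ge_max K0 ltW.
  apply: ler_pM => //; first by rewrite mulr_ge0// mulr_ge0.
    by apply: ler_pM => //; [exact: mulr_ge0|exact: ler_wpM2l].
  by rewrite (le_trans b')// ler_wpM2l.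
apply: eq_Rintegral => w _; under [RHS]eq_Rintegral do rewrite FE.
rewrite /= (ExZ P _ (bcap _)) -/(kap _) /k mulr1.
have [z0|z0] := leP (Z1 w) 0; first by rewrite kap0// !mulr0 mul0r.
by ring.
Qed.


End bounded_weights.
End two_block_formula.

Lemma monotone_limit_eq d d' (T : measurableType d) (T' : measurableType d') (R : realType)
    (mu : {measure set T -> \bar R}) (nu : {measure set T' -> \bar R})
    (F_ : nat -> T -> R) (F : T -> R) (G_ : nat -> T' -> R) (G : T' -> R) :
  (forall n, measurable_fun setT (F_ n)) -> (forall n, measurable_fun setT (G_ n)) ->
  (forall n x, 0 <= F_ n x) -> (forall n y, 0 <= G_ n y) ->
  (forall x m n, (m <= n)%N -> F_ m x <= F_ n x) ->
  (forall y m n, (m <= n)%N -> G_ m y <= G_ n y) ->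
  (forall x, F_ n x @[n --> \oo] --> F x) -> (forall y, G_ n y @[n --> \oo] --> G y) ->
  (forall n, \int[mu]_x (F_ n x)%:E = \int[nu]_y (G_ n y)%:E)%E ->
  (\int[mu]_x (F x)%:E = \int[nu]_y (G y)%:E)%E.
Proof.
move=> mF mG F0 G0 ndF ndG cF cG FG.
have lim d1 (T1 : measurableType d1) (m1 : {measure set T1 -> \bar R})
    (H_ : nat -> T1 -> R) (H : T1 -> R) :
    (forall n, measurable_fun setT (H_ n)) -> (forall n x, 0 <= H_ n x) ->
    (forall x m n, (m <= n)%N -> H_ m x <= H_ n x) ->
    (forall x, H_ n x @[n --> \oo] --> H x) ->
    (\int[m1]_x (H x)%:E = limn (fun n => \int[m1]_x (H_ n x)%:E))%E.
  move=> mH H0 ndH cH; rewrite -monotone_convergence//.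
  - apply: eq_integral => x _; apply/esym/cvg_lim => //.
    by apply: cvg_EFin; [exact: nearW|exact: cH].
  - by move=> n; exact/measurable_EFinP.
  - by move=> n x _; rewrite lee_fin.
  - by move=> x _ m n mn; rewrite lee_fin ndH.
rewrite (lim _ _ mu F_ F)// (lim _ _ nu G_ G)//; congr (limn _); exact/funext.
Qed.

(** * Unbounded weights and decomposition by levels *)

Section truncation.
Variables (R : realType) (u : R -> R).
Hypotheses (cu : continuous u) (u0 : forall x, 0 <= u x).

(* Bounded and vanishing beyond [n]: the exchange argument needs such weights. *)
Definition trunc (n : nat) (x : R) : R :=
  Num.min (u x) n%:R * Num.max 0 (Num.min 1 (n%:R - `|x|)).

Let cut01 (y : R) : 0 <= Num.max 0 (Num.min 1 y) <= 1.
Proof. by rewrite le_max lexx/= ge_max ler01 ge_min lexx. Qed.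

Lemma trunc_bound n x : 0 <= trunc n x <= n%:R.
Proof.
have /andP[h1 h2] := cut01 (n%:R - `|x|).
have h3 : 0 <= Num.min (u x) n%:R by rewrite le_min u0/=.
by rewrite mulr_ge0//= (le_trans (ler_piMr h3 h2))// ge_min lexx orbT.
Qed.

Lemma trunc_eq0 n x : n%:R <= x -> trunc n x = 0.
Proof.
move=> nx; rewrite /trunc max_l ?mulr0// ge_min; apply/orP; right.
by rewrite subr_le0 (le_trans nx)// ler_norm.
Qed.

Lemma trunc_nd x m n : (m <= n)%N -> trunc m x <= trunc n x.
Proof.
rewrite -(ler_nat R) => mn.
have /andP[h1 _] := cut01 (m%:R - `|x|).
have h3 : 0 <= Num.min (u x) m%:R by rewrite le_min u0/=.
rewrite /trunc ler_pM//; first by rewrite le_min !ge_min lexx mn orbT.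
rewrite ge_max !le_max lexx/= le_min !ge_min lexx/= lerD2r mn.
by rewrite !orbT.
Qed.

Lemma trunc_cvg x : trunc n x @[n --> \oo] --> u x.
Proof.
apply: (@cvg_trans _ (cst (u x) n @[n --> \oo])); last exact: cvg_cst.
apply: near_eq_cvg; near=> n; rewrite /= /trunc.
have h : Num.max (u x) (`|x| + 1) <= n%:R by near: n; exact: nbhs_infty_ger.
move: h; rewrite ge_max => /andP[h1 h2].
by rewrite min_l// min_l ?max_r ?mulr1 ?ler01//; lra.
Unshelve. all: by end_near. Qed.

Lemma trunc_continuous n : continuous (trunc n).
Proof.
move=> x; apply: cvgM.
  apply/cvgrPdist_le => e e0; near=> y; apply: min_dist; last by rewrite subrr normr0 ltW.
  by near: y; move/cvgrPdist_le : (@cu x); apply.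
apply/cvgrPdist_le => e e0; near=> y.
have h : `|x - y| <= e by near: y; move/cvgrPdist_le : (@cvg_id _ (nbhs x)); apply.
have := ler_dist_dist x y; move=> /le_trans/(_ h); rewrite !ler_norml => /andP[h1 h2].
by case: (leP 1 (n%:R - `|x|)) => h3; case: (leP 1 (n%:R - `|y|)) => h4;
  rewrite /Num.max; case: ltP => h5; case: ltP => h6; lra.
Unshelve. all: by end_near. Qed.

Lemma measurable_trunc n : measurable_fun setT (trunc n).
Proof. by apply: continuous_measurable_fun; exact: trunc_continuous. Qed.

End truncation.

Section nonnegative_weights.
Context {d : measure_display} {T : measurableType d} {R : realType}.
Variables (P : probability T R) (B : R -> T -> R).
Hypothesis hB : uniform_bm P B.
Local Notation f w := (bpath B w).
Local Notation tau w := (first_argmin (f w)).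
Local Notation mu := (@lebesgue_measure R).

Section upper_tail.
Variables (a b : R) (g : R -> R).
Hypotheses (a0 : 0 <= a) (ab : a < b) (b1 : b <= 1).
Hypotheses (cg : continuous g) (g0 : forall x, 0 <= g x).
Local Notation Z := (bZ B a b).
Local Notation M := (bM B a b).
Variable c : R.
Hypothesis c0 : 0 < c.

Let mZ : measurable_fun setT Z. Proof. exact: (measurable_bZ hB). Qed.
Let mM : measurable_fun setT M. Proof. exact: (measurable_bM hB ab). Qed.

(** Complementary form of [reflection], for unbounded [g]: below [- c] the depth exceeds [c]
    automatically, and the paths that recover from depth [c] contribute the reflected term. *)
Lemma reflection_tail :
  (\int[P]_w (g (Z w) * (c < M w)%R%:R)%:E =
   \int[P]_w ((g (Z w) + g (- (2 * c) - Z w)) * (Z w <= - c)%R%:R)%:E)%E.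
Proof.
pose g_ n := trunc g n.
have mg n : measurable_fun setT (g_ n) by exact: measurable_trunc.
have mcM : measurable_fun setT (fun w => (c < M w)%R%:R : R).
  by apply: measurable_natr; exact: measurable_fun_ltr.
have mZc : measurable_fun setT (fun w => (Z w <= - c)%R%:R : R).
  by apply: measurable_natr; exact: measurable_fun_ler.
have mgZ n : measurable_fun setT (fun w => g_ n (Z w)) by exact: (measurableT_comp (mg n)).
have mgZ' n : measurable_fun setT (fun w => g_ n (- (2 * c) - Z w)).
  by apply: (measurableT_comp (mg n)); exact: measurable_funB.
have gn0 n x : 0 <= g_ n x by case/andP: (trunc_bound g0 n x).
apply: (@monotone_limit_eq _ _ _ _ _ P P (fun n w => g_ n (Z w) * (c < M w)%R%:R) _
  (fun n w => (g_ n (Z w) + g_ n (- (2 * c) - Z w)) * (Z w <= - c)%R%:R)).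
- by move=> n; exact: measurable_funM.
- by move=> n; apply: measurable_funM => //; exact: measurable_funD.
- by move=> n w; rewrite mulr_ge0.
- by move=> n w; rewrite mulr_ge0// addr_ge0.
- by move=> w m n mn; rewrite ler_wpM2r// trunc_nd.
- by move=> w m n mn; rewrite ler_wpM2r// lerD// trunc_nd.
- by move=> w; apply: cvgM; [exact: trunc_cvg|exact: cvg_cst].
- by move=> w; apply: cvgM; [apply: cvgD; exact: trunc_cvg|exact: cvg_cst].
move=> n.
have bgZ : bdm (fun w => g_ n (Z w)).
  by split=> //; exists n%:R => w; have /andP[h1 h2] := trunc_bound g0 n (Z w); rewrite ger0_norm.
have bgZ' : bdm (fun w => g_ n (- (2 * c) - Z w)).
  by split=> //; exists n%:R => w; have /andP[h1 h2] := trunc_bound g0 n (- (2 * c) - Z w); rewrite ger0_norm.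
have bb (p : T -> bool) : measurable_fun setT p -> bdm (fun w => (p w)%:R : R) by exact: bdm_bool.
have bcM : bdm (fun w => (c < M w)%R%:R : R) by apply: bb; exact: measurable_fun_ltr.
have bMc : bdm (fun w => (M w <= c)%R%:R : R) by apply: bb; exact: measurable_fun_ler.
have bZc : bdm (fun w => (Z w <= - c)%R%:R : R) by apply: bb; exact: measurable_fun_ler.
have bZc' : bdm (fun w => (Z w < - c)%R%:R : R) by apply: bb; exact: measurable_fun_ltr.
have bcZ : bdm (fun w => (- c < Z w)%R%:R : R) by apply: bb; exact: measurable_fun_ltr.
have gnC x : `|g_ n x| <= n%:R by have /andP[h1 h2] := trunc_bound g0 n x; rewrite ger0_norm.
have brefl : bdm (fun w => refl (g_ n) c (Z w)) by apply: bdmB; exact: bdmM.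
rewrite ExE; last exact: bdmM.
transitivity (\int[P]_w (g_ n (Z w) * (Z w <= - c)%R%:R + g_ n (- (2 * c) - Z w) * (Z w < - c)%R%:R))%:E; last first.
  rewrite -ExE; last by apply: bdmD; exact: bdmM.
  apply: ae_eq_integral => //.
  - by apply/measurable_EFinP; have [] := bdmD (bdmM bgZ bZc) (bdmM bgZ' bZc').
  - by apply/measurable_EFinP; apply: measurable_funM => //; exact: measurable_funD.
  - apply: filterS (bZ_neq hB a0 ab b1 (- c)) => w Zc _ /=.
    have -> : (Z w < - c) = (Z w <= - c) by rewrite lt_neqAle Zc.
    by rewrite [X in _ = X%:E]mulrDl.
congr EFin.
transitivity (\int[P]_w g_ n (Z w) - \int[P]_w (g_ n (Z w) * (M w <= c)%R%:R)).
  rewrite -ExB//; last exact: bdmM.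
  apply: eq_Rintegral => w _; rewrite (leNgt (M w) c).
  by case: (c < M w)%R; rewrite /= ?mulr1 ?mulr0 ?subr0 ?subrr.
rewrite (@reflection _ _ _ P B hB a b a0 ab b1 (g_ n) _ c (@trunc_continuous _ _ cg n) gnC c0).
rewrite -ExB//; apply: eq_Rintegral => w _; rewrite /refl (ltNge (- c) (Z w)).
by case: (Z w <= - c)%R => /=; ring.
Qed.

End upper_tail.

Section weights.
Variables (u v : R -> R) (t : R).
Hypotheses (cu : continuous u) (cv : continuous v).
Hypotheses (u0 : forall x, 0 <= u x) (v0 : forall x, 0 <= v x).
Hypothesis t01 : 0 < t < 1.
Let t0 : 0 < t. Proof. by case/andP: t01. Qed.
Let t1 : t < 1. Proof. by case/andP: t01. Qed.
Let t01' : 0 <= t <= 1. Proof. by rewrite !ltW. Qed.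

Local Notation Z1 := (bZ B 0 t).
Local Notation Z2 := (bZ B t 1).
Local Notation M2 := (bM B t 1).

Let mZ1 : measurable_fun setT Z1. Proof. exact: (measurable_bZ hB). Qed.
Let mZ2 : measurable_fun setT Z2. Proof. exact: (measurable_bZ hB). Qed.
Let mM2 : measurable_fun setT M2. Proof. exact: (measurable_bM hB t1). Qed.
Let M20 w : 0 <= M2 w. Proof. exact: (bM_ge0 hB t1). Qed.
Let mu_ : measurable_fun setT u. Proof. exact: continuous_measurable_fun. Qed.
Let mv_ : measurable_fun setT v. Proof. exact: continuous_measurable_fun. Qed.

Let W (w : T * T) : R := Num.min (M2 w.2) (Num.max 0 (Z1 w.1)) * (2 / t * Num.max 0 (Z1 w.1)).

Let W0 w : 0 <= W w.
Proof.
have m0 : 0 <= Num.max 0 (Z1 w.1) by rewrite le_max lexx.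
by rewrite mulr_ge0// ?le_min ?M20// mulr_ge0// divr_ge0// ltW.
Qed.

Let mW : measurable_fun setT W.
Proof.
have mX : measurable_fun setT (fun w : T * T => Num.max 0 (Z1 w.1)).
  by apply: measurable_maxr => //; exact: (measurableT_comp mZ1).
apply: measurable_funM; last exact: measurable_funM.
by apply: measurable_minr => //; exact: (measurableT_comp mM2).
Qed.

Lemma vtarget_two_block :
  (\int[P]_w (vtarget u v (f w) t (tau w))%:E =
   \int[(P \x P)]_w (u (Z1 w.1) * v (Z2 w.2) * W w)%:E)%E.
Proof.
pose u_ n := trunc u n; pose v_ n := trunc v n.
have un0 n x : 0 <= u_ n x by case/andP: (trunc_bound u0 n x).
have vn0 n x : 0 <= v_ n x by case/andP: (trunc_bound v0 n x).
have mun n : measurable_fun setT (u_ n) by exact: measurable_trunc.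
have mvn n : measurable_fun setT (v_ n) by exact: measurable_trunc.
have cun n : continuous (u_ n) by exact: trunc_continuous.
have cvn n : continuous (v_ n) by exact: trunc_continuous.
apply: (@monotone_limit_eq _ _ _ _ _ P (P \x P)%E (fun n w => vtarget (u_ n) (v_ n) (f w) t (tau w)) _
  (fun n w => u_ n (Z1 w.1) * v_ n (Z2 w.2) * W w)).
- by move=> n; exact: (measurable_vtarget hB).
- move=> n; apply: measurable_funM => //; apply: measurable_funM.
    by apply: (measurableT_comp (mun n)); exact: (measurableT_comp mZ1).
  by apply: (measurableT_comp (mvn n)); exact: (measurableT_comp mZ2).
- by move=> n w; rewrite /vtarget; case: ifP => // _; rewrite mulr_ge0.
- by move=> n w; rewrite mulr_ge0// mulr_ge0.
- move=> w m n mn; rewrite /vtarget; case: ifP => // _.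
  by apply: ler_pM => //; exact: trunc_nd.
- move=> w m n mn; apply: ler_wpM2r => //.
  by apply: ler_pM => //; exact: trunc_nd.
- move=> w; rewrite /vtarget; case: ifP => // _; last exact: cvg_cst.
  by apply: cvgM; exact: trunc_cvg.
- by move=> w; apply: cvgM; [apply: cvgM; exact: trunc_cvg|exact: cvg_cst].
move=> n.
have bu x : 0 <= u_ n x <= n%:R by exact: trunc_bound.
have bv x : 0 <= v_ n x <= n%:R by exact: trunc_bound.
have uK x : n%:R <= x -> u_ n x = 0 by exact: trunc_eq0.
rewrite ExE; last first.
  split; first exact: (measurable_vtarget hB).
  exists (n%:R * n%:R) => w; rewrite /vtarget; case: ifP => _; last by rewrite normr0 mulr_ge0.
  have /andP[h1 h2] := bu (f w (tau w + t) - f w (tau w)).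
  have /andP[h3 h4] := bv (f w 1 - f w 0 - (f w (tau w + t) - f w (tau w))).
  by rewrite ger0_norm; [exact: ler_pM|exact: mulr_ge0].
rewrite (bounded_vtarget_mean hB t01 (cun n) (cvn n) bu bv (ler0n _ n) uK).
under [in LHS]eq_Rintegral do rewrite -mulrA.
rewrite -ExE//; split.
  apply: measurable_funM => //; apply: measurable_funM.
    by apply: (measurableT_comp (mun n)); exact: (measurableT_comp mZ1).
  by apply: (measurableT_comp (mvn n)); exact: (measurableT_comp mZ2).
exists (n%:R * n%:R * (n%:R * (2 / t * n%:R))) => w.
have t20 : 0 <= 2 / t by rewrite divr_ge0// ltW.
have rhs0 : 0 <= n%:R * n%:R * (n%:R * (2 / t * n%:R)) :> R by rewrite !mulr_ge0// invr_ge0 ltW.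
have [nZ|Zn] := leP n%:R (Z1 w.1); first by rewrite -/(u_ n) uK// !mul0r normr0.
have m0 : 0 <= Num.max 0 (Z1 w.1) by rewrite le_max lexx.
have m1 : Num.max 0 (Z1 w.1) <= n%:R by rewrite ge_max ler0n ltW.
have /andP[h1 h2] := bu (Z1 w.1); have /andP[h3 h4] := bv (Z2 w.2).
have uv0 := mulr_ge0 h1 h3; rewrite -/(W w) -/(u_ n (Z1 w.1)) -/(v_ n (Z2 w.2)) ger0_norm; last exact: mulr_ge0.
apply: ler_pM => //; first exact: ler_pM.
apply: ler_pM => //; first by rewrite le_min M20.
- exact: mulr_ge0.
- by rewrite ge_min m1 orbT.
- exact: ler_wpM2l.
Qed.

Let U (a : R) (x : R) : R := u x * (2 * x / t) * (a < x)%R%:R.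
Let V (a : R) (w : T) : R := v (Z2 w) * (a < M2 w)%R%:R.

(** The minimum of [M2] and the positive part of [Z1] is the length of the set of levels [a > 0]
    below both. At a fixed level the two blocks factor, so only the two one-block integrals
    remain. *)
Lemma vtarget_layers :
  (\int[P]_w (vtarget u v (f w) t (tau w))%:E =
   \int[mu]_(a in `]0%R, +oo[) ((\int[P]_w (U a (Z1 w))%:E) * \int[P]_w (V a w)%:E))%E.
Proof.
pose F (z : (T * T) * R) : \bar R :=
  ((0 < z.2)%R%:R * U z.2 (Z1 z.1.1) * V z.2 z.1.2)%:E.
have mz1 : measurable_fun setT (fun z : (T * T) * R => Z1 z.1.1).
  by apply: (measurableT_comp mZ1); exact: (measurableT_comp measurable_fst).
have mz2 : measurable_fun setT (fun z : (T * T) * R => Z2 z.1.2).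
  by apply: (measurableT_comp mZ2); exact: (measurableT_comp measurable_snd).
have mm2 : measurable_fun setT (fun z : (T * T) * R => M2 z.1.2).
  by apply: (measurableT_comp mM2); exact: (measurableT_comp measurable_snd).
have ma : measurable_fun setT (fun z : (T * T) * R => z.2) by exact: measurable_snd.
have U0 a x : 0 < a -> 0 <= U a x.
  move=> a0; rewrite /U; have [ax|_] := ltP a x; last by rewrite mulr0.
  by rewrite mulr1 mulr_ge0// !mulr_ge0 ?invr_ge0 ?(ltW t0)// ltW// (lt_trans a0).
have V0 a w : 0 <= V a w by rewrite mulr_ge0.
have F0 z : (0 <= F z)%E.
  rewrite lee_fin; have [z0|_] := ltP 0 z.2; last by rewrite !mul0r.
  by rewrite mul1r mulr_ge0// U0.
have mF : measurable_fun setT F.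
  apply/measurable_EFinP; apply: measurable_funM; first apply: measurable_funM.
  - by apply: measurable_natr; exact: measurable_fun_ltr.
  - apply: measurable_funM.
      apply: measurable_funM; first exact: (measurableT_comp mu_).
      by apply: measurable_funM => //; exact: measurable_funM.
    by apply: measurable_natr; exact: measurable_fun_ltr.
  - apply: measurable_funM; first exact: (measurableT_comp mv_).
    by apply: measurable_natr; exact: measurable_fun_ltr.
rewrite vtarget_two_block.
transitivity (\int[(P \x P)]_w (fubini_F mu F w))%E.
  apply: eq_integral => w _; rewrite /fubini_F /F /=.
  pose m := Num.min (M2 w.2) (Z1 w.1).
  transitivity (\int[mu]_a ((u (Z1 w.1) * (2 * Num.max 0 (Z1 w.1) / t) * v (Z2 w.2))%:E *
      (\1_(`]0%R, m[%classic) a)%:E)%E)%E.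
    rewrite ge0_integralZl//.
    - rewrite integral_indic//= setIT lebesgue_measure_itv/= lte_fin.
      rewrite /W; case: ifP => [m0|/negbT].
        rewrite -EFinB -EFinM subr0; congr EFin.
        have z0 : 0 < Z1 w.1 by move: m0; rewrite /m lt_min => /andP[].
        by rewrite max_r ?(ltW z0)// -/m; ring.
      rewrite -leNgt /m ge_min => /orP[h|h].
        by rewrite (_ : M2 w.2 = 0) ?mule0 ?min_l ?mul0r ?mulr0// ?le_max ?lexx//; apply/eqP; rewrite eq_le h M20.
      by rewrite mule0 max_l// !mulr0.
    - by apply/measurable_EFinP; exact: measurable_indic.
    - rewrite lee_fin mulr_ge0// mulr_ge0// mulr_ge0 ?invr_ge0 ?(ltW t0)// mulr_ge0//.
      by rewrite le_max lexx.
  apply: eq_integral => a _; rewrite -EFinM; congr EFin; rewrite /U /V indicE mem_setE in_itv/= /m lt_min.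
  have [a0|_] := ltP 0 a; last by rewrite !mul0r mulr0.
  have [am|_] := ltP a (M2 w.2); last by rewrite !mulr0.
  have [az|_] := ltP a (Z1 w.1); last by rewrite !mulr0 mul0r.
  by rewrite max_r ?(ltW (lt_trans a0 az))//=; ring.
pose Q : probability _ R := (P \x P)%E.
rewrite (@fubini_tonelli _ _ _ (measurableTypeR R) R Q mu F mF F0) [RHS]integral_mkcond.
apply: eq_integral => a _; rewrite patchE mem_setE in_itv/= andbT /fubini_G.
have [a0|a0] := ltP 0 a; last first.
  by rewrite integral0_eq// => w _; rewrite /F/= ltNge a0 !mul0r.
have mUa : measurable_fun setT (fun w => U a (Z1 w)).
  apply: measurable_funM.
    apply: measurable_funM; first exact: (measurableT_comp mu_).
    by apply: measurable_funM => //; exact: measurable_funM.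
  by apply: measurable_natr; exact: measurable_fun_ltr.
have mVa : measurable_fun setT (V a).
  apply: measurable_funM; first exact: (measurableT_comp mv_).
  by apply: measurable_natr; exact: measurable_fun_ltr.
transitivity (\int[(P \x P)]_w ((U a (Z1 w.1))%:E * (V a w.2)%:E))%E.
  by apply: eq_integral => w _; rewrite /F/= a0 mul1r EFinM.
rewrite (fubini_tonelli1 (fun w => (U a (Z1 w.1))%:E * (V a w.2)%:E))%E; last 2 first.
- apply: emeasurable_funM; apply/measurable_EFinP.
    exact: (measurableT_comp mUa).
  exact: (measurableT_comp mVa).
- by move=> w; rewrite mule_ge0// lee_fin// U0.
rewrite -ge0_integralZr//; last 3 first.
- exact/measurable_EFinP.
- by move=> w _; rewrite lee_fin U0.
- by apply: integral_ge0 => w _; rewrite lee_fin.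
apply: eq_integral => w _; rewrite /fubini_F/= ge0_integralZl//.
- exact/measurable_EFinP.
- by move=> y _; rewrite lee_fin.
- by rewrite lee_fin U0.
Qed.

End weights.
End nonnegative_weights.

(** * Gaussian integrals *)

Section upper_tails.
Context {R : realType}.
Local Notation mu := (@lebesgue_measure R).
Implicit Types (f : R -> R) (a x l : R).

Lemma FTC_tail (F f : R -> R) a l : (forall x, is_derive x 1 F (f x)) -> continuous f ->
  (forall x, a <= x -> 0 <= f x) -> F x @[x --> +oo] --> l ->
  (\int[mu]_(x in `[a, +oo[) (f x)%:E = (l - F a)%:E)%E.
Proof.
move=> dF cf f0 Fl; rewrite (@ge0_continuous_FTC2y _ f F a l)//.
- exact: continuous_subspaceT.
- apply: cvg_at_right_filter; apply: differentiable_continuous.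
  by apply/derivable1_diffP; have [] := dF a.
- by move=> x _; rewrite derive1E; exact: derive_val.
Qed.

Definition utail f a : R := \int[mu]_(x in `]a, +oo[) f x.

Let intS f (A : set R) : mu.-integrable setT (EFin \o f) -> measurable A ->
  mu.-integrable A (EFin \o f).
Proof. by move=> intf mA; apply: integrableS intf => //; exact: subsetT. Qed.

Lemma is_derive_utail f x : mu.-integrable setT (EFin \o f) -> continuous f ->
  is_derive x 1 (utail f) (- f x).
Proof.
move=> intf cf.
pose G y := \int[mu]_(x in `]-oo, y]) f x.
have -> : utail f = fun y => \int[mu]_x f x - G y.
  apply/funext => y; have := @Rintegral_itvB R f -oo%O +oo%O y.
  by rewrite set_itvNyy => /(_ intf isT isT) ->.
have [dG GE] := @continuous_FTC1 R f -oo%O x (x + 1) (ltr_pwDr ltr01 (lexx x)) (intS intf (measurable_itv _)) (ltNyr _) (cf x).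
have dGx : is_derive x 1 G (f x).
  by apply: DeriveDef; [exact: dG|rewrite -derive1E].
apply: is_derive_eq.
by rewrite add0r mul1r.
Qed.

Lemma le_utail f g a : mu.-integrable setT (EFin \o f) -> mu.-integrable setT (EFin \o g) ->
  (forall x, a < x -> f x <= g x) -> utail f a <= utail g a.
Proof.
move=> intf intg fg; apply: le_Rintegral => //; try exact: intS.
by move=> x /=; rewrite in_itv/= andbT; exact: fg.
Qed.

Lemma utail_ge0 f a : (forall x, 0 <= f x) -> 0 <= utail f a.
Proof. by move=> f0; apply: Rintegral_ge0. Qed.

Lemma utailE f a : mu.-integrable setT (EFin \o f) ->
  (\int[mu]_(x in `[a, +oo[) (f x)%:E = (utail f a)%:E)%E.
Proof.
move=> intf; rewrite -integral_itv_obnd_cbnd; last first.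
  by apply: measurable_funS (measurable_int _ intf).
by rewrite /utail /Rintegral fineK//; apply: integrable_fin_num => //; exact: intS.
Qed.

Lemma utailZ f k a : mu.-integrable setT (EFin \o f) -> utail (fun x => k * f x) a = k * utail f a.
Proof. by move=> intf; rewrite /utail RintegralZl//; exact: intS. Qed.

Lemma utailT f a : mu.-integrable setT (EFin \o f) -> (forall x, 0 <= f x) ->
  utail f a <= \int[mu]_x f x.
Proof.
move=> intf f0; have := @Rintegral_itvB R f -oo%O +oo%O a.
rewrite set_itvNyy => /(_ intf isT isT); rewrite /utail => <-.
by rewrite gerBl; exact: Rintegral_ge0.
Qed.

(** The fourth power leaves room for factors growing like a cube, enough for the quadratic ones in
    the primitives below. *)
Definition decay f := exists C : R, forall x, 1 <= x -> `|f x| <= C / x ^+ 4.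

Lemma decay_cvg0 f (p : R -> R) D : decay f -> (forall x, 1 <= x -> `|p x| <= D * x ^+ 3) ->
  p x * f x @[x --> +oo] --> (0 : R).
Proof.
move=> [C hC] pD; apply/cvgrPdist_le => e e0; near=> x.
have x1 : 1 <= x by near: x; exact: nbhs_pinfty_ge.
have x0 : 0 < x by apply: lt_le_trans x1.
have xe : D * C / e <= x by near: x; apply: nbhs_pinfty_ge; exact: num_real.
rewrite sub0r normrN normrM.
apply: (@le_trans _ _ (D * x ^+ 3 * (C / x ^+ 4))).
  by apply: ler_pM; [exact: normr_ge0|exact: normr_ge0|exact: pD|exact: hC].
have -> : D * x ^+ 3 * (C / x ^+ 4) = D * C / x by field; rewrite gt_eqF.
by rewrite ler_pdivrMr// (mulrC e x) -ler_pdivrMr.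
Unshelve. all: by end_near. Qed.

Lemma decayMl f g D : decay f -> (forall x, 1 <= x -> `|g x| <= D) -> decay (fun x => f x * g x).
Proof.
move=> [C hC] gD; exists (C * D) => x x1; rewrite normrM mulrAC.
by apply: ler_pM; [exact: normr_ge0|exact: normr_ge0|exact: hC|exact: gD].
Qed.

Section gaussian.
Variable l : R.
Hypothesis l0 : 0 < l.

Lemma is_derive_gpdf x : is_derive x 1 (gpdf l) (- (x / l * gpdf l x)).
Proof.
pose c := (Num.sqrt (l * pi *+ 2))^-1.
have -> : gpdf l = fun y => c * expR (- (l *+ 2)^-1 * (y * y)).
  by apply/funext => y; rewrite gpdfE// -/c expr2 mulNr (mulrC (y * y)).
apply: is_derive_eq.
rewrite /GRing.scale /=.
by field; rewrite gt_eqF.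
Qed.

Lemma continuous_gpdf : continuous (gpdf l).
Proof.
move=> x; apply: differentiable_continuous; apply/derivable1_diffP.
by have [] := is_derive_gpdf x.
Qed.

Lemma integrable_gpdf : mu.-integrable setT (EFin \o gpdf l).
Proof. exact: integrable_normal_pdf. Qed.

Lemma Rintegral_gpdf : \int[mu]_x gpdf l x = 1.
Proof. by rewrite /Rintegral integral_gpdf. Qed.

(** For [a >= 0] this is the probability that a centred Gaussian of variance [l] exceeds [a] in
    absolute value; by reflection it is also the tail of the depth of a block of length [l]. *)
Definition Qtail a : R := 2 * utail (gpdf l) a.

Lemma is_derive_Qtail x : is_derive x 1 Qtail (- (2 * gpdf l x)).
Proof.
have d1 := is_derive_utail x integrable_gpdf continuous_gpdf.
by apply: is_derive_eq; rewrite /GRing.scale /=; ring.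
Qed.

Lemma continuous_Qtail : continuous Qtail.
Proof.
move=> x; apply: differentiable_continuous; apply/derivable1_diffP.
by have [] := is_derive_Qtail x.
Qed.

Lemma Qtail_ge0 a : 0 <= Qtail a.
Proof. by rewrite mulr_ge0// utail_ge0// => x; exact: gpdf_ge0. Qed.

Lemma Qtail_le2 a : Qtail a <= 2.
Proof.
rewrite -[leRHS]mulr1 ler_wpM2l// -Rintegral_gpdf utailT//; first exact: integrable_gpdf.
by move=> x; exact: gpdf_ge0.
Qed.

Lemma Qtail0 : Qtail 0 = 1.
Proof.
have h : (\int[mu]_(x in `[0%R, +oo[) (gpdf l x)%:E = \int[mu]_(x in `]-oo, 0%R]) (gpdf l x)%:E)%E.
  rewrite [LHS]integral_mkcond [RHS]integral_mkcond.
  pose f x := (((fun x => (gpdf l x)%:E) \_ `]-oo, 0%R]) x)%E.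
  rewrite -[RHS](@ge0_integralN _ f).
  - apply: eq_integral => x _; rewrite /f !patchE gpdfN//.
    by congr (if _ then _ else _); rewrite !mem_setE !in_itv/= andbT oppr_le0.
  - apply/(measurable_restrictT _ (measurable_itv _))/measurable_EFinP.
    by apply: measurable_funTS; exact: measurable_gpdf.
  - by move=> x; rewrite /f patchE; case: ifP => // _; rewrite lee_fin gpdf_ge0.
have := @Rintegral_itvB R (gpdf l) -oo%O +oo%O 0.
rewrite set_itvNyy => /(_ integrable_gpdf isT isT); rewrite -/(utail _ 0) Rintegral_gpdf.
rewrite {1}/Rintegral -h utailE ?integrable_gpdf//= /Qtail; lra.
Qed.

(** Half of the Gaussian exponent. The other half, integrated over the tail, is at most a constant
    as a multiple of the density of variance [2 * l]; this gives the decay of [Qtail]. *)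
Let gexp x := expR (- (x ^+ 2 / (l *+ 4))).

Let gexp_decay : decay gexp.
Proof.
(* With [y = x ^+ 2 / (4 * l)], the bound [y / 2 <= expR (y / 2)] gives [expR (- y) <= 4 / y ^+ 2],
   which is [64 * l ^+ 2 / x ^+ 4]. *)
exists (64 * l ^+ 2) => x x1; have x0 : 0 < x by apply: lt_le_trans x1.
rewrite /gexp ger0_norm ?expR_ge0//; set y := x ^+ 2 / _.
have y0 : 0 < y by rewrite divr_gt0 ?exprn_gt0// pmulrn_rgt0.
have -> : 64 * l ^+ 2 / x ^+ 4 = 4 / y ^+ 2.
  by rewrite /y; field; rewrite !gt_eqF.
rewrite expRN -[leRHS]invrK lef_pV2 ?posrE ?invr_gt0 ?divr_gt0 ?exprn_gt0 ?expR_gt0//.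
rewrite invf_div.
have -> : y = y / 2 + y / 2 by field.
rewrite expRD -expr2.
have h := expR_ge1Dx (y / 2); have -> : (y / 2 + y / 2) ^+ 2 / 4 = (y / 2) ^+ 2 by field.
by rewrite lerXn2r ?nnegrE ?expR_ge0//; lra.
Qed.

Lemma gpdf_decay : decay (gpdf l).
Proof.
have [C hC] := gexp_decay; exists ((Num.sqrt (l * pi *+ 2))^-1 * C) => x x1.
rewrite ger0_norm ?gpdf_ge0// gpdfE// -[leRHS]mulrA.
rewrite ler_wpM2l ?invr_ge0 ?sqrtr_ge0//.
apply: le_trans (hC _ x1); rewrite ger0_norm ?expR_ge0// ler_expR lerN2.
rewrite ler_wpM2l ?sqr_ge0// lef_pV2 ?posrE ?pmulrn_rgt0//.
by rewrite ler_pMn2l.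
Qed.

Lemma gpdf_bounded x : `|gpdf l x| <= (Num.sqrt (l * pi *+ 2))^-1.
Proof.
rewrite ger0_norm ?gpdf_ge0// gpdfE// ler_piMr ?invr_ge0 ?sqrtr_ge0//.
by rewrite -expR0 ler_expR oppr_le0 divr_ge0 ?sqr_ge0// mulrn_wge0// ltW.
Qed.

Lemma Qtail_bounded x : `|Qtail x| <= 2.
Proof. by rewrite ger0_norm ?Qtail_ge0// Qtail_le2. Qed.

Lemma Qtail_decay : decay Qtail.
Proof.
have [C hC] := gexp_decay.
have l20 : 0 < l *+ 2 by rewrite pmulrn_rgt0.
pose n1 := (Num.sqrt (l * pi *+ 2))^-1; pose n2 := (Num.sqrt (l *+ 2 * pi *+ 2))^-1.
have n10 : 0 < n1 by rewrite invr_gt0 sqrtr_gt0 pmulrn_rgt0// mulr_gt0// pi_gt0.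
have n20 : 0 < n2 by rewrite invr_gt0 sqrtr_gt0 pmulrn_rgt0// mulr_gt0// pi_gt0.
exists (2 * (n1 / n2) * C) => a a1.
have intg2 : mu.-integrable setT (EFin \o gpdf (l *+ 2)) by exact: integrable_normal_pdf.
have h : utail (gpdf l) a <= n1 / n2 * gexp a.
  apply: (@le_trans _ _ (utail (fun x => n1 / n2 * gexp a * gpdf (l *+ 2) x) a)).
    apply: le_utail; first exact: integrable_gpdf.
      exact: (@integrableZl _ _ _ mu setT measurableT (n1 / n2 * gexp a) _ intg2).
    move=> x ax; have -> : gpdf l x = n1 / n2 * gexp x * gpdf (l *+ 2) x.
      rewrite !gpdfE// -/n1 -/n2 mulrACA divfK ?gt_eqF// -expRD.
      by congr (_ * expR _); field; rewrite gt_eqF.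
    apply: ler_wpM2r; first exact: gpdf_ge0.
    apply: ler_wpM2l; first by rewrite divr_ge0 ?ltW.
    rewrite ler_expR lerN2 ler_pM2r ?invr_gt0 ?pmulrn_rgt0//.
    have a0 : 0 <= a by apply: le_trans a1.
    by rewrite lerXn2r ?nnegrE ?(le_trans a0 (ltW ax))// ltW.
  rewrite utailZ// ler_piMr ?mulr_ge0 ?invr_ge0 ?(ltW n10) ?(ltW n20) ?expR_ge0//.
  apply: le_trans (utailT a intg2 _) _; first by move=> x; exact: gpdf_ge0.
  by rewrite /Rintegral integral_gpdf.
rewrite ger0_norm ?Qtail_ge0// /Qtail -!mulrA ler_wpM2l// (le_trans h)// -mulrA.
rewrite ler_wpM2l ?(ltW n10)// ler_wpM2l ?invr_ge0 ?(ltW n20)//.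
by have := hC _ a1; rewrite ger0_norm ?expR_ge0.
Qed.

End gaussian.

End upper_tails.

Section gaussian_integrals.
Context {R : realType}.
Local Notation mu := (@lebesgue_measure R).
Implicit Types (f : R -> R) (a c x l : R).

Lemma decay_quad f A0 A1 A2 : decay f -> (A0 + A1 * x + A2 * x ^+ 2) * f x @[x --> +oo] --> (0 : R).
Proof.
move=> df; apply: (@decay_cvg0 _ f (fun x => A0 + A1 * x + A2 * x ^+ 2) (`|A0| + `|A1| + `|A2|)) => // x x1.
have x0 : 0 <= x by apply: le_trans x1.
have h2 : x ^+ 2 <= x ^+ 3 by rewrite [leRHS]exprS ler_peMl ?exprn_ge0.
have h1 : x <= x ^+ 2 by rewrite expr2 ler_peMl.
rewrite !mulrDl (le_trans (ler_normD _ _))// lerD//; last first.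
  by rewrite normrM (ger0_norm (exprn_ge0 2 x0)) ler_wpM2l.
rewrite (le_trans (ler_normD _ _))// lerD//.
  by rewrite ler_peMr// (le_trans x1)// (le_trans h1).
by rewrite normrM (ger0_norm x0) ler_wpM2l// (le_trans h1).
Qed.

Lemma continuous_sqr_comp f : continuous f -> continuous (fun x => f x ^+ 2).
Proof. by move=> cf x; apply: (cvgM (cf x) (cf x)). Qed.

Section one_variance.
Variable l : R.
Hypothesis l0 : 0 < l.
Local Notation phi := (gpdf l).
Local Notation Q := (Qtail l).

Let ln0 : l != 0. Proof. by rewrite gt_eqF. Qed.

Lemma integral_gpdf_tail_mean a : 0 <= a ->
  (\int[mu]_(x in `[a, +oo[) (2 * x / l * phi x)%:E = (2 * phi a)%:E)%E.
Proof.
move=> a0; pose F x := - 2 * phi x.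
have dF x : is_derive x 1 F (2 * x / l * phi x).
  have d1 := is_derive_gpdf l0 x.
  by apply: is_derive_eq; rewrite /GRing.scale/=; field.
rewrite (FTC_tail dF _ _ (l := 0)).
- by rewrite /F; congr EFin; ring.
- move=> x; apply: cvgM; last exact: continuous_gpdf.
  by apply: cvgMl; apply: cvgMr; exact: cvg_id.
- move=> x ax; have x0 := le_trans a0 ax.
  by rewrite mulr_ge0 ?gpdf_ge0// divr_ge0 ?mulr_ge0// ltW.
- have := @decay_quad phi (- 2) 0 0 (gpdf_decay l0).
  by under eq_fun do rewrite !mul0r !addr0.
Qed.

Lemma integral_gpdf_tail a : 0 <= a ->
  (\int[mu]_(x in `[a, +oo[) (2 * phi x)%:E = (Q a)%:E)%E.
Proof.
move=> a0; pose F x := - Q x.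
have dF x : is_derive x 1 F (2 * phi x).
  have d1 := is_derive_Qtail l0 x.
  by apply: is_derive_eq; rewrite opprK.
rewrite (FTC_tail dF _ _ (l := 0)).
- by rewrite sub0r opprK.
- by move=> x; apply: cvgMr; exact: continuous_gpdf.
- by move=> x ax; rewrite mulr_ge0 ?gpdf_ge0.
- have := @decay_quad Q (- 1) 0 0 (Qtail_decay l0).
  by under eq_fun do rewrite !mul0r !addr0 mulN1r.
Qed.

(** First-block factor at level [a]: the square weight at the end value times the factor
    [2 * Z1 / t] of the exchange limit. *)
Lemma integral_gpdf_tail_size_biased c a : 0 <= a ->
  (\int[mu]_(x in `[a, +oo[) ((x + c) ^+ 2 * (2 * x / l) * phi x)%:E =
   (2 * (a + c) ^+ 2 * phi a + 4 * l * phi a + 2 * c * Q a)%:E)%E.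
Proof.
move=> a0; pose F x := - 2 * (x + c) ^+ 2 * phi x - 4 * l * phi x - 2 * c * Q x.
have dF x : is_derive x 1 F ((x + c) ^+ 2 * (2 * x / l) * phi x).
  have d1 := is_derive_gpdf l0 x; have d2 := is_derive_Qtail l0 x.
  by apply: is_derive_eq; rewrite /GRing.scale/=; field.
rewrite (FTC_tail dF _ _ (l := 0)).
- by congr EFin; rewrite /F; ring.
- move=> x; apply: cvgM; last exact: continuous_gpdf.
  apply: cvgM; last by apply: cvgMl; apply: cvgMr; exact: cvg_id.
  by apply: (@continuous_sqr_comp (fun x => x + c)) => y; apply: cvgD; [exact: cvg_id|exact: cvg_cst].
- move=> x ax; have x0 := le_trans a0 ax.
  by rewrite mulr_ge0 ?gpdf_ge0// mulr_ge0 ?sqr_ge0// divr_ge0 ?mulr_ge0// ltW.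
- have h1 := @decay_quad phi (- 2 * c ^+ 2 - 4 * l) (- 4 * c) (- 2) (gpdf_decay l0).
  have h2 := @decay_quad Q (- 2 * c) 0 0 (Qtail_decay l0).
  rewrite -[X in _ --> X]addr0.
  apply: cvg_trans (cvgD h1 h2); apply: near_eq_cvg; apply: nearW => x.
  by rewrite /F fctE; ring.
Qed.

(** Second-block factor for the reversed path: the two squares belong to an end value [- z] and to
    its reflection about [- a], namely [z - 2 * a]. *)
Lemma integral_gpdf_tail_reflected c a : 0 <= a ->
  (\int[mu]_(z in `[a, +oo[) (((c + z) ^+ 2 + (c - z + 2 * a) ^+ 2) * phi z)%:E =
   ((c ^+ 2 + 2 * a * c + 2 * a ^+ 2 + l) * Q a - 2 * a * l * phi a)%:E)%E.
Proof.
move=> a0.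
pose F z := - (c ^+ 2 + 2 * a * c + 2 * a ^+ 2 + l) * Q z - 2 * l * z * phi z + 4 * a * l * phi z.
have dF x : is_derive x 1 F (((c + x) ^+ 2 + (c - x + 2 * a) ^+ 2) * phi x).
  have d1 := is_derive_gpdf l0 x; have d2 := is_derive_Qtail l0 x.
  by apply: is_derive_eq; rewrite /GRing.scale/=; field.
rewrite (FTC_tail dF _ _ (l := 0)).
- by congr EFin; rewrite /F; ring.
- move=> x; apply: cvgM; last exact: continuous_gpdf.
  apply: cvgD.
    apply: (@continuous_sqr_comp (fun z => c + z)) => y.
    by apply: cvgD; [exact: cvg_cst|exact: cvg_id].
  apply: (@continuous_sqr_comp (fun z => c - z + 2 * a)) => y.
  by apply: cvgD; [apply: cvgB; [exact: cvg_cst|exact: cvg_id]|exact: cvg_cst].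
- by move=> x ax; rewrite mulr_ge0 ?gpdf_ge0// addr_ge0 ?sqr_ge0.
- have h1 := @decay_quad phi (4 * a * l) (- 2 * l) 0 (gpdf_decay l0).
  have h2 := @decay_quad Q (- (c ^+ 2 + 2 * a * c + 2 * a ^+ 2 + l)) 0 0 (Qtail_decay l0).
  rewrite -[X in _ --> X]addr0.
  apply: cvg_trans (cvgD h1 h2); apply: near_eq_cvg; apply: nearW => x.
  by rewrite /F fctE; ring.
Qed.

End one_variance.

(** * Integration over the level *)

Section two_variances.
Variables t r : R.
Hypotheses (t0 : 0 < t) (r0 : 0 < r) (tr1 : t + r = 1).
Local Notation phit := (gpdf t).
Local Notation phir := (gpdf r).
Local Notation Qt := (Qtail t).
Local Notation Qr := (Qtail r).
Let g0 : R := gpdf 1 0.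

Let tn0 : t != 0. Proof. by rewrite gt_eqF. Qed.
Let rn0 : r != 0. Proof. by rewrite gt_eqF. Qed.
Let tr0 : 0 < t * r. Proof. exact: mulr_gt0. Qed.

Lemma gpdf_at0 l : 0 < l -> gpdf l 0 = g0 / Num.sqrt l.
Proof.
move=> l0; rewrite /g0 !gpdfE// expr0n/= !mul0r oppr0 expR0 !mulr1 mul1r.
by rewrite -mulrnAr sqrtrM ?ltW// invfM mulrC.
Qed.

(** Since [t + r = 1], the exponents add up through [1 / t + 1 / r = 1 / (t * r)]. *)
Lemma gpdf_mul x : phit x * phir x = g0 * gpdf (t * r) x.
Proof.
rewrite /g0 !gpdfE// expr0n/= !mul0r oppr0 expR0 mulr1 mul1r mulrACA -expRD [RHS]mulrA.
have p0 : 0 <= pi *+ 2 :> R by rewrite mulrn_wge0// pi_ge0.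
rewrite -!mulrnAr !sqrtrM ?(ltW t0) ?(ltW r0) ?(ltW tr0)// !invfM.
congr (_ * expR _); first by ring.
have rE : r = 1 - t by rewrite -tr1 addrC addKr.
by rewrite rE; field; rewrite -rE rn0 tn0.
Qed.

(** At 0 this is the probability that a centred Gaussian of variance [r] exceeds in absolute value
    an independent one of variance [t]. *)
Definition cross_tail : R -> R := utail (fun x => 2 * phit x * Qr x).

Let cint : continuous (fun x => 2 * phit x * Qr x).
Proof.
move=> x; apply: cvgM; last exact: continuous_Qtail.
by apply: cvgMr; exact: continuous_gpdf.
Qed.

Let int4 : mu.-integrable setT (EFin \o (fun x => 4 * phit x)).
Proof.
have h : mu.-integrable setT (EFin \o phit) by exact: integrable_gpdf.
exact: (@integrableZl _ _ _ mu setT measurableT 4 _ h).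
Qed.

Let cint_le x : 2 * phit x * Qr x <= 4 * phit x.
Proof.
have := Qtail_le2 r x; have := gpdf_ge0 t x; nra.
Qed.

Let cint_ge0 x : 0 <= 2 * phit x * Qr x.
Proof. by rewrite mulr_ge0 ?Qtail_ge0// mulr_ge0 ?gpdf_ge0. Qed.

Lemma integrable_cross : mu.-integrable setT (EFin \o (fun x => 2 * phit x * Qr x)).
Proof.
apply: le_integrable int4 => //.
  by apply/measurable_EFinP; exact: continuous_measurable_fun.
by move=> x _ /=; rewrite lee_fin ger0_norm// (le_trans (cint_le x))// ler_norm.
Qed.

Lemma is_derive_cross x : is_derive x 1 cross_tail (- (2 * phit x * Qr x)).
Proof. exact: is_derive_utail integrable_cross cint. Qed.

Lemma cross_decay : decay cross_tail.
Proof.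
have [C hC] := Qtail_decay t0; exists (2 * C) => x x1.
rewrite ger0_norm; last exact: utail_ge0.
apply: (@le_trans _ _ (utail (fun x => 4 * phit x) x)).
  by apply: le_utail => //; exact: integrable_cross.
rewrite utailZ; last exact: integrable_gpdf.
have := hC _ x1; rewrite ger0_norm ?Qtail_ge0// /Qtail -mulrA; lra.
Qed.

(* Density in the level [a] of E[(V_t + c)^2]: the first term comes from
   {tau <= 1 - t}, the second one from the time-reversed path. *)
Definition moment_density c a : R :=
  Qr a * (2 * (a + c) ^+ 2 * phit a + 4 * t * phit a + 2 * c * Qt a) +
  2 * phir a * ((c ^+ 2 + 2 * a * c + 2 * a ^+ 2 + t) * Qt a - 2 * a * t * phit a).

(* Primitive of [moment_density], found by integrating by parts with
   [phi' = - (x / l) phi] and [Q' = - 2 phi]; [cross_tail] is the only part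
   without a closed form. *)
Let F c a : R := - (c ^+ 2 * Qt a * Qr a) +
  c * (2 * a * Qt a * Qr a - 8 * t * phit a * Qr a - 8 * r * phir a * Qt a +
       8 * g0 * Qtail (t * r) a) +
  (- (2 * t * a * phit a * Qr a) - 4 * r * a * phir a * Qt a - (t + 2 * r) * Qt a * Qr a -
   (2 * t - 2 * r) * cross_tail a + 8 * t * r * phit a * phir a).

Let is_derive_F c x : is_derive x 1 (F c) (moment_density c x).
Proof.
have dM (f g : R -> R) df dg : is_derive x 1 f df -> is_derive x 1 g dg ->
    is_derive x 1 (fun y => f y * g y) (f x * dg + g x * df).
  by move=> h1 h2; apply: is_derive_eq.
have dZ k (f : R -> R) df : is_derive x 1 f df -> is_derive x 1 (fun y => k * f y) (k * df).
  by move=> h1; apply: is_derive_eq.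
have dD (f g : R -> R) df dg : is_derive x 1 f df -> is_derive x 1 g dg ->
    is_derive x 1 (fun y => f y + g y) (df + dg).
  by move=> h1 h2; apply: is_derive_eq.
have d1 := is_derive_gpdf t0 x; have d2 := is_derive_gpdf r0 x.
have d3 := is_derive_Qtail t0 x; have d4 := is_derive_Qtail r0 x.
have d5 := is_derive_Qtail tr0 x; have d6 := is_derive_cross x.
have dx : is_derive x 1 (fun y : R => y) 1 by exact: is_derive_id.
have qq := dM _ _ _ _ d3 d4; have pq := dM _ _ _ _ d1 d4.
have qp := dM _ _ _ _ d2 d3; have pp := dM _ _ _ _ d1 d2.
have D := dD _ _ _ _ (dD _ _ _ _ (dD _ _ _ _ (dD _ _ _ _ (dD _ _ _ _ (dD _ _ _ _ (dD _ _ _ _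
  (dD _ _ _ _ (dZ (- c ^+ 2 - (t + 2 * r)) _ _ qq) (dZ (2 * c) _ _ (dM _ _ _ _ dx qq)))
  (dZ (- 8 * c * t) _ _ pq)) (dZ (- 8 * c * r) _ _ qp)) (dZ (8 * c * g0) _ _ d5))
  (dZ (- 2 * t) _ _ (dM _ _ _ _ dx pq))) (dZ (- 4 * r) _ _ (dM _ _ _ _ dx qp)))
  (dZ (- (2 * t - 2 * r)) _ _ d6)) (dZ (8 * t * r) _ _ pp).
have FE : F c = fun y => (- c ^+ 2 - (t + 2 * r)) * (Qt y * Qr y) + 2 * c * (y * (Qt y * Qr y)) +
  - 8 * c * t * (phit y * Qr y) + - 8 * c * r * (phir y * Qt y) + 8 * c * g0 * Qtail (t * r) y +
  - 2 * t * (y * (phit y * Qr y)) + - 4 * r * (y * (phir y * Qt y)) +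
  - (2 * t - 2 * r) * cross_tail y + 8 * t * r * (phit y * phir y).
  apply/funext => y; rewrite /F; clear.
  move: (phit y) (phir y) (Qt y) (Qr y) (Qtail (t * r) y) (cross_tail y) g0 => p q a b e k g.
  ring.
rewrite FE; move: D; set dF := (X in is_derive _ _ _ X) => D.
suff -> : moment_density c x = dF by [].
rewrite /dF /moment_density.
have g00 : g0 != 0 by rewrite gt_eqF// gpdf_gt0.
(* In the coefficient of [c] the products with [Qr] and [Qt] leave [16 * t] and [16 * r] times
   [phit * phir]; with [t + r = 1] this cancels the density of variance [t * r]. *)
have -> : gpdf (t * r) x = phit x * phir x / g0 by rewrite gpdf_mul mulrAC mulfV// mul1r.
have tE : t = 1 - r by rewrite -tr1 addrK.
move: (phit x) (phir x) (Qt x) (Qr x) g0 g00 => p q a b g g00.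
have := tn0; rewrite tE => t'.
by field; rewrite rn0 t' g00.
Qed.

Let F_cvg c : F c x @[x --> +oo] --> (0 : R).
Proof.
have bQ (l : R) (g : R -> R) : 0 < l -> decay g -> decay (fun x => g x * Qtail l x).
  by move=> l0 dg; apply: (decayMl dg) => x _; exact: Qtail_bounded.
have h1 := decay_quad (- c ^+ 2 - (t + 2 * r)) (2 * c) 0 (bQ r Qt r0 (Qtail_decay t0)).
have h2 := decay_quad (- 8 * c * t) (- 2 * t) 0 (bQ r phit r0 (gpdf_decay t0)).
have h3 := decay_quad (- 8 * c * r) (- 4 * r) 0 (bQ t phir t0 (gpdf_decay r0)).
have h4 := decay_quad (8 * c * g0) 0 0 (Qtail_decay tr0).
have h5 := decay_quad (- (2 * t - 2 * r)) 0 0 cross_decay.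
have h6 := decay_quad (8 * t * r) 0 0 (decayMl (gpdf_decay t0) (fun x _ => gpdf_bounded r0 x)).
have z0 : 0 = 0 + 0 + 0 + 0 + 0 + 0 :> R by rewrite !addr0.
rewrite [X in _ --> X]z0.
apply: cvg_trans (cvgD (cvgD (cvgD (cvgD (cvgD h1 h2) h3) h4) h5) h6).
apply: near_eq_cvg; apply: nearW => x.
rewrite /F; do 5 rewrite fctE; clear.
move: (phit x) (phir x) (Qt x) (Qr x) (Qtail (t * r) x) (cross_tail x) g0 => p q a b e k g.
ring.
Qed.

Lemma continuous_moment_density c : continuous (moment_density c).
Proof.
have c1 := continuous_gpdf t0; have c2 := continuous_gpdf r0.
have c3 := continuous_Qtail t0; have c4 := continuous_Qtail r0.
have cz k (f : R -> R) : continuous f -> continuous (fun x => k * f x).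
  by move=> cf x; apply: cvgM; [exact: cvg_cst|exact: cf].
have cD (f g : R -> R) : continuous f -> continuous g -> continuous (fun x => f x + g x).
  by move=> cf cg x; apply: cvgD; [exact: cf|exact: cg].
have cM (f g : R -> R) : continuous f -> continuous g -> continuous (fun x => f x * g x).
  by move=> cf cg x; apply: cvgM; [exact: cf|exact: cg].
have cid : continuous (fun x : R => x) by move=> x; exact: cvg_id.
have cc (k : R) : continuous (fun x : R => k) by move=> x; exact: cvg_cst.
have -> : moment_density c = fun a => Qr a * (2 * (a + c) ^+ 2 * phit a + 4 * t * phit a + 2 * c * Qt a) +
  2 * phir a * ((c ^+ 2 + 2 * c * a + 2 * a ^+ 2 + t) * Qt a + (- 2 * t) * a * phit a).
  apply/funext => a; rewrite /moment_density; clear.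
  by move: (phit a) (phir a) (Qt a) (Qr a) => p q u v; ring.
apply: (cD); apply: (cM) => //.
- apply: (cD); last exact: cz.
  apply: (cD); last exact: cz.
  by apply: (cM) => //; apply: (cz); apply: (@continuous_sqr_comp (fun x => x + c)); exact: cD.
- exact: cz.
- apply: (cD); last by apply: (cM) => //; exact: cz.
  apply: (cM) => //; apply: (cD) => //; apply: (cD); last first.
    by apply: (cz); exact: (@continuous_sqr_comp (fun x => x)).
  by apply: (cD) => //; exact: cz.
Qed.

(** The primitive vanishes at infinity, so the value is minus the primitive at 0, where both tails
    equal 1 and each density is [g0] over the standard deviation. Half the coefficient of [c]
    becomes the first moment, the part free of [c] the second. *)
Lemma integral_moment_density c : (forall a, 0 <= a -> 0 <= moment_density c a) ->
  (\int[mu]_(a in `[0%R, +oo[) (moment_density c a)%:E =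
   (c ^+ 2 + 2 * c * (4 * g0 * (Num.sqrt t + Num.sqrt r - 1)) +
   (t + 2 * r + (2 * t - 2 * r) * cross_tail 0 - 8 * g0 ^+ 2 * Num.sqrt (t * r)))%:E)%E.
Proof.
move=> m0; rewrite (FTC_tail (is_derive_F c) (@continuous_moment_density c) m0 (F_cvg c)).
rewrite sub0r /F !Qtail0// !gpdf_at0//; congr EFin.
have ht := sqr_sqrtr (ltW t0); have hr := sqr_sqrtr (ltW r0).
rewrite sqrtrM ?(ltW t0)//.
have st : 0 < Num.sqrt t by rewrite sqrtr_gt0.
have sr : 0 < Num.sqrt r by rewrite sqrtr_gt0.
move: (cross_tail 0) g0 => k g.
clear m0; move: (Num.sqrt t) (Num.sqrt r) ht hr st sr => s q ht hr s0 q0.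
rewrite -ht -hr.
by field; rewrite !gt_eqF.
Qed.

End two_variances.
End gaussian_integrals.

(** * The arcsine *)

Section cross_tail_value.
Context {R : realType}.
Local Notation mu := (@lebesgue_measure R).
Variables t r : R.
Hypotheses (t0 : 0 < t) (r0 : 0 < r) (tr1 : t + r = 1).
Local Notation phit := (gpdf t).
Local Notation phir := (gpdf r).
Local Notation Qr := (Qtail r).
Implicit Types a v x : R.

Let tn0 : t != 0. Proof. by rewrite gt_eqF. Qed.
Let rn0 : r != 0. Proof. by rewrite gt_eqF. Qed.

Lemma gpdf10_sqr : gpdf 1 0 ^+ 2 = (2 * pi)^-1 :> R.
Proof.
rewrite gpdfE// expr0n/= !mul0r oppr0 expR0 mulr1 mul1r exprVn sqr_sqrtr ?mulr_natl//.
by rewrite mulrn_wge0// pi_ge0.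
Qed.

Let scale_derive (f : R -> R) a x df : is_derive (a * x) 1 f df ->
  is_derive x 1 (fun y => f (a * y)) (a * df).
Proof.
move=> hf; have h1 : is_derive x 1 (fun y => a * y) a.
  by apply: is_derive_eq; rewrite /GRing.scale/= mulr1.
by have := is_derive1_comp hf h1; rewrite mulrC.
Qed.

Let scale_cont (f : R -> R) a : continuous f -> continuous (fun y => f (a * y)).
Proof.
move=> cf x; apply: (cvg_comp (fun y => a * y) f); last exact: cf.
by apply: cvgMr; exact: cvg_id.
Qed.

(* At [0] the cross tail becomes an elementary double integral once [Qtail r a]
   is written as an integral over multiples of [a]. *)
Lemma Qtail_scale a : 0 < a ->
  (\int[mu]_(v in `[1%R, +oo[) (2 * a * phir (a * v))%:E = (Qr a)%:E)%E.
Proof.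
move=> a0; pose F v := - Qr (a * v).
have dF v : is_derive v 1 F (2 * a * phir (a * v)).
  have d1 := scale_derive (is_derive_Qtail r0 (a * v)).
  by apply: is_derive_eq; ring.
rewrite (FTC_tail dF _ _ (l := 0)).
- by rewrite /F sub0r opprK mulr1.
- move=> v; apply: cvgMr; exact: (scale_cont (continuous_gpdf r0)).
- by move=> v _; rewrite !mulr_ge0 ?gpdf_ge0// ltW.
- rewrite -[X in _ --> X]oppr0; apply: cvgN.
  have := @decay_quad _ Qr 1 0 0 (Qtail_decay r0).
  under eq_fun do rewrite !mul0r !addr0 mul1r.
  move=> /cvgrPdist_le h; apply/cvgrPdist_le => e e0.
  have [M [_ hM]] := h e e0.
  exists (M / a); split; first exact: num_real.
  by move=> v; rewrite ltr_pdivrMr// mulrC => /hM.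
Qed.

(** The product [phit a * phir (a * v)] is a constant times [expR (- (s v * a ^+ 2 / 2))]. *)
Let s v : R := t^-1 + v ^+ 2 / r.
Let s0 v : 0 < s v.
Proof. by rewrite ltr_pwDl ?invr_gt0// divr_ge0 ?sqr_ge0// ltW. Qed.

Lemma integral_gpdf_scaled_pair v :
  (\int[mu]_(a in `[0%R, +oo[) (4 * a * phit a * phir (a * v))%:E =
   (4 * Num.sqrt t * Num.sqrt r / (2 * pi) / (r + t * v ^+ 2))%:E)%E.
Proof.
pose F a := - (4 / s v) * (phit a * phir (v * a)).
have dF a : is_derive a 1 F (4 * a * phit a * phir (a * v)).
  have d1 := is_derive_gpdf t0 a.
  have d2 := scale_derive (is_derive_gpdf r0 (v * a)).
  apply: is_derive_eq; rewrite /GRing.scale/= (mulrC a v).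
  rewrite (_ : _ + _ = - (a * s v * phit a * phir (v * a))); last by rewrite /s; field; rewrite ?tn0 ?rn0.
  by field; rewrite gt_eqF.
rewrite (FTC_tail dF _ _ (l := 0)).
- rewrite /F mulr0 (gpdf_at0 t0) (gpdf_at0 r0); congr EFin.
  have := gpdf10_sqr; move: (gpdf 1 0) => g hg.
  have st : Num.sqrt t != 0 by rewrite gt_eqF ?sqrtr_gt0.
  have sr : Num.sqrt r != 0 by rewrite gt_eqF ?sqrtr_gt0.
  have h : r + t * v ^+ 2 != 0 by rewrite gt_eqF// ltr_wpDr// mulr_ge0 ?sqr_ge0// ltW.
  have sE : s v = (r + t * v ^+ 2) / (Num.sqrt t ^+ 2 * Num.sqrt r ^+ 2).
    rewrite !sqr_sqrtr ?ltW// /s; field; rewrite ?tn0 ?rn0//.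
  rewrite sE; move: (r + t * v ^+ 2) (Num.sqrt t) (Num.sqrt r) h st sr => D p q D0 p0 q0.
  apply: (@eq_trans _ _ (4 * p * q * g ^+ 2 / D)); last by rewrite hg.
  by field; rewrite D0 p0 q0.
- move=> a; apply: cvgM; last first.
    by under eq_fun do rewrite mulrC; rewrite mulrC; exact: (scale_cont (continuous_gpdf r0)).
  by apply: cvgM; [apply: cvgMr; exact: cvg_id|exact: continuous_gpdf].
- by move=> a a0; rewrite !mulr_ge0 ?gpdf_ge0.
- have dd := decayMl (gpdf_decay t0) (fun x (_ : 1 <= x) => gpdf_bounded r0 (v * x)).
  have := @decay_quad _ _ (- (4 / s v)) 0 0 dd.
  by under eq_fun do rewrite !mul0r !addr0.
Qed.

Let continuous_cauchy k : continuous (fun v => k / (1 + (k * v) ^+ 2)).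
Proof.
have pos x : 0 < 1 + x ^+ 2 by rewrite ltr_pwDl// sqr_ge0.
move=> v; apply: cvgMr; apply: cvgV; first by rewrite gt_eqF.
apply: cvgD; first exact: cvg_cst.
exact: (@scale_cont (fun x => x ^+ 2) k (@continuous_sqr_comp _ (fun x => x) (fun x => @cvg_id _ _))).
Qed.

Lemma integral_atan k : 0 < k ->
  (\int[mu]_(v in `[1%R, +oo[) (k / (1 + (k * v) ^+ 2))%:E = (pi / 2 - atan k)%:E)%E.
Proof.
move=> k0; pose F v := atan (k * v).
have pos x : 0 < 1 + x ^+ 2 by rewrite ltr_pwDl// sqr_ge0.
have dat (x : R) : is_derive x 1 (@atan R) (1 + x ^+ 2)^-1 by exact: is_derive1_atan.
have dF v : is_derive v 1 F (k / (1 + (k * v) ^+ 2)) by exact: (scale_derive (dat (k * v))).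
rewrite (FTC_tail dF _ _ (l := pi / 2)).
- by rewrite /F mulr1.
- exact: continuous_cauchy.
- by move=> v _; rewrite divr_ge0 ?(ltW (pos _))// ltW.
- have /cvgrPdist_le h := @cvgy_atan R; apply/cvgrPdist_le => e e0.
  have [M [_ hM]] := h e e0.
  exists (M / k); split; first exact: num_real.
  by move=> v; rewrite ltr_pdivrMr// mulrC => /hM.
Qed.

Lemma atan_ratio : atan (Num.sqrt t / Num.sqrt r) = asin (Num.sqrt t).
Proof.
have t1 : t < 1 by rewrite -tr1 ltrDl.
have st : 0 < Num.sqrt t < 1.
  by rewrite sqrtr_gt0 t0/= -sqrtr1 ltr_sqrt.
have /andP[st0 st1] := st.
have hs : -1 <= Num.sqrt t <= 1 by rewrite (ltW st1) (le_trans _ (ltW st0)).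
have h : tan (asin (Num.sqrt t)) = Num.sqrt t / Num.sqrt r.
  rewrite /tan asinK ?in_itv//= cos_asin// sqr_sqrtr ?ltW//.
  by rewrite -tr1 addrC addKr.
have m1 : -1 <= Num.sqrt t by rewrite (le_trans _ (ltW st0))// lerN10.
have m1' : -1 < Num.sqrt t by rewrite (le_lt_trans _ st0)// lerN10.
by rewrite -h tanK// in_itv/= asin_gtNpi2 ?asin_ltpi2// ?m1 ?m1' ?(ltW st1).
Qed.

Let cauchy_scale v : 4 * Num.sqrt t * Num.sqrt r / (2 * pi) / (r + t * v ^+ 2) =
  2 / pi * (Num.sqrt t / Num.sqrt r / (1 + (Num.sqrt t / Num.sqrt r * v) ^+ 2)).
Proof.
have pn0 : pi != 0 :> R by rewrite gt_eqF// pi_gt0.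
have st : 0 < Num.sqrt t by rewrite sqrtr_gt0.
have sr : 0 < Num.sqrt r by rewrite sqrtr_gt0.
have D0 : r + t * v ^+ 2 != 0 by rewrite gt_eqF// ltr_wpDr// mulr_ge0 ?sqr_ge0// ltW.
have -> : 1 + (Num.sqrt t / Num.sqrt r * v) ^+ 2 = (r + t * v ^+ 2) / Num.sqrt r ^+ 2.
  by rewrite exprMn expr_div_n !sqr_sqrtr ?ltW//; field; exact: rn0.
move: (@pi R) pn0 (r + t * v ^+ 2) D0 (Num.sqrt t) (Num.sqrt r) st sr.
by move=> p p0 D D0 x y x0 y0; field; rewrite D0 p0 !gt_eqF.
Qed.

(** In the double integral over [a] and the ratio [v], Tonelli puts the integral over [a] inside,
    where the extra factor [a] makes it elementary. What is left is a Cauchy density in [v] over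
    [[1, +oo[], hence an arctangent. *)
Lemma cross_tail0 : cross_tail t r 0 = 1 - 2 / pi * asin (Num.sqrt t).
Proof.
have pn0 : pi != 0 :> R by rewrite gt_eqF// pi_gt0.
have st : 0 < Num.sqrt t by rewrite sqrtr_gt0.
have sr : 0 < Num.sqrt r by rewrite sqrtr_gt0.
pose k := Num.sqrt t / Num.sqrt r.
have k0 : 0 < k by rewrite divr_gt0.
have mk : measurable_fun (`[1, +oo[ : set R) (fun v => (k / (1 + (k * v) ^+ 2))%:E).
  apply: measurable_funTS; apply/measurable_EFinP; apply: continuous_measurable_fun.
  exact: continuous_cauchy.
have k1 v : (0 <= (k / (1 + (k * v) ^+ 2))%:E)%E.
  by rewrite lee_fin divr_ge0 ?(ltW k0)// addr_ge0// sqr_ge0.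
have k2 : (0 <= (2 / pi : R)%:E)%E by rewrite lee_fin divr_ge0// pi_ge0.
suff : (cross_tail t r 0)%:E = (2 / pi * (pi / 2 - atan k))%:E.
  move=> [->]; rewrite atan_ratio; move: (asin _) (@pi R) pn0 => x p p0.
  by field; rewrite p0.
have int := integrable_cross t0 r0.
rewrite -(utailE 0 int).
pose f (z : R * R) : \bar R := ((0 < z.1)%R%:R * (1 <= z.2)%R%:R * (4 * z.1 * phit z.1 * phir (z.1 * z.2)))%:E.
have mphi (l : R) : measurable_fun setT (gpdf l) by exact: measurable_gpdf.
have mf1 : measurable_fun setT (@fst R R) by exact: measurable_fst.
have mf2 : measurable_fun setT (@snd R R) by exact: measurable_snd.
have mf : measurable_fun setT f.
  apply/measurable_EFinP; apply: measurable_funM; first apply: measurable_funM.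
  - by apply: measurable_natr; exact: measurable_fun_ltr.
  - by apply: measurable_natr; exact: measurable_fun_ler.
  - apply: measurable_funM; first apply: measurable_funM.
    + exact: measurable_funM.
    + exact: (measurableT_comp (mphi t)).
    + by apply: (measurableT_comp (mphi r)); exact: measurable_funM.
have f0 z : (0 <= f z)%E.
  rewrite lee_fin; have [z0|_] := ltP 0 z.1; last by rewrite !mul0r.
  by rewrite !mulr_ge0 ?gpdf_ge0// ltW.
have fE a v : f (a, v) = if (0 < a) && (1 <= v) then (4 * a * phit a * phir (a * v))%:E else 0%E.
  rewrite /f; cbn [fst snd]; move: (4 * a * _ * _) => X.
  by case: (0 < a); case: (1 <= v); rewrite /= ?mul0r ?mulr0 ?mul0r ?mul1r ?mul1r.
have ft := @fubini_tonelli _ _ (measurableTypeR R) (measurableTypeR R) R mu mu f mf f0.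
transitivity (\int[mu]_x \int[mu]_y f (x, y))%E.
  rewrite -integral_itv_obnd_cbnd; last first.
    apply: measurable_funTS; apply/measurable_EFinP.
    apply: measurable_funM; last by apply: continuous_measurable_fun; exact: continuous_Qtail.
    exact: measurable_funM.
  rewrite integral_mkcond; apply: eq_integral => a _; rewrite patchE mem_setE in_itv/= andbT.
  have [a0|a0] := ltP 0 a; last first.
    rewrite integral0_eq; [by []|].
    move=> v _; rewrite fE.
    by rewrite (ltNge 0 a) a0.
  rewrite EFinM -(Qtail_scale a0).
  have mi : measurable_fun (`[1, +oo[ : set R) (fun v => (2 * a * phir (a * v))%:E).
    apply: measurable_funTS; apply/measurable_EFinP; apply: measurable_funM; first exact: measurable_cst.
    by apply: (measurableT_comp (mphi r)); exact: measurable_funM.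
  have p1 v : (0 <= (2 * a * phir (a * v))%:E)%E.
    by rewrite lee_fin; apply: mulr_ge0; [apply: mulr_ge0; [exact: ler0n|exact: ltW]|exact: gpdf_ge0].
  have p2 : (0 <= (2 * phit a)%:E)%E.
    by rewrite lee_fin; apply: mulr_ge0; [exact: ler0n|exact: gpdf_ge0].
  rewrite -(ge0_integralZl mu (measurable_itv _) mi (fun v _ => p1 v) p2).
  rewrite integral_mkcond; apply: eq_integral => v _; rewrite patchE mem_setE in_itv/= andbT fE a0/=.
  by case: (1 <= v); [rewrite -EFinM; congr EFin; ring|].
rewrite ft.
transitivity (\int[mu]_(v in `[1%R, +oo[) ((2 / pi)%:E * (k / (1 + (k * v) ^+ 2))%:E))%E.
  rewrite [RHS]integral_mkcond; apply: eq_integral => v _; rewrite patchE mem_setE in_itv/= andbT.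
  have [v1|v1] := leP 1 v; last first.
    rewrite integral0_eq; [by []|].
    by move=> a _; rewrite fE (leNgt 1 v) v1 andbF.
  transitivity (\int[mu]_(a in `[0%R, +oo[) (4 * a * phit a * phir (a * v))%:E)%E.
    rewrite -integral_itv_obnd_cbnd; last first.
      apply: measurable_funTS; apply/measurable_EFinP; apply: measurable_funM.
        by apply: measurable_funM => //; exact: measurable_funM.
      by apply: (measurableT_comp (mphi r)); exact: measurable_funM.
    rewrite [RHS]integral_mkcond; apply: eq_integral => a _; rewrite patchE mem_setE in_itv/= andbT.
    by rewrite fE v1 andbT.
  rewrite integral_gpdf_scaled_pair -EFinM; congr EFin.
  exact: cauchy_scale.
rewrite (ge0_integralZl mu (measurable_itv _) mk (fun v _ => k1 v) k2).
by rewrite (integral_atan k0).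
Qed.

End cross_tail_value.

Section weighted_moments.
Context {d : measure_display} {T : measurableType d} {R : realType}.
Variables (P : probability T R) (B : R -> T -> R).
Hypothesis hB : uniform_bm P B.
Local Notation f w := (bpath B w).
Local Notation tau w := (first_argmin (f w)).
Local Notation mu := (@lebesgue_measure R).

Section level_integrals.
Variables (a0 b0 : R).
Hypotheses (a00 : 0 <= a0) (ab : a0 < b0) (b01 : b0 <= 1).
Local Notation Z := (bZ B a0 b0).
Local Notation M := (bM B a0 b0).
Local Notation l := (b0 - a0).
Let mZ : measurable_fun setT Z. Proof. exact: (measurable_bZ hB). Qed.
Let gZ := @bZ_gaussian _ _ _ P B hB a0 b0 a00 ab b01.

Variable a : R.
Hypothesis a_gt0 : 0 < a.

Lemma level_end_integral (g : R -> R) : measurable_fun setT g -> (forall x, 0 < x -> 0 <= g x) ->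
  (\int[P]_w (g (Z w) * (a < Z w)%R%:R)%:E = \int[mu]_(x in `[a, +oo[) (g x * gpdf l x)%:E)%E.
Proof.
move=> mg g0.
have ma : measurable_fun setT (fun x : R => (a < x)%R%:R : R).
  by apply: measurable_natr; exact: measurable_fun_ltr.
rewrite (ge0_integral_gaussian mZ gZ (f := fun x => (g x * (a < x)%R%:R)%:E)); last 2 first.
- by apply/measurable_EFinP; exact: measurable_funM.
- move=> x; rewrite lee_fin; have [ax|_] := ltP a x; last by rewrite mulr0.
  by rewrite mulr1 g0// (lt_trans a_gt0).
rewrite -integral_itv_obnd_cbnd; last first.
  by apply: measurable_funTS; apply/measurable_EFinP; apply: measurable_funM => //; exact: measurable_gpdf.
rewrite [RHS]integral_mkcond; apply: eq_integral => x _; rewrite patchE mem_setE in_itv/= andbT.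
by case: (a < x)%R; rewrite -EFinM ?mulr1 ?mulr0 ?mul0r.
Qed.

(** The end value is below [- a] in [reflection_tail]; a change of sign makes the integral run over
    the same half-line as that of the first block. *)
Lemma level_max_integral (g : R -> R) : continuous g -> (forall x, 0 <= g x) ->
  (\int[P]_w (g (Z w) * (a < M w)%R%:R)%:E =
   \int[mu]_(z in `[a, +oo[) ((g (- z)%R + g (z - 2 * a)%R) * gpdf l z)%:E)%E.
Proof.
move=> cg g0; rewrite (reflection_tail hB a00 ab b01 cg g0 a_gt0).
have mg : measurable_fun setT g by exact: continuous_measurable_fun.
pose h x := (g x + g (- (2 * a) - x)) * (x <= - a)%R%:R.
have h0 x : 0 <= h x by rewrite mulr_ge0// addr_ge0.
have mh : measurable_fun setT h.
  apply: measurable_funM; last by apply: measurable_natr; exact: measurable_fun_ler.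
  by apply: measurable_funD => //; apply: (measurableT_comp mg); exact: measurable_funB.
rewrite (ge0_integral_gaussian mZ gZ (f := fun x => (h x)%:E)); last 2 first.
- exact/measurable_EFinP.
- by move=> x; rewrite lee_fin.
rewrite -(ge0_integralN (f := fun x => ((h x)%:E * (gpdf l x)%:E)%E)); last 2 first.
- by apply: emeasurable_funM; apply/measurable_EFinP => //; exact: measurable_gpdf.
- by move=> x; rewrite mule_ge0// lee_fin// gpdf_ge0.
rewrite [RHS]integral_mkcond; apply: eq_integral => x _; rewrite patchE mem_setE in_itv/= andbT.
rewrite gpdfN ?subr_gt0// /h lerN2 opprK -EFinM (addrC (- _)).
by case: (a <= x)%R; rewrite ?mulr1 ?mulr0 ?mul0r.
Qed.

End level_integrals.

Variable t : R.
Hypothesis t01 : 0 < t < 1.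
Let t0 : 0 < t. Proof. by case/andP: t01. Qed.
Let t1 : t < 1. Proof. by case/andP: t01. Qed.
Let r0 : 0 < 1 - t. Proof. by rewrite subr_gt0. Qed.

Let msq (c : R) : continuous (fun x => (x + c) ^+ 2).
Proof. by apply: (@continuous_sqr_comp _ (fun x => x + c)) => x; apply: cvgD; [exact: cvg_id|exact: cvg_cst]. Qed.

Let c1 : continuous (fun _ : R => 1 : R). Proof. by move=> x; exact: cvg_cst. Qed.

Let lin (k : R) : measurable_fun setT (fun x : R => 2 * x / k).
Proof. by apply: measurable_funM => //; exact: measurable_funM. Qed.

Lemma early_argmin_moment c :
  (\int[P]_w (vtarget (fun x => (x + c)%R ^+ 2) (fun _ => 1%R) (f w) t (tau w))%:E =
   \int[mu]_(a in `]0%R, +oo[) ((2 * (a + c) ^+ 2 * gpdf t a + 4 * t * gpdf t a + 2 * c * Qtail t a) *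
     Qtail (1 - t) a)%:E)%E.
Proof.
rewrite (vtarget_layers hB (@msq c) c1 (fun x => sqr_ge0 _) (fun _ => ler01) t01).
apply: eq_integral => a; rewrite inE/= in_itv/= andbT => a0; rewrite EFinM; congr (_ * _)%E.
  rewrite (level_end_integral (lexx 0) t0 (ltW t1) a0 (g := fun x => (x + c) ^+ 2 * (2 * x / t))); last 2 first.
  - by apply: measurable_funM => //; apply: continuous_measurable_fun; exact: msq.
  - by move=> x x0; rewrite mulr_ge0 ?sqr_ge0// divr_ge0 ?mulr_ge0// ltW.
  by rewrite subr0 integral_gpdf_tail_size_biased// ltW.
rewrite (level_max_integral (ltW t0) t1 (lexx 1) a0 c1 (fun _ => ler01)).
by rewrite -(integral_gpdf_tail r0 (ltW a0)).
Qed.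

Let cv2 (c : R) : continuous (fun z => (c - z) ^+ 2).
Proof. by apply: (@continuous_sqr_comp _ (fun x => c - x)) => x; apply: cvgB; [exact: cvg_cst|exact: cvg_id]. Qed.

Lemma late_argmin_moment c :
  (\int[P]_w (vtarget (fun _ => 1%R) (fun z => (c - z)%R ^+ 2) (f w) t (tau w))%:E =
   \int[mu]_(a in `]0%R, +oo[) (2 * gpdf t a *
     ((c ^+ 2 + 2 * a * c + 2 * a ^+ 2 + (1 - t)) * Qtail (1 - t) a -
      2 * a * (1 - t) * gpdf (1 - t) a))%:E)%E.
Proof.
rewrite (vtarget_layers hB c1 (@cv2 c) (fun _ => ler01) (fun x => sqr_ge0 _) t01).
apply: eq_integral => a; rewrite inE/= in_itv/= andbT => a0; rewrite EFinM; congr (_ * _)%E.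
  rewrite (level_end_integral (lexx 0) t0 (ltW t1) a0 (g := fun x => 1 * (2 * x / t))); last 2 first.
  - by apply: measurable_funM.
  - by move=> x x0; rewrite mul1r divr_ge0 ?mulr_ge0// ltW.
  rewrite subr0 -(integral_gpdf_tail_mean t0 (ltW a0)).
  by apply: eq_integral => x _; rewrite mul1r.
rewrite (level_max_integral (ltW t0) t1 (lexx 1) a0 (@cv2 c) (fun x => sqr_ge0 _)).
rewrite -(integral_gpdf_tail_reflected r0 c (ltW a0)).
apply: eq_integral => x _; congr (((_ ^+ 2 + _ ^+ 2) * _)%:E); first by rewrite opprK.
by ring.
Qed.

End weighted_moments.

Section total_moment.
Context {R : realType}.
Local Notation mu := (@lebesgue_measure R).
Variables (t : R).
Hypothesis t01 : 0 < t < 1.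
Let t0 : 0 < t. Proof. by case/andP: t01. Qed.
Let r0 : 0 < 1 - t. Proof. by rewrite subr_gt0; case/andP: t01. Qed.
Let tr1 : t + (1 - t) = 1. Proof. by rewrite addrC subrK. Qed.

Definition first_moment : R := Num.sqrt (8 / pi) * (Num.sqrt t + Num.sqrt (1 - t) - 1).
Definition second_moment : R :=
  3 * t + (4 - 8 * t) / pi * asin (Num.sqrt t) - 4 / pi * Num.sqrt (t * (1 - t)).

Let A c a : R := (2 * (a + c) ^+ 2 * gpdf t a + 4 * t * gpdf t a + 2 * c * Qtail t a) * Qtail (1 - t) a.
Let D c a : R := 2 * gpdf (1 - t) a * ((c ^+ 2 + 2 * a * c + 2 * a ^+ 2 + t) * Qtail t a - 2 * a * t * gpdf t a).

Let A_ge0 c a : 0 <= c -> 0 <= a -> 0 <= A c a.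
Proof.
move=> c0 a0; have q0 := Qtail_ge0 t a; have q1 := Qtail_ge0 (1 - t) a; have p0 := gpdf_ge0 t a.
rewrite mulr_ge0// addr_ge0//; first apply: addr_ge0.
- by rewrite mulr_ge0// mulr_ge0// sqr_ge0.
- by rewrite mulr_ge0// mulr_ge0// ltW.
- by rewrite mulr_ge0// mulr_ge0.
Qed.

(** The closed form contains a negative term; the sign comes from its origin as an integral of
    squares. *)
Let D_ge0 c a : 0 <= a -> 0 <= D c a.
Proof.
move=> a0; rewrite mulr_ge0 ?mulr_ge0 ?gpdf_ge0//.
rewrite -lee_fin -(integral_gpdf_tail_reflected t0 c a0); apply: integral_ge0 => x _.
by rewrite lee_fin mulr_ge0 ?gpdf_ge0// addr_ge0 ?sqr_ge0.
Qed.

(** The early and late densities add up to [moment_density]; [0 <= c] ensures the nonnegativity that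
    the improper integral relies on. *)
Lemma total_moment c : 0 <= c ->
  (\int[mu]_(a in `]0%R, +oo[) (A c a)%:E + \int[mu]_(a in `]0%R, +oo[) (D c a)%:E =
   (c ^+ 2 + 2 * c * first_moment + second_moment)%:E)%E.
Proof.
move=> c0.
have mp (l : R) : measurable_fun setT (gpdf l) by exact: measurable_gpdf.
have mq (l : R) : 0 < l -> measurable_fun setT (Qtail l).
  by move=> l0; apply: continuous_measurable_fun; exact: continuous_Qtail.
have mqt := mq t t0; have mqr := mq (1 - t) r0.
have genA (p q q' : R -> R) : measurable_fun setT p -> measurable_fun setT q ->
    measurable_fun setT q' ->
    measurable_fun setT (fun a : R => (2 * (a + c) ^+ 2 * p a + 4 * t * p a + 2 * c * q a) * q' a).
  move=> m1 m2 m3; apply: measurable_funM => //; apply: measurable_funD; last exact: measurable_funM.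
  apply: measurable_funD; last exact: measurable_funM.
  apply: measurable_funM => //; apply: measurable_funM => //.
  by apply: measurable_funX; exact: measurable_funD.
have genD (p p' q : R -> R) : measurable_fun setT p -> measurable_fun setT p' ->
    measurable_fun setT q ->
    measurable_fun setT (fun a : R => 2 * p' a * ((c ^+ 2 + 2 * a * c + 2 * a ^+ 2 + t) * q a - 2 * a * t * p a)).
  move=> m1 m2 m3; apply: measurable_funM; first exact: measurable_funM.
  apply: measurable_funB.
    apply: measurable_funM => //; apply: measurable_funD => //; apply: measurable_funD.
      by apply: measurable_funD => //; apply: measurable_funM => //; exact: measurable_funM.
    by apply: measurable_funM => //; exact: measurable_funX.
  by apply: measurable_funM => //; apply: measurable_funM => //; exact: measurable_funM.
have mA : measurable_fun setT (A c) by exact: (genA _ _ _ (mp t) mqt mqr).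
have mD : measurable_fun setT (D c) by exact: (genD _ _ _ (mp t) (mp (1 - t)) mqt).
clear genA genD.
rewrite -ge0_integralD//; last 4 first.
- by move=> a; rewrite /= in_itv/= andbT => a0; rewrite lee_fin A_ge0// ltW.
- by apply: measurable_funTS; exact/measurable_EFinP.
- by move=> a; rewrite /= in_itv/= andbT => a0; rewrite lee_fin D_ge0// ltW.
- by apply: measurable_funTS; exact/measurable_EFinP.
transitivity (\int[mu]_(a in `[0%R, +oo[) (moment_density t (1 - t) c a)%:E)%E.
  rewrite -integral_itv_obnd_cbnd.
    by apply: eq_integral => a _; rewrite -EFinD /moment_density /A /D mulrC.
  apply: measurable_funTS; apply/measurable_EFinP.
  by apply: continuous_measurable_fun; exact: continuous_moment_density.
rewrite integral_moment_density//; last first.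
  by move=> a a0; rewrite /moment_density mulrC addr_ge0 ?A_ge0 ?D_ge0.
have pi0 : 0 < pi :> R by exact: pi_gt0.
(* The constant of the first moment: the squared standard density at 0 is [1 / (2 * pi)], and 16
   times this is [8 / pi]. *)
have g4 : 4 * gpdf 1 0 = Num.sqrt (8 / pi) :> R.
  apply/eqP; rewrite -(@eqrXn2 _ 2)// ?mulr_ge0 ?gpdf_ge0 ?sqrtr_ge0//.
  rewrite exprMn gpdf10_sqr sqr_sqrtr ?divr_ge0 ?(ltW pi0)//.
  by apply/eqP; move: (@pi R) pi0 => p p0; field; rewrite gt_eqF.
rewrite cross_tail0// gpdf10_sqr g4; congr EFin.
rewrite /first_moment /second_moment.
move: (Num.sqrt (8 / pi)) (Num.sqrt t) (Num.sqrt (1 - t)) (Num.sqrt (t * (1 - t))) (asin _) => s1 s2 s3 s4 x.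
by move: (@pi R) pi0 => p p0; field; rewrite gt_eqF.
Qed.

End total_moment.

(** * Time reversal and conclusion *)

Section uniform_continuity.
Variable R : realType.
Implicit Types (f : R -> R) (x y s : R).

Definition clamp s : R := Num.min 1 (Num.max 0 s).

Lemma clamp_itv s : 0 <= clamp s <= 1.
Proof. by rewrite le_min ler01 le_max lexx/= ge_min lexx. Qed.

Lemma clamp_id s : 0 <= s <= 1 -> clamp s = s.
Proof. by move=> /andP[s0 s1]; rewrite /clamp max_r// min_r. Qed.

Lemma clamp_dist x y : `|clamp x - clamp y| <= `|x - y|.
Proof.
apply: min_dist; first by rewrite subrr normr0.
have h3 := ler_norm (x - y); have h4 := ler_norm (y - x); rewrite distrC in h4.
by rewrite ler_norml; case: (leP 0 x) => hx; case: (leP 0 y) => hy; lra.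
Qed.

(** Uniform continuity on the compact interval by a near-covering argument over radii decreasing to
    0, carried to the line because [clamp] does not increase distances. *)
Lemma clamp_ucont f : {within `[0, 1], continuous f} -> ucont (fun s => f (clamp s)).
Proof.
move=> cf e e0.
have e2 : 0 < e / 2 by rewrite divr_gt0.
have := @segment_compact R 0 1; rewrite compact_near_coveringP => nc.
have := nc R (0 : R)^'+ (fun c x => 0 <= x <= 1 -> forall y, 0 <= y <= 1 -> `|x - y| <= c ->
  `|f x - f y| <= e) _ _.
case.
  move=> x; rewrite /= in_itv/= => x01.
  have /subspace_continuousP := cf => /(_ x); rewrite /= in_itv/= => /(_ x01).
  move=> /cvgrPdist_le /(_ _ e2); rewrite near_withinE => -[c /= c0 hc].
  have c2 : 0 < c / 2 by rewrite divr_gt0.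
  exists (ball x (c / 2), [set y : R | 0 < y < c / 2]) => /=.
    split; first exact: nbhsx_ballx.
    by near=> y; apply/andP; split; near: y; [exact: nbhs_right_gt|exact: nbhs_right_lt].
  move=> [x' i] /= [xx' /andP[i0 ic]] x'01 y y01 x'y.
  have h1 : `|f x - f x'| <= e / 2.
    by apply: (hc x'); [rewrite /=; apply: lt_trans xx' _; lra|rewrite in_itv].
  have h2 : `|f x - f y| <= e / 2.
    apply: (hc y); last by rewrite in_itv.
    rewrite /=; have := ler_distD x' x y; move: xx' x'y ic; rewrite /ball/=; lra.
  have := ler_distD (f x) (f x') (f y); rewrite (distrC (f x') (f x)); lra.
move=> c /= c0 hc; exists (c / 2); first by rewrite divr_gt0.
move=> x y xy; apply: (hc (c / 2)) => /=.
- by rewrite sub0r normrN gtr0_norm ?divr_gt0// ltr_pdivrMr// ltr_pMr// ltr1n.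
- by rewrite divr_gt0.
- by rewrite in_itv/= clamp_itv.
- exact: clamp_itv.
- exact: clamp_itv.
- exact: le_trans (clamp_dist x y) xy.
Unshelve. all: by end_near. Qed.

End uniform_continuity.

Section brownian_symmetries.
Context {d : measure_display} {T : measurableType d} {R : realType}.
Variables (P : probability T R) (B : R -> T -> R).

Let grid_itv n (p : nat -> R) : 0 <= p 0%N -> (forall i, (i < n)%N -> p i <= p i.+1) -> p n <= 1 ->
  forall i, (i <= n)%N -> 0 <= p i <= 1.
Proof.
move=> p0 pS p1 i ni; apply/andP; split.
  by elim: i ni => // i IH ni; rewrite (le_trans (IH (ltnW ni)))// pS.
have h j : (j <= n)%N -> p (n - j)%N <= 1.
  elim: j => [|j IH] jn; first by rewrite subn0.
  by apply: le_trans (IH (ltnW jn)); rewrite -(subnSK jn) pS// ltn_subrL (leq_ltn_trans (leq0n j) jn).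
by rewrite -(subKn ni) h// leq_subr.
Qed.

Lemma clamped_brownian : standard_brownian_motion P B ->
  uniform_bm P (fun s w => B (clamp s) w).
Proof.
move=> hB; split.
- split.
  + by move=> t t01; apply: (bm_measurable hB); exact: clamp_itv.
  + by move=> w; rewrite clamp_id ?lexx ?ler01// (bm_start hB).
  + move=> w; apply: continuous_subspaceT; apply: ucont_continuous.
    exact: (clamp_ucont (@bm_continuous _ _ _ _ _ hB w)).
  + move=> s t s0 st t1 A mA; rewrite !clamp_id ?s0 ?t1 ?(le_trans s0 (ltW st)) ?(le_trans (ltW st) t1)//.
    exact: (bm_gaussian hB).
  + move=> n p p0 pS p1; have pi01 := grid_itv p0 pS p1.
    rewrite (_ : (fun _ => _) = fun (i : 'I_n) w => B (p i.+1) w - B (p i) w).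
      exact: (bm_independent hB).
    by apply/funext => i; apply/funext => w; rewrite !clamp_id ?pi01// ltnW.
- by move=> t; apply: (bm_measurable hB); exact: clamp_itv.
- by move=> w; exact: (clamp_ucont (@bm_continuous _ _ _ _ _ hB w)).
Qed.

(** An increment of the reversed path is minus an increment of [B] over the mirrored interval, so
    Gaussian symmetry applies, and a grid [p] corresponds to the grid [q] read backwards. *)
Lemma reversed_brownian : uniform_bm P B -> uniform_bm P (fun s w => B (1 - s) w - B 1 w).
Proof.
move=> hB; have mB t := ubm_measurable hB t.
have uc w : ucont (fun s => B (1 - s) w - B 1 w).
  move=> e e0; have [c c0 hc] := ubm_ucont hB w e0; exists c => // x y xy.
  rewrite opprB addrA subrK; apply: hc.
  by rewrite opprB addrC addrA subrK distrC.
have mR t : measurable_fun setT (fun w => B (1 - t) w - B 1 w) by exact: measurable_funB.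
split=> //; split=> //.
- by move=> w; rewrite subr0 subrr.
- by move=> w; apply: continuous_subspaceT; exact: ucont_continuous.
- move=> s t s0 st t1 A mA.
  rewrite (_ : t - s = 1 - s - (1 - t)); last by ring.
  have mA' : measurable [set x : R | A (- x)].
    by have := @oppr_measurable R setT measurableT _ mA; rewrite setTI.
  have st' : 1 - t < 1 - s by rewrite ltrD2l ltrN2.
  rewrite -normal_probN ?subr_gt0//.
  rewrite -(bm_gaussian (ubm_bm hB) _ st' _ mA') ?subr_ge0// ?lerBlDr ?lerDl//.
  by congr (P _); apply/seteqP; split => w /=; rewrite opprB; congr (A _); ring.
- move=> n p p0 pS p1 A mA; have pi01 := grid_itv p0 pS p1.
  pose q j := 1 - p (n - j)%N.
  pose A' (j : 'I_n) := [set x : R | A (rev_ord j) (- x)].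
  have mA' j : measurable (A' j).
    by have := @oppr_measurable R setT measurableT _ (mA (rev_ord j)); rewrite setTI.
  have q0 : 0 <= q 0%N by rewrite /q subn0 subr_ge0.
  have qn : q n <= 1 by rewrite /q subnn gerBl.
  have qS i : (i < n)%N -> q i <= q i.+1.
    by move=> ni; rewrite /q lerD2l lerN2 -(subnSK ni) pS// ltn_subrL (leq_ltn_trans (leq0n i) ni).
  have := bm_independent (ubm_bm hB) q0 qS qn mA'.
  have incE (j : 'I_n) w : - (B (q j.+1) w - B (q j) w) =
      B (1 - p (rev_ord j).+1) w - B 1 w - (B (1 - p (rev_ord j)) w - B 1 w).
    by rewrite /q /= subnSK//; ring.
  pose X (i : 'I_n) w := B (1 - p i.+1) w - B 1 w - (B (1 - p i) w - B 1 w).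
  have A'E j w : A' j (B (q j.+1) w - B (q j) w) = A (rev_ord j) (X (rev_ord j) w).
    by rewrite /X -incE.
  have -> : [set w | forall i : 'I_n, A' i (B (q i.+1) w - B (q i) w)] =
      [set w | forall i : 'I_n, A i (X i w)].
    apply/seteqP; split => w h i; last by rewrite A'E; exact: h.
    by have := h (rev_ord i); rewrite A'E rev_ordK.
  move=> ->; rewrite (reindex_inj rev_ord_inj)/=; apply: eq_bigr => i _.
  congr (P _); apply/seteqP; split => w h.
    by have : A' (rev_ord i) (B (q (rev_ord i).+1) w - B (q (rev_ord i)) w) by []; rewrite A'E rev_ordK.
  have : A (rev_ord (rev_ord i)) (X (rev_ord (rev_ord i)) w) by rewrite rev_ordK.
  by rewrite -A'E.
Qed.

End brownian_symmetries.

Section path_identities.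
Variables (R : realType) (f g : R -> R).

Lemma first_argmin_ext : (forall s, 0 <= s <= 1 -> f s = g s) -> first_argmin f = first_argmin g.
Proof.
move=> fg; congr inf; apply/seteqP; split => s [s01 h]; split=> // v v01.
  by rewrite -!fg// h.
by rewrite !fg// h.
Qed.

Hypothesis ug : ucont g.

Lemma vervaat_ext t : 0 <= t <= 1 -> (forall s, 0 <= s <= 1 -> f s = g s) ->
  vervaat f t = vervaat g t.
Proof.
move=> /andP[t0 t1] fg; rewrite /vervaat (first_argmin_ext fg).
have [/andP[u0 u1] _ _] := first_argminP ug.
move: (first_argmin g) u0 u1 => u u0 u1.
by case: (leP t (1 - u)) => h; rewrite !fg//; apply/andP; split; lra.
Qed.

End path_identities.

Section vervaat_split.
Variables (R : realType) (f : R -> R).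
Hypotheses (uf : ucont f) (f0 : f 0 = 0).
Local Notation tau := (first_argmin f).
Hypothesis uniq : forall s, 0 <= s <= 1 -> s != tau -> f tau < f s.
Let g s := f (1 - s) - f 1.
Hypothesis ug : ucont g.

(** Reversal turns the first minimiser into the last one; uniqueness identifies the two. *)
Lemma first_argmin_rev : first_argmin g = 1 - tau.
Proof.
have [/andP[t0 t1] _ _] := first_argminP uf.
have [/andP[s0 s1] gmin _] := first_argminP ug.
have s01 : 0 <= 1 - first_argmin g <= 1 by apply/andP; split; lra.
have [e|ne] := eqVneq (1 - first_argmin g) tau; first by rewrite -e; ring.
have := uniq s01 ne; have := gmin (1 - tau); rewrite /g (_ : 1 - (1 - tau) = tau); last by ring.
by rewrite subr_ge0 t1 gerBl t0 => /(_ isT); lra.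
Qed.

(** When the time window wraps around, its complement is an interval of length [1 - t] ending at
    [tau]. For the reversed path it starts at the argmin, and [V_t] is minus the remaining
    increment, whence the weight [(c - z) ^+ 2]. Excluding [tau = 1 - t] makes exactly one of the
    two targets active. *)
Lemma vervaat_sqr_split c t : tau != 1 - t -> (vervaat f t + c) ^+ 2 =
  vtarget (fun x => (x + c) ^+ 2) (fun _ => 1) f t tau +
  vtarget (fun _ => 1) (fun z => (c - z) ^+ 2) g (1 - t) (first_argmin g).
Proof.
rewrite first_argmin_rev /vervaat /vtarget => taut.
have -> : (t <= 1 - tau) = (tau <= 1 - t) by apply/idP/idP; lra.
have -> : (1 - tau <= 1 - (1 - t)) = ~~ (tau <= 1 - t).
  rewrite -ltNge; apply/idP/idP => [h|]; last by lra.
  by rewrite lt_neqAle eq_sym taut; lra.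
case: (tau <= 1 - t) => /=; first by rewrite mulr1 addr0.
rewrite add0r mul1r /g subrr subr0 subKr f0.
have -> : 1 - (1 - tau + (1 - t)) = tau + t - 1 by ring.
by congr (_ ^+ 2); ring.
Qed.

End vervaat_split.

(** Needed at [t = 1]. Folding the line at 0 produces the sum of two squares of
    [integral_gpdf_tail_reflected] at level 0. *)
Lemma gaussian_square_mean {d : measure_display} {T : measurableType d} {R : realType}
    (P : probability T R) (Y : T -> R) (l c : R) : 0 < l -> measurable_fun setT Y ->
  (forall A, measurable A -> P [set w | A (Y w)] = normal_prob 0 (Num.sqrt l) A) ->
  (\int[P]_w ((Y w + c)%R ^+ 2)%:E = (c ^+ 2 + l)%:E)%E.
Proof.
move=> l0 mY YE; pose mu := @lebesgue_measure R.
have mp : measurable_fun setT (gpdf l) by exact: measurable_gpdf.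
have msq (k : R) : measurable_fun setT (fun x : R => (x + k) ^+ 2).
  by apply: measurable_funX; exact: measurable_funD.
rewrite (ge0_integral_gaussian mY YE (f := fun x => ((x + c) ^+ 2)%:E)); last 2 first.
- exact/measurable_EFinP.
- by move=> x; rewrite lee_fin sqr_ge0.
pose h (x : R) : R := (x + c) ^+ 2 * gpdf l x.
have h0 x : 0 <= h x by rewrite mulr_ge0 ?sqr_ge0 ?gpdf_ge0.
have mh : measurable_fun setT h by exact: measurable_funM.
have mi (b : R -> bool) : measurable_fun setT b -> measurable_fun setT (fun x => (h x * (b x)%:R)%:E).
  by move=> mb; apply/measurable_EFinP; apply: measurable_funM => //; exact: measurable_natr.
have mge : measurable_fun setT (fun x : R => 0 <= x) by exact: measurable_fun_ler.
have mlt : measurable_fun setT (fun x : R => x < 0) by exact: measurable_fun_ltr.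
transitivity (\int[mu]_x ((h x * (0 <= x)%R%:R)%:E + (h x * (x < 0)%R%:R)%:E))%E.
  apply: eq_integral => x _; rewrite -EFinM -EFinD -mulrDr ltNge -/(h x).
  by case: (0 <= x); rewrite /= ?addr0 ?add0r mulr1.
rewrite ge0_integralD//; last 4 first.
- by move=> x _; rewrite lee_fin mulr_ge0.
- exact: (mi _ mge).
- by move=> x _; rewrite lee_fin mulr_ge0.
- exact: (mi _ mlt).
rewrite -[X in (_ + X)%E](ge0_integralN (f := fun x => (h x * (x < 0)%R%:R)%:E)); last 2 first.
- exact: (mi _ mlt).
- by move=> x; rewrite lee_fin mulr_ge0.
have -> : (\int[mu]_x (h (- x)%R * (- x < 0)%R%:R)%:E = \int[mu]_(x in `[0%R, +oo[) (h (- x)%R)%:E)%E.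
  rewrite -integral_itv_obnd_cbnd; last first.
    by apply: measurable_funTS; apply/measurable_EFinP; exact: measurableT_comp.
  rewrite [RHS]integral_mkcond; apply: eq_integral => x _; rewrite patchE mem_setE in_itv/= andbT oppr_lt0.
  by case: (0 < x); rewrite ?mulr1 ?mulr0.
have -> : (\int[mu]_x (h x * (0 <= x)%R%:R)%:E = \int[mu]_(x in `[0%R, +oo[) (h x)%:E)%E.
  rewrite [RHS]integral_mkcond; apply: eq_integral => x _; rewrite patchE mem_setE in_itv/= andbT.
  by case: (0 <= x); rewrite ?mulr1 ?mulr0.
rewrite -ge0_integralD//; last 4 first.
- by move=> x _; rewrite lee_fin.
- by apply: measurable_funTS; exact/measurable_EFinP.
- by move=> x _; rewrite lee_fin.
- by apply: measurable_funTS; apply/measurable_EFinP; exact: measurableT_comp.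
have := integral_gpdf_tail_reflected l0 c (lexx 0).
rewrite Qtail0// mulr1 !(mulr0, mul0r) expr0n/= mulr0 !addr0 subr0 => <-.
by apply: eq_integral => x _; rewrite -EFinD /h gpdfN// -mulrDl addr0 (addrC x) (addrC (- x)).
Qed.

Section vervaat_moments.
Context {d : measure_display} {T : measurableType d} {R : realType}.
Variables (P : probability T R) (B : R -> T -> R).
Hypothesis hB : uniform_bm P B.
Variable t : R.
Hypothesis t01 : 0 <= t <= 1.
Local Notation f w := (bpath B w).
Local Notation tau w := (first_argmin (f w)).
Local Notation V w := (vervaat (f w) t).

Let uf w : ucont (f w). Proof. exact: bpath_ucont hB w. Qed.
Let mB s : measurable_fun setT (B s). Proof. exact: ubm_measurable hB s. Qed.

Lemma measurable_vervaat : measurable_fun setT (fun w => V w).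
Proof.
have mt := measurable_argmin hB; have /andP[t0 t1] := t01.
have mtt : measurable_fun setT (fun w => B (tau w) w).
  by apply: (measurable_at_time hB) => // w; have [/andP[h1 h2] _ _] := first_argminP (uf w); lra.
(* The positive part changes nothing on its branch; it keeps the time admissible on the other one,
   where the branch function must be measurable too. *)
have -> : (fun w => V w) = fun w => if t <= 1 - tau w then B (tau w + t) w - B (tau w) w
    else B (Num.max 0 (tau w + t - 1)) w + B 1 w - B (tau w) w.
  apply/funext => w; rewrite /vervaat /bpath; case: leP => // h.
  by rewrite max_r//; lra.
apply: measurable_fun_ifT.
- by apply: measurable_fun_ler => //; exact: measurable_funB.
- apply: measurable_funB => //; apply: (measurable_at_time hB); first exact: measurable_funD.
  by move=> w; have [/andP[h1 h2] _ _] := first_argminP (uf w); lra.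
- apply: measurable_funB => //; apply: measurable_funD => //.
  apply: (measurable_at_time hB).
    by apply: measurable_maxr => //; apply: measurable_funB => //; exact: measurable_funD.
  move=> w; have [/andP[h1 h2] _ _] := first_argminP (uf w).
  by rewrite le_max lexx/= ge_max; lra.
Qed.

Let interior_moment c : 0 < t < 1 -> 0 <= c ->
  (\int[P]_w ((V w + c)%R ^+ 2)%:E = (c ^+ 2 + 2 * c * first_moment t + second_moment t)%:E)%E.
Proof.
move=> t01' c0; have /andP[t0 t1] := t01'.
have r01 : 0 < 1 - t < 1 by lra.
have hR := reversed_brownian hB.
pose g w := bpath (fun s w => B (1 - s) w - B 1 w) w.
have ug w : ucont (g w) by exact: bpath_ucont hR w.
have csq : continuous (fun x : R => (x + c) ^+ 2).
  by apply: (@continuous_sqr_comp _ (fun x => x + c)) => x; apply: cvgD; [exact: cvg_id|exact: cvg_cst].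
have csq' : continuous (fun x : R => (c - x) ^+ 2).
  by apply: (@continuous_sqr_comp _ (fun x => c - x)) => x; apply: cvgB; [exact: cvg_cst|exact: cvg_id].
have c1 : continuous (fun _ : R => 1 : R) by move=> x; exact: cvg_cst.
pose E w := vtarget (fun x => (x + c) ^+ 2) (fun _ => 1) (f w) t (tau w).
pose L w := vtarget (fun _ => 1) (fun z => (c - z) ^+ 2) (g w) (1 - t) (first_argmin (g w)).
have mE : measurable_fun setT E by exact: (measurable_vtarget hB).
have mL : measurable_fun setT L by apply: (measurable_vtarget hR) => //; rewrite !ltW//; case/andP: r01.
have E0 w : 0 <= E w by rewrite /E /vtarget; case: ifP => // _; rewrite mulr1 sqr_ge0.
have L0 w : 0 <= L w by rewrite /L /vtarget; case: ifP => // _; rewrite mul1r sqr_ge0.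
have mV2 : measurable_fun setT (fun w => ((V w + c) ^+ 2)).
  by apply: measurable_funX; apply: measurable_funD => //; exact: measurable_vervaat.
transitivity (\int[P]_w ((E w)%:E + (L w)%:E))%E.
  apply: ge0_ae_eq_integral => //.
  - exact/measurable_EFinP.
  - by apply: emeasurable_funD; exact/measurable_EFinP.
  - by move=> w _; rewrite lee_fin sqr_ge0.
  - by move=> w _; rewrite -EFinD lee_fin addr_ge0.
  - apply: filterS (ae_unique_argmin hB t01') => w [_ h1 h2] _.
    rewrite -EFinD; congr EFin.
    exact: (@vervaat_sqr_split _ (f w) (uf w) (bpath0 hB w) h1 (ug w) c t h2).
rewrite ge0_integralD//; last 4 first.
- by move=> w _; rewrite lee_fin.
- exact/measurable_EFinP.
- by move=> w _; rewrite lee_fin.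
- exact/measurable_EFinP.
rewrite (early_argmin_moment hB t01' c) (late_argmin_moment hR r01 c) subKr.
exact: total_moment.
Qed.

(** At the endpoints one block has length 0 and the exchange does not apply: there [V_0 = 0] and
    [V_1 = B_1] give the values directly. *)
Lemma vervaat_moment c : 0 <= c ->
  (\int[P]_w ((V w + c)%R ^+ 2)%:E = (c ^+ 2 + 2 * c * first_moment t + second_moment t)%:E)%E.
Proof.
move=> c0; have /andP[t0 t1] := t01.
have [t00|tn0] := eqVneq t 0.
  have -> : c ^+ 2 + 2 * c * first_moment t + second_moment t = c ^+ 2.
    have a0 : asin 0 = 0 :> R.
      by rewrite -{1}sin0 sinK// in_itv/= oppr_le0 divr_ge0// pi_ge0.
    by rewrite /first_moment /second_moment t00 subr0 sqrtr0 sqrtr1 mul0r sqrtr0 a0; ring.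
  transitivity (\int[P]_w (c ^+ 2)%:E)%E; last first.
    by rewrite (ExE P (bdm_cst _)) Ex_cst.
  apply: eq_integral => w _; have [/andP[h1 h2] _ _] := first_argminP (uf w).
  by rewrite t00 /vervaat subr_ge0 h2 addr0 subrr add0r.
have [t11|tn1] := eqVneq t 1.
  have p0 : pi != 0 :> R by rewrite gt_eqF// pi_gt0.
  have -> : c ^+ 2 + 2 * c * first_moment t + second_moment t = c ^+ 2 + 1.
    have a1 : asin 1 = pi / 2 :> R.
      have pp : 0 <= pi / 2 :> R by rewrite divr_ge0// pi_ge0.
      have := @sinK R (pi / 2); rewrite sin_pihalf; apply.
      by rewrite in_itv/= lexx andbT (le_trans _ pp)// oppr_le0.
    rewrite /first_moment /second_moment t11 subrr sqrtr0 sqrtr1 mulr0 sqrtr0 a1.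
    by rewrite addr0 subrr !mulr0; move: (@pi R) p0 => p pn0; field.
  have gB A : measurable A -> P [set w | A (B 1 w)] = normal_prob 0 (Num.sqrt 1) A.
    move=> mA; have := bm_gaussian (ubm_bm hB) (lexx 0) ltr01 (lexx 1) mA; rewrite subr0 => <-.
    by congr (P _); apply/seteqP; split => w /=; rewrite (bm_start (ubm_bm hB)) subr0.
  rewrite -(gaussian_square_mean c ltr01 (mB 1) gB); apply: eq_integral => w _.
  congr (((_ + c) ^+ 2)%:E); have [/andP[h1 h2] _ _] := first_argminP (uf w).
  rewrite t11 /vervaat; case: leP => h.
    have -> : tau w = 0 by lra.
    by rewrite add0r (bpath0 hB) subr0.
  by rewrite addrK addrAC subrr add0r.
apply: interior_moment => //.
by rewrite !lt_neqAle eq_sym tn0 t0 tn1.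
Qed.

(** The case [c = 0] is the second moment. Its finiteness makes [V] integrable, and expanding the
    square for [c = 1] then isolates the first moment. *)
Lemma vervaat_expectations :
  (\int[P]_w (V w)%:E = (first_moment t)%:E /\ \int[P]_w (V w ^+ 2)%:E = (second_moment t)%:E)%E.
Proof.
have mV := measurable_vervaat.
have e0 : (\int[P]_w (V w ^+ 2)%:E = (second_moment t)%:E)%E.
  have := vervaat_moment (lexx 0); rewrite expr0n/= mulr0 mul0r !add0r => <-.
  by apply: eq_integral => w _; rewrite addr0.
split=> //.
have iV2 : P.-integrable setT (EFin \o (fun w => V w ^+ 2)).
  apply/integrableP; split; first by apply/measurable_EFinP; exact: measurable_funX.
  rewrite (_ : (\int[P]_w _)%E = (\int[P]_w (V w ^+ 2)%:E)%E) ?e0 ?ltry//.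
  by rewrite -e0; apply: eq_integral => w _ /=; rewrite ger0_norm ?sqr_ge0.
have i1 : P.-integrable setT (EFin \o (fun _ : T => 1 : R)) by exact: finite_measure_integrable_cst.
have iV : P.-integrable setT (EFin \o (fun w => V w)).
  apply: (le_integrable _ _ _ (integrableD measurableT iV2 i1)) => //.
    exact/measurable_EFinP.
  move=> w _ /=; rewrite lee_fin.
  (* The second square gives [2 * |V| <= V ^+ 2 + 1], which dominates [|V|]. *)
  have s0 := sqr_ge0 (V w); have s1 := sqr_ge0 (`|V w| - 1).
  rewrite (ger0_norm (addr_ge0 s0 ler01)).
  have n2 := real_normK (num_real (V w)); have n0 := normr_ge0 (V w); nra.
have e1 := vervaat_moment ler01.
have i2 : P.-integrable setT (fun w => (2%:E * (V w)%:E)%E) by exact: integrableZl.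
have : (\int[P]_w ((V w + 1)%R ^+ 2)%:E =
    \int[P]_w (V w ^+ 2)%:E + (2%:E * \int[P]_w (V w)%:E + 1))%E.
  rewrite -(integralZl measurableT iV).
  have -> : (1 = \int[P]_w (1 : R)%:E)%E by rewrite (ExE P (bdm_cst _)) Ex_cst.
  rewrite -integralD//= -integralD//=; last exact: integrableD.
  by apply: eq_integral => w _; rewrite -EFinM -!EFinD; congr EFin; ring.
rewrite e1 e0 -(fineK (integrable_fin_num measurableT iV)).
rewrite -EFinM -!EFinD => -[h]; congr EFin; move: h; rewrite /Rintegral; lra.
Qed.

End vervaat_moments.

Theorem proposition4p7 (R : realType) (d : measure_display)
    (T : measurableType d) (P : probability T R) (B : R -> T -> R)
    (hB : standard_brownian_motion P B) (t : R) (ht : 0 <= t <= 1) :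
  'E_P[fun w => vervaat (fun s => B s w) t]%E =
    (Num.sqrt (8 / pi) * (Num.sqrt t + Num.sqrt (1 - t) - 1))%:E /\
  'E_P[fun w => (vervaat (fun s => B s w) t ^+ 2)%R]%E =
    (3 * t + (4 - 8 * t) / pi * asin (Num.sqrt t)
       - 4 / pi * Num.sqrt (t * (1 - t)))%:E.
Proof.
have hC := clamped_brownian hB.
have VE w : vervaat (fun s => B s w) t = vervaat (bpath (fun s w => B (clamp s) w) w) t.
  apply: vervaat_ext => //; first exact: bpath_ucont hC w.
  by move=> s s01; rewrite /bpath clamp_id.
have [e1 e2] := vervaat_expectations hC ht.
rewrite unlock; split; [rewrite -[RHS]e1|rewrite -[RHS]e2]; apply: eq_integral => w _; by rewrite VE.
Qed.
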